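(* Work in either the $C^*$-setting or the $W^*$-setting. Let $X$ be a standard subproduct system, and let $T$ be a completely contractive, covariant representation of $X$ on a Hilbert space $\mathcal{H}$. If $p_1,\ldots,p_t$ and $q_1,\ldots,q_t$ are polynomials over $X$, then $$\Bigl\|\sum_{i=1}^t p_i(T)q_i(T)^*\Bigr\|_{B(\mathcal{H})}\le\Bigl\|\sum_{i=1}^t p_i(S)q_i(S)^*\Bigr\|_{\mathcal{L}(\mathcal{F}_X)}.$$
   Context: Conventions. Hilbert spaces are complex; $C^*$-algebras need not be unital; all representations of operator algebras on Hilbert spaces are assumed nondegenerate. $\mathcal{L}(F)$ denotes the adjointable operators on a Hilbert module $F$. Two settings are considered. $C^*$-setting: $\mathcal{M}$ is a $C^*$-algebra; a correspondence over $\mathcal{M}$ is a right Hilbert $C^*$-module $F$ over $\mathcal{M}$ (inner product $\langle\cdot,\cdot\rangle$ linear in the second variable) with a left action $a\zeta=\varphi(a)\zeta$ given by a $*$-homomorphism $\varphi:\mathcal{M}\to\mathcal{L}(F)$; tensor products are interior tensor products. $W^*$-setting: $\mathcal{M}$ is a von Neumann algebra, correspondences are required to be self-dual with $\varphi$ normal, and tensor products and direct sums of correspondences mean the self-dual completions of the usual ones. Standard subproduct system: a family $X=(X(n))_{n\in\mathbb{Z}_+}$ of correspondences over $\mathcal{M}$ with $X(0)=\mathcal{M}$ such that $X(n+m)$ is an orthogonally complementable sub-bimodule of $X(n)\otimes X(m)$ for all $n,m$ (where $X(n)\otimes\mathcal{M}$ and $\mathcal{M}\otimes X(n)$ are identified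 with $X(n)$ via the module actions, so the left actions are nondegenerate). Put $E=X(1)$; then $X(n)\subseteq E^{\otimes n}$ ($E^{\otimes 0}=\mathcal{M}$), and $p_n\in\mathcal{L}(E^{\otimes n})$ is the orthogonal projection onto $X(n)$. Completely contractive, covariant representation of $X$ on $\mathcal{H}$: a family $T=(T_n)_{n\in\mathbb{Z}_+}$ of linear maps $T_n:X(n)\to B(\mathcal{H})$ such that $\sigma:=T_0$ is a $C^*$-representation of $\mathcal{M}$ on $\mathcal{H}$; each $T_n$ is completely contractive (with $X(n)$ viewed inside its linking algebra); $T_n(\zeta a)=T_n(\zeta)\sigma(a)$ and $T_n(a\zeta)=\sigma(a)T_n(\zeta)$; and $T_{n+m}(p_{n+m}(\zeta\otimes\eta))=T_n(\zeta)T_m(\eta)$ for $\zeta\in X(n),\eta\in X(m)$. In the $W^*$-setting $\sigma$ is also required to be normal, and each $T_n$ continuous from the $\sigma$-topology of $X(n)$ (generated by the functionals $x\mapsto\sum_i\omega_i(\langle\eta_i,x\rangle)$ with $\omega_i\in\mathcal{M}_*$, $\eta_i\in X(n)$, $\sum_i\|\omega_i\|\|\eta_i\|<\infty$) to the ultraweak topology (this continuity is automatic when $\sigma$ is normal). $X$-Fock space and shift: $\mathcal{F}_X=\bigoplus_{n\in\mathbb{Z}_+}X(n)$, and for $\zeta\in X(n)$, $S_n(\zeta)\in\mathcal{L}(\mathcal{F}_X)$ is given by $S_n(\zeta)\eta=p_{n+m}(\zeta\otimes\eta)$ for $\eta\in X(m)$. A polynomial over $X$ is a tuple $p=(\alpha,\zeta_0,\zeta_1,\ldots,\zeta_M)$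 with $\alpha\in\mathbb{C}$, $M\in\mathbb{Z}_+$ and $\zeta_n\in X(n)$ for $0\le n\le M$. One sets $p(T):=\alpha I_{\mathcal{H}}+\sum_{n=0}^M T_n(\zeta_n)\in B(\mathcal{H})$ and $p(S):=\alpha I_{\mathcal{F}_X}+\sum_{n=0}^M S_n(\zeta_n)\in\mathcal{L}(\mathcal{F}_X)$. *)

(* Defs.v *)
From HB Require Import structures.
From mathcomp Require Import all_boot all_order all_algebra.
From mathcomp Require Import complex.
From mathcomp Require Import boolp classical_sets functions reals.
From mathcomp Require Import topology normedtype.

Set Implicit Arguments.
Unset Strict Implicit.
Unset Printing Implicit Defensive.

Import Order.TTheory GRing.Theory Num.Theory.
Import numFieldNormedType.Exports.

Local Open Scope classical_set_scope.
Local Open Scope ring_scope.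

Section ComplexComplete.
Variable R : realType.
Local Notation C := (complex R).

Lemma normc_Re_le (z : C) : `|complex.Re z| <= complex.Re `|z|.
Proof.
rewrite normc_def /= -sqrtr_sqr ler_wsqrtr // lerDl; exact: sqr_ge0.
Qed.

Lemma normc_Im_le (z : C) : `|complex.Im z| <= complex.Re `|z|.
Proof.
rewrite normc_def /= -sqrtr_sqr ler_wsqrtr // lerDr; exact: sqr_ge0.
Qed.

Lemma normc_le_ReIm (z : C) :
  complex.Re `|z| <= `|complex.Re z| + `|complex.Im z|.
Proof.
rewrite normc_def /= -(@ger0_norm _ (`|complex.Re z| + `|complex.Im z|));
  last by rewrite addr_ge0.
rewrite -sqrtr_sqr ler_wsqrtr // sqrrD !real_normK ?num_real //.
by rewrite lerD2r lerDl mulrn_wge0 // mulr_ge0.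
Qed.

Lemma normc_real (z : C) : `|z| = (complex.Re `|z|)%:C%C.
Proof. by rewrite normc_def. Qed.

Lemma complex_complete (F : set_system C^o) :
  ProperFilter F -> cauchy F -> cvg F.
Proof.
move=> FF /cauchy_ballP cF.
have proj_cvg (f : C^o -> R) : (forall z w, `|f z - f w| <= complex.Re `|z - w|) ->
    cvg (f @ F).
  move=> fle; apply/cauchy_cvgP/cauchy_ballP => e e0.
  have e0' : 0 < e%:C%C :> C by rewrite ltcR.
  have := cF _ e0'; rewrite !near_simpl => -[[A B] /= [FA FB] AB].
  exists (f @` A, f @` B).
    split=> /=; [apply: filterS FA|apply: filterS FB] => z Az; exists z => //.
  move=> [_ _] [/= [z Az <-] [w Bw <-]].
  have := AB (z, w) (conj Az Bw); rewrite /ball /= => zw.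
  by apply: le_lt_trans (fle _ _) _; move: zw; rewrite normc_real ltcR.
have /cvg_ex[a Fa] : cvg ((@complex.Re R : C^o -> R) @ F).
  apply: proj_cvg => -[a b] [c d]; exact: normc_Re_le (Complex a b - Complex c d).
have /cvg_ex[b Fb] : cvg ((@complex.Im R : C^o -> R) @ F).
  apply: proj_cvg => -[x y] [c d]; exact: normc_Im_le (Complex x y - Complex c d).
apply/cvg_ex; exists (Complex a b : C^o).
apply/cvgrPdist_lt => /= e; rewrite ltcE /= => /andP[/eqP ime ree].
have e2 : 0 < complex.Re e / 2 by rewrite divr_gt0.
move/cvgrPdist_lt: Fa => /(_ _ e2) Fa.
move/cvgrPdist_lt: Fb => /(_ _ e2) Fb.
have {}Fa : \forall z \near F, `|a - complex.Re z| < complex.Re e / 2 by [].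
have {}Fb : \forall z \near F, `|b - complex.Im z| < complex.Re e / 2 by [].
near=> z.
rewrite normc_real ltcE /= ime eqxx /=.
apply: le_lt_trans (normc_le_ReIm _) _.
have -> : complex.Re (Complex a b - z) = a - complex.Re z by case: (z).
have -> : complex.Im (Complex a b - z) = b - complex.Im z by case: (z).
rewrite [ltRHS]splitr ltrD //; near: z; [exact: Fa|exact: Fb].
Unshelve. all: by end_near. Qed.

End ComplexComplete.

(* The instance [Complete] of [_^o] is taken by realType, hence this alias. *)
Definition complexB (R : realType) : Type := (complex R)^o.
HB.instance Definition _ (R : realType) :=
  NormedModule.copy (complexB R) (complex R)^o.
HB.instance Definition _ (R : realType) :=
  Uniform_isComplete.Build (complexB R) (@complex_complete R).

Record cstarAlg (R : realType) := CStarAlg {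
  calg :> completeNormedModType (complex R) ;
  cmul : calg -> calg -> calg ;
  cstar : calg -> calg ;
  cmulA : associative cmul ;
  cmulDl : left_distributive cmul +%R ;
  cmulDr : right_distributive cmul +%R ;
  cmulZl : forall (c : complex R) a b, cmul (c *: a) b = c *: cmul a b ;
  cmulZr : forall (c : complex R) a b, cmul a (c *: b) = c *: cmul a b ;
  cstarD : forall a b, cstar (a + b) = cstar a + cstar b ;
  cstarZ : forall (c : complex R) a, cstar (c *: a) = conjc c *: cstar a ;
  cstarM : forall a b, cstar (cmul a b) = cmul (cstar b) (cstar a) ;
  cstarK : involutive cstar ;
  cnormM : forall a b, `|cmul a b| <= `|a| * `|b| ;
  cnormV : forall a, `|cmul (cstar a) a| = `|a| ^+ 2 }.

Section ComplexAlg.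
Variable R : realType.
Local Notation C := (complex R).

Let cm (a b : complexB R) : complexB R := (a : C) * (b : C).
Let cs (a : complexB R) : complexB R := conjc (a : C).

Let cmA : associative cm. Proof. exact: mulrA. Qed.
Let cmDl : left_distributive cm +%R. Proof. exact: mulrDl. Qed.
Let cmDr : right_distributive cm +%R. Proof. exact: mulrDr. Qed.
Let cmZl (c : C) a b : cm (c *: a) b = c *: cm a b.
Proof. exact: (esym (mulrA (c : C) a b)). Qed.
Let cmZr (c : C) a b : cm a (c *: b) = c *: cm a b.
Proof. exact: (mulrCA (a : C) c b). Qed.
Let csD a b : cs (a + b) = cs a + cs b.
Proof. exact: (rmorphD (@conjc R)). Qed.
Let csZ (c : C) a : cs (c *: a) = conjc c *: cs a.
Proof. exact: (rmorphM (@conjc R)). Qed.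
Let csM a b : cs (cm a b) = cm (cs b) (cs a).
Proof. by rewrite /cs /cm [LHS](rmorphM (@conjc R)) mulrC. Qed.
Let csK : involutive cs. Proof. exact: conjcK. Qed.
Let cnM a b : `|cm a b| <= `|a| * `|b|.
Proof. by rewrite [leLHS](normrM (a : C) b). Qed.
Let cnV a : `|cm (cs a) a| = `|a| ^+ 2.
Proof. by rewrite [LHS](normrM (conjc a : C) a) normcJ. Qed.

Definition complexAlg : cstarAlg R :=
  @CStarAlg R (complexB R) cm cs
    cmA cmDl cmDr cmZl cmZr csD csZ csM csK cnM cnV.

End ComplexAlg.

Record hilbMod (R : realType) (M : cstarAlg R) := HilbMod {
  hmod :> completeNormedModType (complex R) ;
  hact : hmod -> M -> hmod ;
  hip : hmod -> hmod -> M ;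
  hactDl : forall x y a, hact (x + y) a = hact x a + hact y a ;
  hactDr : forall x a b, hact x (a + b) = hact x a + hact x b ;
  hactZl : forall (c : complex R) x a, hact (c *: x) a = c *: hact x a ;
  hactZr : forall (c : complex R) x a, hact x (c *: a) = c *: hact x a ;
  hactA : forall x a b, hact x (cmul a b) = hact (hact x a) b ;
  hipD : forall x y z, hip x (y + z) = hip x y + hip x z ;
  hipZ : forall (c : complex R) x y, hip x (c *: y) = c *: hip x y ;
  hipA : forall x y a, hip x (hact y a) = cmul (hip x y) a ;
  hipC : forall x y, cstar (hip x y) = hip y x ;
  hip_ge0 : forall x, exists b, hip x x = cmul (cstar b) b ;
  hip_norm : forall x, `|hip x x| = `|x| ^+ 2 }.
Arguments hact {R M h} x a.
Arguments hip {R M h} x y.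

(* Hilbert spaces are the Hilbert modules over the complex numbers, and
   [adjOp H] is then B(H) with its adjoint operation. *)
Notation hilbSpace R := (hilbMod (complexAlg R)).

Section Operators.
Variables (R : realType) (M : cstarAlg R).
Local Notation C := (complex R).

Fact regular_subproof (a b c : M) :
  cmul (cstar a) (cmul b c) = cmul (cmul (cstar a) b) c.
Proof. exact: cmulA. Qed.

Fact regularC_subproof (a b : M) :
  cstar (cmul (cstar a) b) = cmul (cstar b) a.
Proof. by rewrite cstarM cstarK. Qed.

Fact regularZ_subproof (k : C) (a b : M) :
  cmul (cstar a) (k *: b) = k *: cmul (cstar a) b.
Proof. exact: cmulZr. Qed.

Fact regularD_subproof (a b c : M) :
  cmul (cstar a) (b + c) = cmul (cstar a) b + cmul (cstar a) c.
Proof. exact: cmulDr. Qed.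

Definition regularMod : hilbMod M :=
  @HilbMod R M M (@cmul R M) (fun a b => cmul (cstar a) b)
    (@cmulDl R M) (@cmulDr R M) (@cmulZl R M) (fun c x a => cmulZr c x a)
    (@cmulA R M) regularD_subproof regularZ_subproof regular_subproof
    regularC_subproof (fun x => ex_intro _ x erefl) (@cnormV R M).

Record adjOp (F : hilbMod M) := AdjOp {
  afun :> F -> F ;
  aadj : F -> F ;
  adjP : forall x y, hip (afun x) y = hip x (aadj y) }.

(* For an adjointable f this set is bounded, so [sup] is not a default value. *)
Definition opnorm (F : hilbMod M) (f : F -> F) : R :=
  sup [set complex.Re `|f x| | x in [set x : F | `|x| <= 1]].

Definition module_map (F G : hilbMod M) (f : F -> G) : Prop :=
  linear f /\ forall x a, f (hact x a) = hact (f x) a.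

Definition self_dual (F : hilbMod M) : Prop :=
  forall tau : F -> regularMod, module_map tau ->
    (exists c : C, forall x, `|tau x| <= c * `|x|) ->
    exists y, forall x, tau x = hip y x.

(* The norm of a column in the Hilbert module F^k. *)
Definition colnorm (F : hilbMod M) (k : nat) (v : 'I_k -> F) : R :=
  Num.sqrt (complex.Re `|\sum_(i < k) hip (v i) (v i)|).

(* A matrix of operators on F, as an operator on F^k. *)
Definition mxop_norm (F : hilbMod M) (k : nat) (A : 'I_k -> 'I_k -> F -> F) : R :=
  sup [set colnorm (fun i => \sum_(j < k) A i j (v j)) |
       v in [set v : 'I_k -> F | colnorm v <= 1]].

(* In the linking algebra of F, acting on M (+) F, an element x of F is the
   operator a |-> x a from M to F; a matrix over F is normed as an operator
   from M^k to F^k. *)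
Definition mxlink_norm (F : hilbMod M) (k : nat) (x : 'I_k -> 'I_k -> F) : R :=
  sup [set colnorm (fun i => \sum_(j < k) hact (x i j) (a j)) |
       a in [set a : 'I_k -> regularMod | colnorm a <= 1]].

End Operators.
Arguments regularMod {R} M.

(* Here the operators act on a module over some N, not necessarily over M. *)
Definition star_hom (R : realType) (M N : cstarAlg R) (F : hilbMod N)
    (phi : M -> adjOp F) : Prop :=
  [/\ forall a b x, phi (a + b) x = phi a x + phi b x,
      forall (c : complex R) a x, phi (c *: a) x = c *: phi a x,
      forall a b x, phi (cmul a b) x = phi a (phi b x) &
      forall a x, phi (cstar a) x = aadj (phi a) x].

Definition dense_span (R : realType) (V : normedModType (complex R)) (I : Type)
    (f : I -> V) : Prop :=
  closure [set z | exists s : seq I, z = \sum_(i <- s) f i] = setT.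

Definition nondegenerate (R : realType) (M : cstarAlg R) (H : hilbSpace R)
    (sigma : M -> adjOp H) : Prop :=
  dense_span (fun u : M * H => sigma u.1 u.2).

Section WStar.
Variable R : realType.
Local Notation C := (complex R).

Definition sums_to (f : nat -> C) (l : C) : Prop :=
  (fun n => \sum_(i < n) f i : complexB R) @ \oo --> (l : complexB R).

(* Used for nonnegative terms only. *)
Definition bounded_sums (f : nat -> C) : Prop :=
  exists B : C, forall n, \sum_(i < n) f i <= B.

(* Continuity from the topology generated by the functionals FU to the one
   generated by the functionals FV. *)
Definition weak_continuous (U V : Type) (FU : set (U -> C)) (FV : set (V -> C))
    (f : U -> V) : Prop :=
  forall (x0 : U) (g : V -> C) (e : C), FV g -> 0 < e ->
  exists (m : nat) (h : 'I_m -> U -> C) (d : C),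
    [/\ 0 < d, forall i, FU (h i) &
        forall x, (forall i, `|h i x - h i x0| < d) -> `|g (f x) - g (f x0)| < e].

Definition ultraweak (H : hilbSpace R) : set (adjOp H -> C) :=
  [set f | exists xi eta : nat -> H,
     bounded_sums (fun i => `|xi i| * `|eta i|) /\
     forall A : adjOp H, sums_to (fun i => hip (xi i) (A (eta i)) : C) (f A)].

(* A von Neumann algebra structure on M: a faithful representation on some
   Hilbert space whose image is its own double commutant. *)
Record vonNeumann (M : cstarAlg R) := VonNeumann {
  vspace : hilbSpace R ;
  vrep : M -> adjOp vspace ;
  vrep_hom : star_hom vrep ;
  vrep_faithful : forall a, (forall x, vrep a x = 0) -> a = 0 ;
  vrep_bicommutant : forall A : adjOp vspace,
    (forall B : adjOp vspace, (forall a x, B (vrep a x) = vrep a (B x)) ->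
       forall x, A (B x) = B (A x)) ->
    exists a, forall x, A x = vrep a x }.

Section Predual.
Variables (M : cstarAlg R) (v : vonNeumann M).

Definition predual : set (M -> C) :=
  [set w | exists2 f, ultraweak f & forall a, w a = f (vrep v a)].

(* c bounds the norms of the functionals w. *)
Definition predual_seq (w : nat -> M -> C) (c : nat -> C) : Prop :=
  forall i, predual (w i) /\ forall a, `|w i a| <= c i * `|a|.

Definition sigma_functional (F : hilbMod M) : set (F -> C) :=
  [set f | exists w c (eta : nat -> F),
     [/\ predual_seq w c, bounded_sums (fun i => c i * `|eta i|) &
         forall x, sums_to (fun i => w i (hip (eta i) x)) (f x)]].

(* The weak-star continuous functionals on the W*-algebra L(F). *)
Definition adj_predual (F : hilbMod M) : set (adjOp F -> C) :=
  [set f | exists w c (xi eta : nat -> F),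
     [/\ predual_seq w c, bounded_sums (fun i => c i * (`|xi i| * `|eta i|)) &
         forall A : adjOp F, sums_to (fun i => w i (hip (xi i) (A (eta i)))) (f A)]].

End Predual.
End WStar.

Inductive setting (R : realType) (M : cstarAlg R) :=
  | CStarSetting
  | WStarSetting of vonNeumann M.
Arguments CStarSetting {R M}.

Record corr (R : realType) (M : cstarAlg R) := Corr {
  cmod :> hilbMod M ;
  lact : M -> adjOp cmod ;
  lact_hom : star_hom lact }.
Arguments lact {R M c} a.

Section Correspondences.
Variables (R : realType) (M : cstarAlg R).
Local Notation C := (complex R).

Fact lmul_subproof (a x y : regularMod M) :
  hip (cmul a x : regularMod M) y = hip x (cmul (cstar a) y : regularMod M).
Proof. by rewrite /= cstarM cmulA. Qed.

Definition lmul (a : M) : adjOp (regularMod M) :=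
  @AdjOp R M (regularMod M) (cmul a) (cmul (cstar a)) (lmul_subproof a).

Fact lmul_hom : star_hom lmul.
Proof.
split=> [a b x|c a x|a b x|//]; [exact: cmulDl|exact: cmulZl|].
exact/esym/cmulA.
Qed.

Definition regularCorr : corr M := Corr lmul_hom.

Definition wf_corr (s : setting M) (F : corr M) : Prop :=
  if s is WStarSetting v then
    self_dual F /\ weak_continuous (predual v) (@adj_predual R M v F) lact
  else True.

Definition bimodule_isometry (F G : corr M) (j : F -> G) : Prop :=
  [/\ module_map j, forall a x, j (lact a x) = lact a (j x) &
      forall x y, hip (j x) (j y) = hip x y].

(* G is the self-dual completion of F: it is self-dual and j identifies it
   with the module of all bounded module maps from F to M. *)
Definition self_dual_completion (F G : corr M) (j : F -> G) : Prop :=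
  [/\ bimodule_isometry j, self_dual G &
      forall tau : F -> regularMod M, module_map tau ->
        (exists c : C, forall x, `|tau x| <= c * `|x|) ->
        exists! y, forall x, tau x = hip y (j x)].

Definition interior_tensor (F G FG : corr M) (t : F -> G -> FG) : Prop :=
  [/\ (forall y, linear (t ^~ y)) /\ (forall x, linear (t x)),
      forall x a y, t (hact x a) y = t x (lact a y),
      (forall x y a, t x (hact y a) = hact (t x y) a) /\
      (forall a x y, t (lact a x) y = lact a (t x y)),
      forall x y x' y', hip (t x y) (t x' y') = hip y (lact (hip x x') y') &
      dense_span (fun u : F * G => t u.1 u.2)].

Definition tensor_product (s : setting M) (F G FG : corr M)
    (t : F -> G -> FG) : Prop :=
  if s is WStarSetting _ then
    exists (K : corr M) (t0 : F -> G -> K) (j : K -> FG),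
      [/\ interior_tensor t0, self_dual_completion j &
          forall x y, t x y = j (t0 x y)]
  else interior_tensor t.

Definition cstar_direct_sum (X : nat -> corr M) (F : corr M)
    (iota : forall n, X n -> F) : Prop :=
  [/\ forall n, bimodule_isometry (iota n),
      forall n m (x : X n) (y : X m), n <> m -> hip (iota n x) (iota m y) = 0 &
      dense_span (fun u : {n : nat & X n} => iota (projT1 u) (projT2 u))].

Definition direct_sum (s : setting M) (X : nat -> corr M) (F : corr M)
    (iota : forall n, X n -> F) : Prop :=
  if s is WStarSetting _ then
    exists (K : corr M) (iota0 : forall n, X n -> K) (j : K -> F),
      [/\ cstar_direct_sum iota0, self_dual_completion j &
          forall n x, iota n x = j (iota0 n x)]
  else cstar_direct_sum iota.

(* The families (X(n)) with X(0) = M, and (E^{(x)n}) with E^{(x)0} = M and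
   E^{(x)1} = E; these equations hold by computation. *)
Definition fiber (Y : nat -> corr M) (n : nat) : corr M :=
  if n is k.+1 then Y k else regularCorr.

Definition tpower (E : corr M) (Y : nat -> corr M) (n : nat) : corr M :=
  match n with 0 => regularCorr | 1 => E | k.+2 => Y k end.

(* XK is an orthogonally complementable sub-bimodule of the tensor product Y of
   XF and XG, where Y and XK both sit in P via kappa and incK. *)
Definition complementable_in_tensor (s : setting M) (F G XF XG XK P : corr M)
    (incF : XF -> F) (incG : XG -> G) (incK : XK -> P) (t : F -> G -> P) : Prop :=
  exists (Y : corr M) (tY : XF -> XG -> Y) (kappa : Y -> P) (i : XK -> Y),
    [/\ wf_corr s Y /\ tensor_product s tY,
        bimodule_isometry kappa,
        forall x y, kappa (tY x y) = t (incF x) (incG y),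
        bimodule_isometry i /\ (forall x, kappa (i x) = incK x) &
        forall y, exists x, forall x', hip (i x') (y - i x) = 0].

End Correspondences.
Arguments regularCorr {R} M.

Section SubproductData.
Variables (R : realType) (M : cstarAlg R).

(* sp_mul presents the (n + m)-th tensor power of E = X(1) as the tensor product
   of the n-th and m-th ones; the index k = n + m avoids transports along the
   associativity of addition. *)
Record sp_data := SpData {
  sp_fiber : nat -> corr M ;
  sp_tensor : nat -> corr M ;
  sp_mul : forall n m k, (n + m)%N = k ->
    tpower (sp_fiber 0) sp_tensor n -> tpower (sp_fiber 0) sp_tensor m ->
    tpower (sp_fiber 0) sp_tensor k ;
  sp_inc : forall n, fiber sp_fiber n -> tpower (sp_fiber 0) sp_tensor n }.

Definition spX (D : sp_data) : nat -> corr M := fiber (sp_fiber D).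
Definition spE (D : sp_data) : nat -> corr M :=
  tpower (sp_fiber D 0) (sp_tensor D).
Definition mulE (D : sp_data) n m k (e : (n + m)%N = k) :
  spE D n -> spE D m -> spE D k := sp_mul e.
Definition inc (D : sp_data) n : spX D n -> spE D n := @sp_inc D n.

End SubproductData.

Record standard_subproduct (R : realType) (M : cstarAlg R) (s : setting M) := StandardSubproduct {
  spd :> sp_data M ;
  sp_wf : forall n, wf_corr s (spX spd n) /\ wf_corr s (spE spd n) ;
  sp_mul_tensor : forall n m k (e : (n + m)%N = k),
    tensor_product s (@mulE R M spd n m k e) ;
  sp_mul0l : forall n (e : (0 + n)%N = n) (a : M) (x : spE spd n),
    @mulE R M spd 0 n n e a x = lact a x ;
  sp_mul0r : forall n (e : (n + 0)%N = n) (x : spE spd n) (a : M),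
    @mulE R M spd n 0 n e x a = hact x a ;
  sp_mulA : forall n m k nm mk nmk (e1 : (n + m)%N = nm) (e2 : (nm + k)%N = nmk)
      (e3 : (m + k)%N = mk) (e4 : (n + mk)%N = nmk)
      (x : spE spd n) (y : spE spd m) (z : spE spd k),
    mulE e2 (mulE e1 x y) z = mulE e4 x (mulE e3 y z) ;
  sp_inc_isom : forall n, bimodule_isometry (@inc R M spd n) ;
  sp_inc0 : forall a : M, @inc R M spd 0 a = a ;
  sp_inc1 : forall x : spX spd 1, @inc R M spd 1 x = x ;
  sp_standard : forall n m k (e : (n + m)%N = k),
    complementable_in_tensor s (@inc R M spd n) (@inc R M spd m)
      (@inc R M spd k) (@mulE R M spd n m k e) }.

Section Fock.
Variables (R : realType) (M : cstarAlg R) (s : setting M).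
Variable X : standard_subproduct s.
Local Notation C := (complex R).

(* p_n, with values in X(n) rather than in E^{(x)n}. *)
Definition sp_proj n (z : spE X n) : spX X n :=
  xget 0 [set x | forall y, hip (inc y) (z - inc x) = 0].

(* p_{n+m}(x (x) y). *)
Definition sp_prod n m (x : spX X n) (y : spX X m) : spX X (n + m) :=
  sp_proj (mulE erefl (inc x) (inc y)).

(* A model of the X-Fock space with its shift; it is unique up to unitary
   equivalence. *)
Record fock := Fock {
  fspace : corr M ;
  fwf : wf_corr s fspace ;
  finc : forall n, spX X n -> fspace ;
  fshift : forall n, spX X n -> adjOp fspace ;
  fdirect_sum : direct_sum s finc ;
  fshiftE : forall n m (x : spX X n) (y : spX X m),
    fshift x (finc y) = finc (sp_prod x y) }.

Record covariant_rep (H : hilbSpace R) (T : forall n, spX X n -> adjOp H) : Prop :=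
  CovariantRep {
  rep_hom : star_hom (T 0 : M -> adjOp H) ;
  rep_nondegenerate : nondegenerate (T 0 : M -> adjOp H) ;
  rep_linear : forall n h, linear (fun x : spX X n => T n x h) ;
  rep_cc : forall n k (x : 'I_k -> 'I_k -> spX X n),
    mxop_norm (fun i j => T n (x i j)) <= mxlink_norm x ;
  rep_right : forall n (x : spX X n) (a : M) h,
    T n (hact x a) h = T n x (T 0 a h) ;
  rep_left : forall n (a : M) (x : spX X n) h,
    T n (lact a x) h = T 0 a (T n x h) ;
  rep_mul : forall n m (x : spX X n) (y : spX X m) h,
    T (n + m)%N (sp_prod x y) h = T n x (T m y h) ;
  rep_normal : if s is WStarSetting v then
      weak_continuous (predual v) (@ultraweak R H) (T 0 : M -> adjOp H) /\
      forall n, weak_continuous (@sigma_functional R M v (spX X n))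
                  (@ultraweak R H) (T n)
    else True }.

Record sp_poly := Polynomial {
  pconst : C ;
  pdeg : nat ;
  pcoef : forall n : 'I_pdeg.+1, spX X n }.
Arguments pcoef : clear implicits.

Section Eval.
Variables (N : cstarAlg R) (F : hilbMod N) (T : forall n, spX X n -> adjOp F).
Variable p : sp_poly.

Let pf (x : F) : F := pconst p *: x + \sum_(n < (pdeg p).+1) T (pcoef p n) x.
Let pa (x : F) : F :=
  conjc (pconst p) *: x + \sum_(n < (pdeg p).+1) aadj (T (pcoef p n)) x.

Fact peval_subproof x y : hip (pf x) y = hip x (pa y).
Proof.
have ipDl (a b c : F) : hip (a + b) c = hip a c + hip b c.
  by rewrite -hipC hipD cstarD !hipC.
have ipZl (k : C) (a b : F) : hip (k *: a) b = conjc k *: hip a b.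
  by rewrite -hipC hipZ cstarZ hipC.
rewrite /pf /pa ipDl hipD ipZl hipZ; congr (_ + _).
elim/big_rec2: _ => [|i b c _ IH].
  have h0 : hip (0 : F) y = 0 by rewrite -[0 in LHS](scale0r (0 : F)) ipZl conjc0 scale0r.
  by rewrite h0 -[0 in RHS](scale0r (0 : F)) hipZ scale0r.
by rewrite ipDl hipD IH adjP.
Qed.

(* p(T), or p(S) when T is the shift. *)
Definition peval : adjOp F := AdjOp peval_subproof.

End Eval.
End Fock.

(* Main.v *)
(* The proof is by a Poisson kernel.  Let T~_n : X(n) (x) H -> H, x (x) h |-> T_n(x) h,
   which is a contraction, and Q_n = T~_n T~_n^*, so that Q_0 = I and
   T~_n (I (x) Q_1) T~_n^* = Q_{n+1}; this is where X(n+1) is complemented in X(n) (x) X(1).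
   For 0 < r < 1 put D = I - r^2 Q_1 >= 0, and let H_D be H with the inner product <h, D l>.
   The map Phi : F_X (x) H_D -> H, x (x) h |-> r^n T_n(x) D h for x in X(n), satisfies
   Phi Phi^* = sum_n r^(2n) (Q_n - r^2 Q_{n+1}) = I by telescoping, and
   Phi (S_n(x) (x) I) = r^n T_n(x) Phi.  With r T = (r^n T_n)_n this gives
   sum_i p_i(r T) q_i(r T)^* = Phi (sum_i p_i(S) q_i(S)^* (x) I) Phi^*, whose norm is at most
   that of sum_i p_i(S) q_i(S)^*; let r tend to 1.

   Completions are avoided: the tensor products are represented by finite lists over a
   positive definite kernel, and a vector Phi^* h by approximants.  Positivity of the kernels
   and contractivity of T~_n follow from finite approximate frames <x, y> ~ sum_i <x, e_i> <e_i, y>.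
   In the W*-setting, the density of the algebraic tensor product and direct sum, after
   tensoring with H, follows from the bicommutant theorem and self-duality. *)

Require Import Defs.
From HB Require Import structures.
From mathcomp Require Import all_boot all_order all_algebra.
From mathcomp Require Import complex ring lra.
From mathcomp Require Import boolp classical_sets functions reals.
From mathcomp Require Import topology normedtype.

Set Implicit Arguments.
Unset Strict Implicit.
Unset Printing Implicit Defensive.

Import Order.TTheory GRing.Theory Num.Theory.
Import numFieldNormedType.Exports.
Local Open Scope classical_set_scope.
Local Open Scope ring_scope.

(** The form [<h, D l>] stands in for the defect operator [D^(1/2)]: it needs only that [D >= 0]
    commutes with [T_0]. The factor [r < 1] makes the remainder [r^(2 N) Q_N] of the telescoped sum
    vanish, so nothing has to be known about the limit of [Q_n]. Products [p q^*] are accessible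
    because the intertwining dualises to [Phi^* q(r T)^* = (q(S)^* (x) I) Phi^*]: pairing two such
    vectors puts both polynomials on the Fock space. An [adjOp] is just a pair of functions adjoint
    to each other, a Hilbert module only grants that [<x, x>] is some [b^* b], and [M] may have no
    unit; linearity, boundedness, the order and Cauchy-Schwarz are derived. Square roots come from a
    fixed-point iteration, and positivity of [x^* x] from algebra, for operators on a module and
    then for left multiplications on [M]. A self-dual completion is given by functionals and carries
    no density statement; density is recovered in the seminorms that vectors of the space of [M]
    induce, and normality of [T_0] transfers it to [H]. *)

Section RealNorm.
Variable R : realType.
Local Notation C := (complex R).

(* Norms take values in [C]; [nr] and [cab] are the underlying reals. *)
Definition nr (V : normedModType C) (x : V) : R := complex.Re `|x|.
Definition cab (z : C) : R := complex.Re `|z|.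

Lemma nrE (V : normedModType C) (x : V) : `|x| = (nr x)%:C%C.
Proof.
have := normr_ge0 x; rewrite /nr lecE => /andP[/eqP].
by case: `|x| => a b /= ->.
Qed.

Lemma cabE (z : C) : `|z| = (cab z)%:C%C. Proof. exact: normc_real. Qed.

Lemma nr_ge0 (V : normedModType C) (x : V) : 0 <= nr x.
Proof. by have := normr_ge0 x; rewrite nrE lecR. Qed.

Lemma cab_ge0 (z : C) : 0 <= cab z.
Proof. by have := normr_ge0 z; rewrite cabE lecR. Qed.

Lemma nr0 (V : normedModType C) : nr (0 : V) = 0.
Proof. by rewrite /nr normr0. Qed.

Lemma nr_eq0 (V : normedModType C) (x : V) : nr x = 0 -> x = 0.
Proof. by move=> x0; apply/normr0_eq0; rewrite nrE x0. Qed.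

Lemma nrD (V : normedModType C) (x y : V) : nr (x + y) <= nr x + nr y.
Proof. by have := ler_normD x y; rewrite !nrE -rmorphD lecR. Qed.

Lemma cabD (x y : C) : cab (x + y) <= cab x + cab y.
Proof. by have := ler_normD x y; rewrite !cabE -rmorphD lecR. Qed.

Lemma nrN (V : normedModType C) (x : V) : nr (- x) = nr x.
Proof. by rewrite /nr normrN. Qed.

Lemma cabN (x : C) : cab (- x) = cab x.
Proof. by rewrite /cab normrN. Qed.

Lemma cab0 : cab 0 = 0. Proof. by rewrite /cab normr0. Qed.

Lemma nrBC (V : normedModType C) (x y : V) : nr (x - y) = nr (y - x).
Proof. by rewrite -nrN opprB. Qed.

Lemma cabBC (x y : C) : cab (x - y) = cab (y - x).
Proof. by rewrite -cabN opprB. Qed.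

Lemma nrB_le (V : normedModType C) (x y z : V) : nr (x - z) <= nr (x - y) + nr (y - z).
Proof. by have := nrD (x - y) (y - z); rewrite addrA subrK. Qed.

Lemma cabB_le (x y z : C) : cab (x - z) <= cab (x - y) + cab (y - z).
Proof. by have := cabD (x - y) (y - z); rewrite addrA subrK. Qed.

Lemma nr_le (V : normedModType C) (x y : V) : nr x <= nr (x - y) + nr y.
Proof. by have := nrD (x - y) y; rewrite subrK. Qed.

Lemma cab_le (x y : C) : cab x <= cab (x - y) + cab y.
Proof. by have := cabD (x - y) y; rewrite subrK. Qed.

Lemma nrZ (V : normedModType C) (c : C) (x : V) : nr (c *: x) = cab c * nr x.
Proof.
have := normrZ c x; rewrite !nrE cabE -rmorphM => /eqP.
by rewrite eq_complex /= eqxx andbT => /eqP.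
Qed.

Lemma cabM (x y : C) : cab (x * y) = cab x * cab y.
Proof.
have := normrM x y; rewrite !cabE -rmorphM => /eqP.
by rewrite eq_complex /= eqxx andbT => /eqP.
Qed.

Lemma cabR (t : R) : cab t%:C%C = `|t|.
Proof. by rewrite /cab normc_def /= expr0n /= addr0 sqrtr_sqr. Qed.

Lemma cab1 : cab 1 = 1. Proof. by rewrite (cabR 1) normr1. Qed.

Lemma cabJ (z : C) : cab (conjc z) = cab z.
Proof. by rewrite /cab normcJ. Qed.

Lemma cab_eq0 (z : C) : cab z = 0 -> z = 0.
Proof. by move=> z0; apply/normr0_eq0; rewrite cabE z0. Qed.

Lemma Re_cab (z : C) : complex.Re z <= cab z.
Proof. exact: le_trans (ler_norm _) (normc_Re_le _). Qed.

Lemma NRe_cab (z : C) : - complex.Re z <= cab z.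
Proof. by apply: le_trans (normc_Re_le z); rewrite -normrN ler_norm. Qed.

Lemma mulJ_cab (z : C) : conjc z * z = (cab z ^+ 2)%:C%C.
Proof.
by rewrite [LHS]mulrC -normCK cabE -rmorphXn.
Qed.

Lemma nrZr (V : normedModType C) (t : R) (x : V) : nr (t%:C%C *: x) = `|t| * nr x.
Proof. by rewrite nrZ cabR. Qed.

Lemma nr_sum (V : normedModType C) (I : Type) (s : seq I) (P : pred I) (f : I -> V) :
  nr (\sum_(i <- s | P i) f i) <= \sum_(i <- s | P i) nr (f i).
Proof.
apply: (big_ind2 (fun x y => nr x <= y)) => [|x a y b xa yb|//].
  by rewrite nr0.
exact: le_trans (nrD _ _) (lerD xa yb).
Qed.

Lemma cab_sum (I : Type) (s : seq I) (P : pred I) (f : I -> C) :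
  cab (\sum_(i <- s | P i) f i) <= \sum_(i <- s | P i) cab (f i).
Proof.
apply: (big_ind2 (fun x y => cab x <= y)) => [|x a y b xa yb|//].
  by rewrite cab0.
exact: le_trans (cabD _ _) (lerD xa yb).
Qed.

Lemma ReD (x y : C) : complex.Re (x + y) = complex.Re x + complex.Re y.
Proof. by case: x; case: y. Qed.

Lemma ReN (x : C) : complex.Re (- x) = - complex.Re x.
Proof. by case: x. Qed.

Lemma ReJ (x : C) : complex.Re (conjc x) = complex.Re x.
Proof. by case: x. Qed.

Lemma conjM (x y : C) : conjc (x * y) = conjc x * conjc y.
Proof. exact: (rmorphM (@conjc R)). Qed.

Lemma conjD (x y : C) : conjc (x + y) = conjc x + conjc y.
Proof. exact: (rmorphD (@conjc R)). Qed.

Lemma conjN (x : C) : conjc (- x) = - conjc x.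
Proof. exact: (rmorphN (@conjc R)). Qed.

Lemma conjN1 : conjc (-1) = -1 :> C.
Proof. exact: (rmorphN1 (@conjc R)). Qed.

Lemma conj_sum (I : Type) (s : seq I) (f : I -> C) :
  conjc (\sum_(i <- s) f i) = \sum_(i <- s) conjc (f i).
Proof. exact: (rmorph_sum (@conjc R)). Qed.

Lemma ReZ (t : R) (x : C) : complex.Re (t%:C%C * x) = t * complex.Re x.
Proof. by case: x => a b /=; rewrite mul0r subr0. Qed.

Lemma le0_small (a k : R) : 0 <= k -> (forall e, 0 < e -> a <= e * k) -> a <= 0.
Proof.
move=> k0 h; have [//|a0] := leP a 0.
have k1 : 0 < 2 * k + 1 by rewrite ltr_wpDl // mulr_ge0.
have e0 : 0 < a / (2 * k + 1) by rewrite divr_gt0.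
have := h _ e0; rewrite mulrAC ler_pdivlMr // ler_pM2l //; lra.
Qed.

Lemma le_small (a b k : R) : 0 <= k -> (forall e, 0 < e -> a <= b + e * k) -> a <= b.
Proof.
move=> k0 h; rewrite -subr_le0; apply: (le0_small k0) => e e0.
by rewrite lerBlDl h.
Qed.

(** Restricting to [e <= 1] lets quadratic error terms be absorbed into linear ones. *)
Lemma le_small1 (a b k : R) : 0 <= k -> (forall e, 0 < e -> e <= 1 -> a <= b + e * k) -> a <= b.
Proof.
move=> k0 h; apply: (le_small k0) => e e0.
have [e1|e1] := leP e 1; first exact: h.
by apply: le_trans (h 1 _ _) _ => //; rewrite lerD2l ler_wpM2r // ltW.
Qed.

Lemma nr_eq0_small (V : normedModType C) (x : V) (k : R) :
  0 <= k -> (forall e, 0 < e -> nr x <= e * k) -> x = 0.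
Proof.
move=> k0 h; apply: nr_eq0; apply/eqP; rewrite eq_le nr_ge0 andbT.
exact: le0_small h.
Qed.

Lemma archi_inv (e : R) : 0 < e -> exists N : nat, forall n, (N <= n)%N -> n.+1%:R^-1 <= e.
Proof.
move=> e0; exists (Num.truncn e^-1) => n Nn.
rewrite -[leRHS]invrK lef_pV2 ?posrE ?invr_gt0 ?ltr0n //.
apply/ltW/(lt_le_trans (truncnS_gt _)).
by rewrite ler_nat ltnS.
Qed.

Lemma cauchy_limit (V : completeNormedModType C) (f : nat -> V) :
  (forall e, 0 < e -> exists N, forall n m, (N <= n)%N -> (N <= m)%N -> nr (f n - f m) <= e) ->
  exists l, forall e, 0 < e -> exists N, forall n, (N <= n)%N -> nr (f n - l) <= e.
Proof.
move=> cf.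
have : cvg (f @ \oo).
  apply/cauchy_cvgP/cauchy_ballP => e e0.
  have re : 0 < complex.Re e / 2 by move: e0; rewrite ltcE /= => /andP[_ ?]; rewrite divr_gt0.
  have [N hN] := cf _ re.
  exists (f @` [set n | (N <= n)%N], f @` [set n | (N <= n)%N])%classic => /=.
    by split; exists N => // n /= Nn; exists n.
  move=> [_ _] [/= [n Nn <-] [m Nm <-]].
  rewrite -ball_normE /=.
  have := hN n m Nn Nm; rewrite nrE.
  move: e0 re; rewrite !ltcE /= => /andP[-> _] re h /=.
  by apply: le_lt_trans h _; lra.
move/cvg_ex => [l fl]; exists l => e e0.
move/cvgrPdist_le: fl => /(_ e%:C%C); rewrite ltcR => /(_ e0) [N _ hN].
by exists N => n Nn; rewrite nrBC -lecR -nrE; apply: hN.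
Qed.

(** Vectors known only through their approximants, such as [Phi Psi^* h] below, are obtained this
    way: approximants of tolerance [1/(n+1)] form a Cauchy sequence, and any other approximant is
    compared with its terms. *)
Lemma approx_point (V : completeNormedModType C) (A : R -> V -> Prop) :
  (forall e, 0 < e -> exists x, A e x) ->
  (forall e e' x x', 0 < e -> 0 < e' -> A e x -> A e' x' -> nr (x - x') <= e + e') ->
  exists l, forall e x, 0 < e -> A e x -> nr (x - l) <= e.
Proof.
move=> ex near.
have p n : 0 < n.+1%:R^-1 :> R by rewrite invr_gt0 ltr0n.
pose f n := sval (cid (ex _ (p n))).
have fP n : A n.+1%:R^-1 (f n) by rewrite /f; case: cid.
have [e e0|l fl] := @cauchy_limit V f.
  have [N hN] := @archi_inv (e / 2) ltac:(by rewrite divr_gt0).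
  exists N => n m Nn Nm; have := near _ _ _ _ (p n) (p m) (fP n) (fP m).
  move: (hN n Nn) (hN m Nm) => h1 h2 h3; apply: le_trans h3 _; rewrite [leRHS]splitr; exact: lerD.
exists l => e x e0 Ax.
apply: (@le_small _ _ 2) => // d d0.
have [N hN] := fl _ d0; have [N' hN'] := archi_inv d0.
pose n := maxn N N'.
move: (hN n (leq_maxl _ _)) (hN' n (leq_maxr _ _)) (near _ _ _ _ e0 (p n) Ax (fP n)).
by move: (n.+1%:R^-1) (nrB_le x (f n) l) => u; lra.
Qed.

End RealNorm.

(** * Hilbert modules and pairs of adjoint maps *)

Section HilbBasics.
Variables (R : realType) (M : cstarAlg R).
Local Notation C := (complex R).

Lemma cstar_nr (a : M) : nr (cstar a) = nr a.
Proof.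
have le (b : M) : nr b <= nr (cstar b).
  have h : nr (cmul (cstar b) b) = nr b ^+ 2.
    by apply/eqP; rewrite -(inj_eq (@complexI R)) rmorphXn /= -!nrE cnormV.
  have := cnormM (cstar b) b; rewrite !nrE -rmorphM lecR h expr2.
  have [->|b0] := eqVneq (nr b) 0; first by rewrite nr_ge0.
  by rewrite ler_pM2r // lt_def b0 nr_ge0.
by apply/eqP; rewrite eq_le le -{2}(cstarK a) le.
Qed.

Lemma cmul_nr (a b : M) : nr (cmul a b) <= nr a * nr b.
Proof. by have := cnormM a b; rewrite !nrE -rmorphM lecR. Qed.

Lemma cmulV_nr (a : M) : nr (cmul (cstar a) a) = nr a ^+ 2.
Proof. by apply/eqP; rewrite -(inj_eq (@complexI R)) rmorphXn /= -!nrE cnormV. Qed.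

Lemma cmul0l (a : M) : cmul 0 a = 0.
Proof. by rewrite -[0 in LHS](scale0r 0) cmulZl scale0r. Qed.

Lemma cmul0r (a : M) : cmul a 0 = 0.
Proof. by rewrite -[0 in LHS](scale0r 0) cmulZr scale0r. Qed.

Lemma cmulNl (a b : M) : cmul (- a) b = - cmul a b.
Proof. by rewrite -scaleN1r cmulZl scaleN1r. Qed.

Lemma cmulNr (a b : M) : cmul a (- b) = - cmul a b.
Proof. by rewrite -scaleN1r cmulZr scaleN1r. Qed.

Lemma cmul_suml I (s : seq I) (f : I -> M) b :
  cmul (\sum_(i <- s) f i) b = \sum_(i <- s) cmul (f i) b.
Proof. by elim/big_rec2: _ => [|i x y _ <-]; rewrite ?cmul0l ?cmulDl. Qed.

Lemma cmul_sumr I (s : seq I) (f : I -> M) b :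
  cmul b (\sum_(i <- s) f i) = \sum_(i <- s) cmul b (f i).
Proof. by elim/big_rec2: _ => [|i x y _ <-]; rewrite ?cmul0r ?cmulDr. Qed.

Lemma cstar0 : cstar (0 : M) = 0.
Proof. by rewrite -[0 in LHS](scale0r 0) cstarZ conjc0 scale0r. Qed.

Lemma cstarN (a : M) : cstar (- a) = - cstar a.
Proof. by rewrite -scaleN1r cstarZ rmorphN1 scaleN1r. Qed.

Lemma cstar_sum I (s : seq I) (f : I -> M) :
  cstar (\sum_(i <- s) f i) = \sum_(i <- s) cstar (f i).
Proof. by elim/big_rec2: _ => [|i x y _ <-]; rewrite ?cstar0 ?cstarD. Qed.

Variable F : hilbMod M.
Implicit Types x y z : F.

Lemma hip_nr x : nr (hip x x) = nr x ^+ 2.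
Proof. by apply/eqP; rewrite -(inj_eq (@complexI R)) rmorphXn /= -!nrE hip_norm. Qed.

Lemma hipDl x y z : hip (x + y) z = hip x z + hip y z.
Proof. by rewrite -hipC hipD cstarD !hipC. Qed.

Lemma hipZl (c : C) x y : hip (c *: x) y = conjc c *: hip x y.
Proof. by rewrite -hipC hipZ cstarZ hipC. Qed.

Lemma hip0l x : hip 0 x = 0.
Proof. by rewrite -[0 in LHS](scale0r 0) hipZl conjc0 scale0r. Qed.

Lemma hip0r x : hip x 0 = 0.
Proof. by rewrite -[0 in LHS](scale0r 0) hipZ scale0r. Qed.

Lemma hipNl x y : hip (- x) y = - hip x y.
Proof. by rewrite -scaleN1r hipZl rmorphN1 scaleN1r. Qed.

Lemma hipNr x y : hip x (- y) = - hip x y.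
Proof. by rewrite -scaleN1r hipZ scaleN1r. Qed.

Lemma hipBl x y z : hip (x - y) z = hip x z - hip y z.
Proof. by rewrite hipDl hipNl. Qed.

Lemma hipBr x y z : hip x (y - z) = hip x y - hip x z.
Proof. by rewrite hipD hipNr. Qed.

Lemma hipAl x y (a : M) : hip (hact x a) y = cmul (cstar a) (hip x y).
Proof. by rewrite -hipC hipA cstarM hipC. Qed.

Lemma hip_suml I (s : seq I) (f : I -> F) y :
  hip (\sum_(i <- s) f i) y = \sum_(i <- s) hip (f i) y.
Proof. by elim/big_rec2: _ => [|i u v _ <-]; rewrite ?hip0l ?hipDl. Qed.

Lemma hip_sumr I (s : seq I) (f : I -> F) y :
  hip y (\sum_(i <- s) f i) = \sum_(i <- s) hip y (f i).
Proof. by elim/big_rec2: _ => [|i u v _ <-]; rewrite ?hip0r ?hipD. Qed.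

Lemma hip_eq0 x : hip x x = 0 -> x = 0.
Proof.
move=> h; apply: nr_eq0; apply/eqP; rewrite -sqrf_eq0 -hip_nr h.
by rewrite nr0.
Qed.

Lemma hip_inj x y : (forall z, hip z x = hip z y) -> x = y.
Proof.
move=> h; apply/eqP; rewrite -subr_eq0; apply/eqP/hip_eq0.
by rewrite hipBr h subrr.
Qed.

Lemma hip_injl x y : (forall z, hip x z = hip y z) -> x = y.
Proof. by move=> h; apply: hip_inj => z; rewrite -hipC h hipC. Qed.

Lemma hact0l (a : M) : hact (0 : F) a = 0.
Proof. by rewrite -[0 in LHS](scale0r 0) hactZl scale0r. Qed.

(** A relation between plain functions: linearity over the scalars and over [M] follows from it, and
    later boundedness does too. *)
Definition adj (f g : F -> F) := forall x y, hip (f x) y = hip x (g y).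

Lemma adjC f g : adj f g -> adj g f.
Proof. by move=> fg x y; rewrite -hipC -fg hipC. Qed.

Lemma adjOp_adj (A : adjOp F) : adj A (aadj A).
Proof. exact: adjP. Qed.

Section Linear.
Variables (f g : F -> F) (fg : adj f g).

Lemma adjD x y : f (x + y) = f x + f y.
Proof. by apply: hip_injl => z; rewrite fg !hipDl !fg. Qed.

Lemma adjZ (c : C) x : f (c *: x) = c *: f x.
Proof. by apply: hip_injl => z; rewrite fg !hipZl !fg. Qed.

Lemma adjA x a : f (hact x a) = hact (f x) a.
Proof. by apply: hip_injl => z; rewrite fg !hipAl !fg. Qed.

Lemma adj0 : f 0 = 0.
Proof. by rewrite -[0 in LHS](scale0r 0) adjZ scale0r. Qed.

Lemma adjN x : f (- x) = - f x.
Proof. by rewrite -scaleN1r adjZ scaleN1r. Qed.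

Lemma adjB x y : f (x - y) = f x - f y.
Proof. by rewrite adjD adjN. Qed.

Lemma adj_sum I (s : seq I) (h : I -> F) :
  f (\sum_(i <- s) h i) = \sum_(i <- s) f (h i).
Proof. by elim/big_rec2: _ => [|i u v _ <-]; rewrite ?adj0 ?adjD. Qed.

End Linear.

Lemma adj_add f f' g g' : adj f g -> adj f' g' ->
  adj (fun x => f x + f' x) (fun x => g x + g' x).
Proof. by move=> a b x y; rewrite hipDl hipD a b. Qed.

Lemma adj_sub f f' g g' : adj f g -> adj f' g' ->
  adj (fun x => f x - f' x) (fun x => g x - g' x).
Proof. by move=> a b x y; rewrite hipBl hipBr a b. Qed.

Lemma adj_scale (c : C) f g : adj f g ->
  adj (fun x => c *: f x) (fun x => conjc c *: g x).
Proof. by move=> a x y; rewrite hipZl hipZ a. Qed.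

Lemma adj_scaleR (t : R) f g : adj f g ->
  adj (fun x => t%:C%C *: f x) (fun x => t%:C%C *: g x).
Proof. by move=> a x y; rewrite hipZl hipZ a conjc_real. Qed.

Lemma adj_comp f f' g g' : adj f g -> adj f' g' ->
  adj (fun x => f (f' x)) (fun x => g' (g x)).
Proof. by move=> a b x y; rewrite a b. Qed.

Definition bdd (f : F -> F) (c : R) := forall x, nr (f x) <= c * nr x.

End HilbBasics.

(** * Square roots, positivity and the order of a C*-algebra *)

Section Limits.
Variable R : realType.
Local Notation C := (complex R).

Definition cvgto (V : normedModType C) (f : nat -> V) (l : V) :=
  forall e : R, 0 < e -> exists N, forall n, (N <= n)%N -> nr (f n - l) <= e.

Section Lemmas.
Variable V : normedModType C.
Implicit Types (f g : nat -> V) (l k : V).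

Lemma cvgto_unique f l k : cvgto f l -> cvgto f k -> l = k.
Proof.
move=> fl fk; apply/eqP; rewrite -subr_eq0; apply/eqP.
apply: (@nr_eq0_small _ _ _ 2) => // e e0.
have [N hN] := fl _ e0; have [N' hN'] := fk _ e0.
have := nrB_le l (f (maxn N N')) k; rewrite (nrBC l (f _)).
have := hN _ (leq_maxl N N'); have := hN' _ (leq_maxr N N'); lra.
Qed.

Lemma cvgto_cst l : cvgto (fun=> l) l.
Proof. by move=> e e0; exists 0%N => n _; rewrite subrr nr0 ltW. Qed.

Lemma cvgto_add f g l k : cvgto f l -> cvgto g k -> cvgto (fun n => f n + g n) (l + k).
Proof.
move=> fl gk e e0; have e2 : 0 < e / 2 by rewrite divr_gt0.
have [N hN] := fl _ e2; have [N' hN'] := gk _ e2.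
exists (maxn N N') => n; rewrite geq_max => /andP[Nn N'n].
rewrite opprD addrACA; apply: le_trans (nrD _ _) _.
by rewrite [leRHS]splitr lerD ?hN ?hN'.
Qed.

Lemma cvgto_map (W : normedModType C) (h : V -> W) (c : R) f l :
  (forall x y, nr (h x - h y) <= c * nr (x - y)) ->
  cvgto f l -> cvgto (fun n => h (f n)) (h l).
Proof.
move=> hc fl e e0.
have c0 : 0 < `|c| + 1 by rewrite ltr_wpDl.
have [N hN] := fl _ (divr_gt0 e0 c0); exists N => n /hN.
rewrite ler_pdivlMr // => h1; apply: le_trans (hc _ _) (le_trans _ h1).
rewrite mulrC ler_wpM2l ?nr_ge0 //.
by rewrite (le_trans (ler_norm _)) // lerDl.
Qed.

Lemma cvgto_scale (c : C) f l : cvgto f l -> cvgto (fun n => c *: f n) (c *: l).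
Proof. by apply: (@cvgto_map _ _ (cab c)) => x y; rewrite -scalerBr nrZ. Qed.

Lemma cvgto_le f l c : cvgto f l -> (forall n, nr (f n) <= c) -> nr l <= c.
Proof.
move=> fl fc; apply: (@le_small _ _ _ 1) => // e e0; rewrite mulr1.
have [N hN] := fl _ e0; have := hN N (leqnn N); rewrite nrBC.
have := nr_le l (f N); have := fc N; lra.
Qed.

Lemma cvgto_shift f l : cvgto f l -> cvgto (fun n => f n.+1) l.
Proof.
by move=> fl e /fl[N hN]; exists N => n Nn; apply: hN; rewrite (leq_trans Nn).
Qed.

Lemma cvgto_ext f g l : (forall n, f n = g n) -> cvgto f l -> cvgto g l.
Proof. by move=> fg fl e /fl[N hN]; exists N => n; rewrite -fg; exact: hN. Qed.

End Lemmas.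

(* [majorant n] dominates the n-th approximation of [1 - sqrt (1 - p)] when [nr p <= 1]. *)
Fixpoint majorant (n : nat) : R :=
  if n is k.+1 then (1 + majorant k ^+ 2) / 2 else 0.

Lemma majorant_itv n : 0 <= majorant n <= 1.
Proof. elim: n => [|n /andP[h0 h1]] /=; [lra|nra]. Qed.

Lemma majorant_diff n : majorant n.+2 - majorant n.+1 =
  2^-1 * ((majorant n.+1 + majorant n) * (majorant n.+1 - majorant n)).
Proof.
have -> : majorant n.+2 = (1 + majorant n.+1 ^+ 2) / 2 by [].
rewrite {2}[majorant n.+1]/=; move: (majorant n.+1) (majorant n) => a b; lra.
Qed.

Lemma bounded_tail (b : nat -> R) (B e : R) :
  (forall n, b n <= B) -> 0 < e -> exists N, forall n, b n <= b N + e.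
Proof.
move=> bB e0; pose S : set R := range b.
have supS : has_sup S.
  split; first by exists (b 0), 0%N.
  by exists B => _ [n _ <-].
have [_ [N _ <-] h] := sup_adherent e0 supS.
exists N => n; have : b n <= sup S by apply: (ub_le_sup (proj2 supS)); exists n.
by move=> h1; apply: (le_trans h1); rewrite -lerBlDr ltW.
Qed.

Lemma majorant_cauchy (e : R) : 0 < e ->
  exists N, forall n, majorant n <= majorant N + e.
Proof.
by apply: (@bounded_tail majorant 1) => n; have /andP[] := majorant_itv n.
Qed.

(** Increments are compared with those of a bounded sequence rather than a geometric one, since the
    square root iteration has no uniform contraction rate when the norm of [p] is 1. *)
Lemma majorant_limit (V : completeNormedModType C) (f : nat -> V) (k : R) : 0 <= k ->
  (forall n, nr (f n.+1 - f n) <= (majorant n.+1 - majorant n) * k) ->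
  exists l, cvgto f l.
Proof.
move=> k0 fk.
have h n d : nr (f (n + d)%N - f n) <= (majorant (n + d) - majorant n) * k.
  elim: d => [|d IH]; first by rewrite addn0 subrr nr0 subrr mul0r.
  rewrite addnS; apply: le_trans (nrB_le _ (f (n + d)%N) _) _.
  by have := lerD (fk (n + d)%N) IH; rewrite -mulrDl addrA subrK.
apply: cauchy_limit => e e0.
have k1 : 0 < 2 * k + 1 by rewrite ltr_wpDl // mulr_ge0.
have [N hN] := majorant_cauchy (divr_gt0 e0 k1).
have tail n : (N <= n)%N -> nr (f n - f N) <= e / (2 * k + 1) * k.
  move=> Nn; rewrite -(subnKC Nn); apply: le_trans (h _ _) _.
  by apply: ler_wpM2r => //; rewrite subnKC // lerBlDl hN.
exists N => n m /tail hn /tail hm.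
apply: le_trans (nrB_le _ (f N) _) _; rewrite (nrBC (f N)).
have -> : e = e / (2 * k + 1) * (2 * k + 1) by rewrite divfK // gt_eqF.
have : 0 <= e / (2 * k + 1) by rewrite ltW // divr_gt0.
move: (e / (2 * k + 1)) hn hm => u; lra.
Qed.

End Limits.

Section SquareRoot.
Variables (R : realType) (M : cstarAlg R).
Local Notation C := (complex R).

(* [s] plays the role of [1 - sqrt (1 - p)], which makes sense without a unit. *)
Lemma cstar_sqrt (p : M) : cstar p = p -> nr p <= 1 ->
  exists s, cstar s = s /\ p = s + s - cmul s s.
Proof.
move=> ps p1.
(* A fixed point of [s = (p + s^2) / 2] satisfies [p = 2 s - s^2], formally [(1 - s)^2 = 1 - p]. *)
pose f := fix f n : M := if n is k.+1 then (2^-1)%:C%C *: (p + cmul (f k) (f k)) else 0.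
have fS n : f n.+1 = (2^-1)%:C%C *: (p + cmul (f n) (f n)) by [].
have half : `|2^-1| = 2^-1 :> R by rewrite ger0_norm ?invr_ge0.
have fs n : cstar (f n) = f n.
  elim: n => [|n IH]; first exact: cstar0.
  by rewrite fS cstarZ conjc_real cstarD ps cstarM IH.
have fb n : nr (f n) <= majorant R n.
  elim: n => [|n IH]; first by rewrite nr0.
  rewrite fS nrZr half /= mulrC ler_pM2r ?invr_gt0 //; apply: le_trans (nrD _ _) _.
  apply: lerD => //; apply: le_trans (cmul_nr _ _) _; rewrite expr2.
  by apply: ler_pM; rewrite ?nr_ge0.
have fp n : cmul p (f n) = cmul (f n) p.
  elim: n => [|n IH]; first by rewrite cmul0l cmul0r.
  by rewrite fS cmulZl cmulZr cmulDl cmulDr cmulA IH -cmulA IH cmulA.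
have fc n m : cmul (f n) (f m) = cmul (f m) (f n).
  elim: n => [|n IH]; first by rewrite cmul0l cmul0r.
  by rewrite fS cmulZl cmulZr cmulDl cmulDr fp -cmulA IH cmulA IH cmulA.
have step n : nr (f n.+1 - f n) <= (majorant R n.+1 - majorant R n) * 1.
  elim: n => [|n IH].
    rewrite fS cmul0l addr0 subr0 nrZr half /=; lra.
  rewrite [f n.+2]fS [in X in _ - X]fS -scalerBr nrZr half.
  have -> : p + cmul (f n.+1) (f n.+1) - (p + cmul (f n) (f n)) =
      cmul (f n.+1 + f n) (f n.+1 - f n).
    rewrite cmulDl !cmulDr !cmulNr (fc n n.+1) addrA subrK opprD addrACA subrr.
    by rewrite add0r.
  have h := le_trans (cmul_nr _ _) (ler_pM (nr_ge0 _) (nr_ge0 _)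
    (le_trans (nrD _ _) (lerD (fb n.+1) (fb n))) IH).
  by rewrite majorant_diff mulr1 ler_wpM2l ?invr_ge0 //; move: h; rewrite mulr1.
have [s fs'] := majorant_limit ler01 step.
have sq : cvgto (fun n => cmul (f n) (f n)) (cmul s s).
  move=> e e0.
  have c0 : 0 < nr s + 1 by rewrite ltr_wpDl ?nr_ge0.
  have [N hN] := fs' _ (divr_gt0 e0 c0); exists N => n /hN.
  rewrite ler_pdivlMr // => h; apply: le_trans h.
  have -> : cmul (f n) (f n) - cmul s s = cmul (f n) (f n - s) + cmul (f n - s) s.
    by rewrite cmulDl cmulDr cmulNl cmulNr addrA subrK.
  rewrite mulrDr mulr1 addrC; apply: le_trans (nrD _ _) (lerD (cmul_nr _ _) _).
  apply: le_trans (cmul_nr _ _) _; apply: ler_piMl; first exact: nr_ge0.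
  by rewrite (le_trans (fb n)) //; have /andP[] := majorant_itv R n.
exists s; split.
  apply: (@cvgto_unique _ _ (fun n => cstar (f n))).
    apply: (@cvgto_map _ _ _ _ 1) fs' => x y.
    by rewrite mul1r -cstarN -cstarD cstar_nr.
  by apply: cvgto_ext fs' => n; rewrite fs.
have : s = (2^-1)%:C%C *: (p + cmul s s).
  apply: cvgto_unique (cvgto_shift fs') _.
  apply: (cvgto_ext (fun n => esym (fS n))); apply: cvgto_scale.
  exact: cvgto_add (cvgto_cst _) sq.
move=> h; have -> : s + s = p + cmul s s.
  rewrite {1 2}h -scalerDl -rmorphD.
  have -> : 2^-1 + 2^-1 = 1 :> R by lra.
  by rewrite rmorph1 scale1r.
by rewrite addrK.
Qed.

End SquareRoot.

Section Operators.
Variables (R : realType) (M : cstarAlg R) (F : hilbMod M).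
Local Notation C := (complex R).
(** Cauchy-Schwarz is assumed for now: its proof in a general module uses the order of [M], which
    comes from applying these results to [M] over itself, where the inequality is
    submultiplicativity of the norm. *)
Hypothesis CS : forall x y : F, nr (hip x y) <= nr x * nr y.
Implicit Types (f g h k p : F -> F) (x y z : F).

(* Uniform boundedness, by Sokal's argument: each vector [f y] defines the
   functional [x |-> <f y, x> = <y, g x>], bounded pointwise for [y] in the unit ball. *)
Lemma adj_bounded f g : adj f g -> exists c, 0 <= c /\ bdd f c.
Proof.
move=> fg; apply: contrapT => nb.
have big (c : R) : exists y, nr y <= 1 /\ c <= nr (f y).
  apply: contrapT => h; apply: nb; exists `|c|; split=> // x.
  have [x0|x0] := eqVneq (nr x) 0.
    by rewrite (nr_eq0 x0) (adj0 fg) nr0 mulr0.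
  have xp : 0 < nr x by rewrite lt_def x0 nr_ge0.
  rewrite -ler_pdivrMr //; apply: contrapT => /negP; rewrite -ltNge => h2.
  apply: h; exists ((nr x)^-1%:C%C *: x); split.
    by rewrite nrZr ger0_norm ?invr_ge0 ?nr_ge0 // mulVf.
  rewrite (adjZ fg) nrZr ger0_norm ?invr_ge0 ?nr_ge0 // mulrC.
  by apply: le_trans (ltW h2); exact: ler_norm.
pose w n : R := (4 ^+ n)^-1.
have w0 n : 0 < w n by rewrite invr_gt0 exprn_gt0.
have wS n : w n = 4 * w n.+1 by rewrite /w exprS invfM mulrA mulfV ?mul1r // pnatr_eq0.
pose Y n := sval (cid (big (n.+1%:R / w n))).
have Y1 n : nr (Y n) <= 1 by rewrite /Y; case: cid => ? [].
have YB n : n.+1%:R / w n <= nr (f (Y n)) by rewrite /Y; case: cid => ? [].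
have Yp n : 0 < nr (f (Y n)).
  by apply: lt_le_trans (YB n); rewrite divr_gt0 // ltr0n.
pose U n := (nr (f (Y n)))^-1%:C%C *: f (Y n).
have U1 n : nr (U n) = 1.
  by rewrite nrZr ger0_norm ?invr_ge0 ?nr_ge0 // mulVf // gt_eqF.
have UT n : nr (hip (f (Y n)) (U n)) = nr (f (Y n)).
  rewrite hipZ nrZr hip_nr ger0_norm ?invr_ge0 ?nr_ge0 // expr2 mulrA mulVf ?mul1r //.
  by rewrite gt_eqF.
(* If [X n] is not good, adding [w n U n] changes the pairing with [f (Y n)] by
   [w n * nr (f (Y n))], and the triangle inequality makes the new point good. All later moves sum
   to at most [w n / 3], so [1/2 - 1/3 = 1/6] of the unbounded quantity [n + 1] survives at the
   limit. *)
pose good n z := w n / 2 * nr (f (Y n)) <= nr (hip (f (Y n)) z).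
pose X := fix X n : F := if n is k.+1 then
  (if pselect (good k (X k)) then X k else X k + (w k)%:C%C *: U k) else 0.
have XS n : X n.+1 = if pselect (good n (X n)) then X n else X n + (w n)%:C%C *: U n by [].
have Xgood n : good n (X n.+1).
  rewrite XS; case: pselect => gn; first exact: gn.
  have h : nr (hip (f (Y n)) (X n)) < w n / 2 * nr (f (Y n)).
    by rewrite ltNge; apply/negP.
  rewrite /good.
  have := nrD (hip (f (Y n)) (X n + (w n)%:C%C *: U n)) (- hip (f (Y n)) (X n)).
  rewrite nrN -hipBr addrAC subrr add0r hipZ nrZr UT ger0_norm ?(ltW (w0 n)) //.
  move: h; lra.
have Xstep n : nr (X n.+1 - X n) <= w n.
  rewrite XS; destruct (pselect (good n (X n))).
    by rewrite subrr nr0 ltW.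
  by rewrite addrAC subrr add0r nrZr U1 mulr1 ger0_norm // ltW.
have Xd n d : nr (X (n + d)%N - X n) <= 4 / 3 * (w n - w (n + d)%N).
  elim: d => [|d IH]; first by rewrite addn0 !subrr nr0 mulr0.
  rewrite addnS; have := nrB_le (X (n + d).+1) (X (n + d)%N) (X n).
  have := wS (n + d)%N; have := Xstep (n + d)%N; move: IH.
  by move: (w _) (w _) (w _) => a b c; lra.
have Xt n m : (n <= m)%N -> nr (X m - X n) <= 4 / 3 * w n.
  move=> nm; have := Xd n (m - n)%N; rewrite subnKC // => h; apply: le_trans h _.
  by have := w0 m; lra.
have wlt n : w n <= n.+1%:R^-1.
  rewrite lef_pV2 ?posrE ?exprn_gt0 ?ltr0n // -natrX ler_nat.
  exact: ltn_expl.
have [e e0|l Xl] := @cauchy_limit _ _ X.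
  have [N hN] := @archi_inv R (e / 4) ltac:(by rewrite divr_gt0).
  exists N => n m Nn Nm; apply: le_trans (nrB_le _ (X N) _) _.
  rewrite (nrBC (X N)).
  have := Xt _ _ Nn; have := Xt _ _ Nm; have := le_trans (wlt N) (hN N (leqnn N)).
  by move: (w N) e0 => u; lra.
have ln n : nr (l - X n.+1) <= w n / 3.
  apply: (@le_small _ _ _ 1) => // e e0; have [N hN] := Xl _ e0.
  have := hN _ (leq_maxl N n.+1); have := Xt _ _ (leq_maxr N n.+1).
  have := nrB_le l (X (maxn N n.+1)) (X n.+1); rewrite (nrBC l (X (maxn _ _))); have := wS n.
  by move: (w n) (w n.+1) => u v; lra.
have lb n : n.+1%:R / 6 <= nr (g l).
  have h1 : nr (hip (f (Y n)) l) <= nr (g l).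
    rewrite fg; apply: le_trans (CS _ _) _.
    by rewrite ler_piMl ?nr_ge0.
  have h2 := Xgood n; rewrite /good in h2.
  have h3 : nr (hip (f (Y n)) (X n.+1)) <= nr (hip (f (Y n)) l) + nr (f (Y n)) * (w n / 3).
    have := nr_le (hip (f (Y n)) (X n.+1)) (hip (f (Y n)) l).
    rewrite -hipBr => h; apply: le_trans h _; rewrite addrC lerD2l.
    apply: le_trans (CS _ _) _; rewrite ler_wpM2l ?nr_ge0 // nrBC; exact: ln.
  have h4 := YB n; rewrite ler_pdivrMr // in h4.
  by move: h1 h2 h3 h4; move: (n.+1%:R : R) => a; lra.
have [N hN] : exists N : nat, 6 * nr (g l) < N.+1%:R.
  by exists (Num.truncn (6 * nr (g l))); exact: truncnS_gt.
by have := lb N; move: hN; move: (N.+1%:R : R) => u; lra.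
Qed.

Lemma adj_bdd f g c : adj f g -> 0 <= c -> bdd f c -> bdd g c.
Proof.
move=> fg c0 fc x; have [->|x0] := eqVneq (nr (g x)) 0; first by rewrite mulr_ge0 ?nr_ge0.
have gp : 0 < nr (g x) by rewrite lt_def x0 nr_ge0.
rewrite -(ler_pM2l gp) -expr2 -hip_nr -fg.
apply: le_trans (CS _ _) _; have := ler_wpM2r (nr_ge0 x) (fc (g x)).
by rewrite mulrC => h; apply: le_trans h _; rewrite mulrAC mulrC.
Qed.

(** The iteration of [cstar_sqrt], converging vector by vector. Each iterate is a polynomial in [p],
    so it commutes with all that commutes with [p]; passing this to the limit needs [g] continuous,
    hence [adj_bounded]. *)
Lemma op_sqrt p : adj p p -> bdd p 1 ->
  exists s : F -> F, [/\ adj s s, bdd s 1, forall x, p x = s x + s x - s (s x) &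
    forall g g', adj g g' -> (forall x, g (p x) = p (g x)) -> forall x, g (s x) = s (g x)].
Proof.
move=> ps p1.
pose f := fix f n : F -> F := if n is k.+1 then
  (fun x => (2^-1)%:C%C *: (p x + f k (f k x))) else (fun=> 0).
have fS n x : f n.+1 x = (2^-1)%:C%C *: (p x + f n (f n x)) by [].
have half : `|2^-1| = 2^-1 :> R by rewrite ger0_norm ?invr_ge0.
have fs n : adj (f n) (f n).
  elim: n => [|n IH] x y; first by rewrite hip0l hip0r.
  exact: (adj_scaleR _ (adj_add ps (adj_comp IH IH))).
have fb n : bdd (f n) (majorant R n).
  elim: n => [|n IH] x; first by rewrite nr0 mul0r.
  rewrite fS nrZr half /= mulrC mulrAC ler_pM2r ?invr_gt0 //; apply: le_trans (nrD _ _) _.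
  rewrite mulrDl; apply: lerD; rewrite // ?p1 //; apply: le_trans (IH _) _.
  rewrite expr2 -mulrA ler_wpM2l //; have /andP[] := majorant_itv R n => //.
have fc g g' n : adj g g' -> (forall x, g (p x) = p (g x)) -> forall x, g (f n x) = f n (g x).
  move=> gg gp; elim: n => [|n IH] x; first by rewrite (adj0 gg).
  by rewrite !fS (adjZ gg) (adjD gg) gp !IH.
have ff n m x : f n (f m x) = f m (f n x).
  apply: (fc _ _ _ (fs n)) => y.
  by rewrite (fc _ _ _ ps) // => z.
have step x n : nr (f n.+1 x - f n x) <= (majorant R n.+1 - majorant R n) * nr x.
  elim: n x => [|n IH] x.
    rewrite fS addr0 subr0 nrZr half /=; have := p1 x; lra.
  rewrite [f n.+2 x]fS [in X in _ - X]fS -scalerBr nrZr half.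
  have -> : p x + f n.+1 (f n.+1 x) - (p x + f n (f n x)) =
      f n.+1 (f n.+1 x - f n x) + f n (f n.+1 x - f n x).
    by rewrite !(adjB (fs _)) (ff n n.+1) addrA subrK opprD addrACA subrr add0r.
  have h := le_trans (nrD _ _) (lerD (fb n.+1 (f n.+1 x - f n x)) (fb n (f n.+1 x - f n x))).
  have h2 := IH x.
  have a0 : 0 <= majorant R n.+1 + majorant R n.
    by rewrite addr_ge0 //; have /andP[] := majorant_itv R n; have /andP[] := majorant_itv R n.+1.
  have := ler_wpM2l a0 h2; rewrite majorant_diff.
  by move: (majorant R n.+1) (majorant R n) (nr _) (nr _) (nr _) h => a b c d u; lra.
have lim x : exists l, cvgto (f ^~ x) l by exact: majorant_limit (nr_ge0 x) (step x).
pose s x := sval (cid (lim x)).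
have fl x : cvgto (f ^~ x) (s x) by rewrite /s; case: cid.
have sb : bdd s 1.
  move=> x; apply: cvgto_le (fl x) _ => n; apply: le_trans (fb n x) _.
  by rewrite ler_wpM2r ?nr_ge0 //; have /andP[] := majorant_itv R n.
have sadj : adj s s.
  move=> x y; apply: (@cvgto_unique _ _ (fun n => hip (f n x) y)).
    apply: (@cvgto_map _ _ _ (fun u => hip u y) (nr y)) (fl x) => u v.
    by rewrite -hipBl mulrC; exact: CS.
  apply: (@cvgto_ext _ _ (fun n => hip x (f n y))) => [n|]; first by rewrite fs.
  by apply: (@cvgto_map _ _ _ (fun u => hip x u) (nr x)) (fl y) => u v; rewrite -hipBr; exact: CS.
exists s; split=> //.
  move=> x.
  have sq : cvgto (fun n => f n (f n x)) (s (s x)).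
    move=> e e0; have e2 : 0 < e / 2 by rewrite divr_gt0.
    have [N hN] := fl x _ e2; have [N' hN'] := fl (s x) _ e2.
    exists (maxn N N') => n; rewrite geq_max => /andP[/hN h1 /hN' h2].
    apply: le_trans (nrB_le _ (f n (s x)) _) _; rewrite [leRHS]splitr lerD //.
    rewrite -(adjB (fs n)); apply: le_trans (fb _ _) (le_trans _ h1).
    by rewrite ler_piMl ?nr_ge0 //; have /andP[] := majorant_itv R n.
  have : s x = (2^-1)%:C%C *: (p x + s (s x)).
    apply: cvgto_unique (cvgto_shift (fl x)) _.
    apply: (cvgto_ext (fun n => esym (fS n x))); apply: cvgto_scale.
    exact: cvgto_add (cvgto_cst _) sq.
  move=> h; have -> : s x + s x = p x + s (s x).
    rewrite {1 2}h -scalerDl -rmorphD.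
    have -> : 2^-1 + 2^-1 = 1 :> R by lra.
    by rewrite rmorph1 scale1r.
  by rewrite addrK.
move=> g g' gg gp x; have [c [_ gc]] := adj_bounded gg.
apply: (@cvgto_unique _ _ (fun n => g (f n x))).
  by apply: (@cvgto_map _ _ _ g c) (fl x) => u v; rewrite -(adjB gg).
by apply: (@cvgto_ext _ _ (fun n => f n (g x))) (fl _) => n; rewrite (fc _ _ _ gg).
Qed.

End Operators.

Section Positive.
Variables (R : realType) (M : cstarAlg R) (F : hilbMod M).
Local Notation C := (complex R).
Hypothesis CS : forall x y : F, nr (hip x y) <= nr x * nr y.
Implicit Types (f g h k a b : F -> F) (x y z : F).

Definition commute_with f g := forall x, f (g x) = g (f x).

(** For commuting [h] and [k], [(h - i k) (h + i k) = t], so both [h + i k] and [h - i k] multiply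
    every norm by [sqrt t], and [h] is their average. No order property is used, as none is
    available yet. *)
Lemma sum_squares_bdd (t : R) h k : 0 <= t -> adj h h -> adj k k -> commute_with h k ->
  (forall x, h (h x) + k (k x) = t%:C%C *: x) -> bdd h (Num.sqrt t).
Proof.
move=> t0 hs ks hk hkt x.
have key (c : C) : conjc c * c = 1 -> conjc c = - c ->
    nr (h x + c *: k x) = Num.sqrt t * nr x.
  move=> c1 cN; have uv := adj_add hs (adj_scale c ks).
  have E : hip (h x + c *: k x) (h x + c *: k x) = t%:C%C *: hip x x.
    rewrite uv (adjD hs) (adjD ks) (adjZ hs) (adjZ ks) scalerDr scalerA c1 scale1r.
    by rewrite hk cN -addrA (addrA (c *: _)) scaleNr subrr add0r hkt hipZ.
  have : nr (h x + c *: k x) ^+ 2 = (Num.sqrt t * nr x) ^+ 2.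
    by rewrite -hip_nr E nrZr hip_nr exprMn sqr_sqrtr // ger0_norm.
  by move/eqP; rewrite eqrXn2 ?mulr_ge0 ?nr_ge0 ?sqrtr_ge0 // => /eqP.
have conji : conjc 'i%C = - 'i%C :> C by apply/eqP; rewrite eq_complex /= oppr0 !eqxx.
have ii : 'i%C * 'i%C = -1 :> C.
  by apply/eqP; rewrite eq_complex /= !mul0r !mulr0 mul1r add0r addr0 oppr0 !eqxx.
have h1 : nr (h x + 'i%C *: k x) = Num.sqrt t * nr x.
  by apply: key => //; rewrite conji mulNr ii opprK.
have h2 : nr (h x + (- 'i%C) *: k x) = Num.sqrt t * nr x.
  have E : conjc (- 'i%C) = 'i%C :> C by apply: (can_inj (@conjcK R)); rewrite conjcK conji.
  by apply: key; rewrite E ?opprK // mulrN ii opprK.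
have E : h x + 'i%C *: k x + (h x + (- 'i%C) *: k x) = 2%:C%C *: h x.
  by rewrite scaleNr addrACA subrr addr0 -[X in X + X]scale1r -scalerDl -(rmorphD (real_complex R) 1 1).
have := nrD (h x + 'i%C *: k x) (h x + (- 'i%C) *: k x).
rewrite E nrZr ger0_norm // h1 h2; lra.
Qed.

(** With [p = (t - a) / t], of norm at most 1, [a = t (1 - p)] is the square of [sqrt t (1 - s)] for
    the [s] of [op_sqrt]. The hypothesis is a form of [0 <= a <= 2 t] that needs no order. *)
Lemma sqrt_near a (t : R) : adj a a -> 0 < t -> bdd (fun x => t%:C%C *: x - a x) t ->
  exists h, [/\ adj h h, forall x, a x = h (h x),
    forall g g', adj g g' -> commute_with g a -> commute_with g h &
    bdd (fun x => (Num.sqrt t)%:C%C *: x - h x) (Num.sqrt t)].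
Proof.
move=> as_ t0 ta; pose p x := t^-1%:C%C *: (t%:C%C *: x - a x).
have idt : adj (fun x : F => t%:C%C *: x) (fun x => t%:C%C *: x) by apply: adj_scaleR => x y.
have ps : adj p p by apply: adj_scaleR; apply: adj_sub.
have pb : bdd p 1.
  by move=> x; rewrite nrZr gtr0_norm ?invr_gt0 // mul1r mulrC ler_pdivrMr // mulrC ta.
have [s [ss sb sp sc]] := op_sqrt CS ps pb.
have st0 : 0 <= Num.sqrt t by exact: sqrtr_ge0.
have qs : adj (fun x => x - s x) (fun x => x - s x) by apply: adj_sub => // x y.
exists (fun x => (Num.sqrt t)%:C%C *: (x - s x)); split.
- exact: adj_scaleR.
- move=> x; rewrite (adjZ ss) -scalerBr scalerA -rmorphM -expr2 sqr_sqrtr ?(ltW t0) //.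
  have -> : x - s x - s (x - s x) = x - p x by rewrite (adjB ss) sp -!addrA -opprD.
  rewrite /p scalerBr scalerA -rmorphM mulfV ?gt_eqF // rmorph1 scale1r.
  by rewrite opprB addrC subrK.
- move=> g g' gg ga x; rewrite (adjZ gg) (adjB gg) (sc g g') // => y.
  by rewrite /p (adjZ gg) (adjB gg) (adjZ gg) ga.
- move=> x; rewrite -scalerBr opprB addrC subrK nrZr ger0_norm // ler_wpM2l //.
  by have := sb x; rewrite mul1r.
Qed.

(** A square of a self-adjoint operator rather than a product [x^* x]; that the latter are positive
    is [pos_star]. *)
Definition pos a := exists h, adj h h /\ forall x, a x = h (h x).

Lemma pos_adj a : pos a -> adj a a.
Proof. by move=> [h [hs ah]] x y; rewrite !ah !hs. Qed.

Lemma pos_ext a b : (forall x, a x = b x) -> pos a -> pos b.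
Proof. by move=> ab [h [hs ah]]; exists h; split=> // x; rewrite -ab. Qed.

Lemma pos_square h : adj h h -> pos (fun x => h (h x)).
Proof. by exists h. Qed.

Lemma pos0 : pos (fun=> 0).
Proof. by exists (fun=> 0); split=> // x y; rewrite hip0l hip0r. Qed.

Lemma pos_scale (t : R) a : 0 <= t -> pos a -> pos (fun x => t%:C%C *: a x).
Proof.
move=> t0 [h [hs ah]]; exists (fun x => (Num.sqrt t)%:C%C *: h x); split.
  exact: adj_scaleR.
by move=> x; rewrite (adjZ hs) scalerA -rmorphM -expr2 sqr_sqrtr // ah.
Qed.

Lemma pos_conj a g g' : adj g g' -> pos a -> exists h h', adj h h' /\
  forall x, g' (a (g x)) = h' (h x).
Proof.
move=> gg [h [hs ah]]; exists (fun x => h (g x)), (fun x => g' (h x)); split.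
  exact: (adj_comp hs gg).
by move=> x; rewrite ah.
Qed.

(** Converse of [near_pos]. If [a = h^2], the root [k] of [t - a] commutes with [h] and
    [h^2 + k^2 = t], so [sum_squares_bdd] bounds [k] by [sqrt t]. *)
Lemma pos_near a (t : R) : pos a -> 0 < t -> bdd a t -> bdd (fun x => t%:C%C *: x - a x) t.
Proof.
move=> pa t0 ab; have as_ := pos_adj pa; case: pa => h [hs ah].
have t1 : t^-1%:C%C * t%:C%C = 1 :> C by rewrite -rmorphM mulVf ?rmorph1 // gt_eqF.
pose p x := t^-1%:C%C *: a x.
have ps : adj p p by apply: adj_scaleR.
have pb : bdd p 1.
  by move=> x; rewrite nrZr gtr0_norm ?invr_gt0 // mul1r mulrC ler_pdivrMr // mulrC ab.
have [s [ss _ sp sc]] := op_sqrt CS ps pb.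
pose k x := (Num.sqrt t)%:C%C *: (x - s x).
have qs : adj (fun x => x - s x) (fun x => x - s x) by apply: adj_sub => // x y.
have ks : adj k k by exact: adj_scaleR.
have kk x : k (k x) = t%:C%C *: x - a x.
  rewrite /k (adjZ ss) -scalerBr scalerA -rmorphM -expr2 sqr_sqrtr ?(ltW t0) //.
  have -> : x - s x - s (x - s x) = x - p x by rewrite (adjB ss) sp -!addrA -opprD.
  by rewrite /p scalerBr scalerA mulrC t1 scale1r.
have hk : commute_with k h.
  have hp x : h (p x) = p (h x) by rewrite /p (adjZ hs) !ah.
  by move=> x; rewrite /k (adjZ hs) (adjB hs) (sc h h).
have kb : bdd k (Num.sqrt t).
  apply: (sum_squares_bdd (ltW t0) ks hs hk) => x.
  by rewrite kk -ah subrK.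
move=> x; rewrite -kk; apply: le_trans (kb _) _.
rewrite -[X in _ <= X * _](sqr_sqrtr (ltW t0)) expr2 -mulrA.
by rewrite ler_wpM2l ?sqrtr_ge0.
Qed.

Lemma near_pos a (t : R) : adj a a -> 0 < t -> bdd (fun x => t%:C%C *: x - a x) t -> pos a.
Proof. by move=> as_ t0 ta; have [h [hs ah _ _]] := sqrt_near as_ t0 ta; exists h. Qed.

Lemma pos_bound a : adj a a -> exists t, 0 < t /\ bdd a t.
Proof.
move=> as_; have [c [c0 ac]] := adj_bounded CS as_.
exists (c + 1); split=> [|x]; first by rewrite ltr_wpDl.
by apply: le_trans (ac x) _; rewrite ler_wpM2r ?nr_ge0 // lerDl.
Qed.

Lemma pos_sqrt a : pos a ->
  exists h, [/\ adj h h, pos h, forall x, a x = h (h x) &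
    forall g g', adj g g' -> commute_with g a -> commute_with g h].
Proof.
move=> pa; have as_ := pos_adj pa; have [t [t0 ab]] := pos_bound as_.
have [h [hs ah hc hb]] := sqrt_near as_ t0 (pos_near pa t0 ab).
exists h; split=> //; apply: near_pos hb => //.
by rewrite sqrtr_gt0.
Qed.

(** [near_pos] and [pos_near] express positivity by norm inequalities, and these add up by the
    triangle inequality. *)
Lemma pos_add a b : pos a -> pos b -> pos (fun x => a x + b x).
Proof.
move=> pa pb; have [t [t0 ta]] := pos_bound (pos_adj pa).
have [u [u0 ub]] := pos_bound (pos_adj pb).
apply: (@near_pos _ (t + u)); first exact: adj_add (pos_adj pa) (pos_adj pb).
  exact: addr_gt0.
move=> x; rewrite rmorphD scalerDl opprD addrACA mulrDl.
exact: le_trans (nrD _ _) (lerD (pos_near pa t0 ta x) (pos_near pb u0 ub x)).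
Qed.

Lemma pos_sum I (s : seq I) (f : I -> F -> F) :
  (forall i, pos (f i)) -> pos (fun x => \sum_(i <- s) f i x).
Proof.
move=> pf; elim: s => [|i s IH]; first by apply: pos_ext pos0 => x; rewrite big_nil.
by apply: pos_ext (pos_add (pf i) IH) => x; rewrite big_cons.
Qed.

Lemma sq0 h x : adj h h -> h (h x) = 0 -> h x = 0.
Proof. by move=> hs hx; apply: hip_eq0; rewrite hs hx hip0r. Qed.

(** The roots [h] of [a] and [k] of [- a] commute and [h^2 + k^2 = 0], so [sum_squares_bdd] applies
    with [t = 0]. *)
Lemma pos_opp0 a : pos a -> pos (fun x => - a x) -> forall x, a x = 0.
Proof.
move=> pa pna x; have as_ := pos_adj pa.
have [h [hs _ ah hc]] := pos_sqrt pa; have [k [ks _ ak kc]] := pos_sqrt pna.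
have ha : commute_with h a by move=> y; rewrite !ah.
have hk : commute_with h k.
  by apply: (kc h h) => // y; rewrite (adjN hs) ha.
have := sum_squares_bdd (lexx 0) hs ks hk; rewrite sqrtr0 => /(_ _) hb.
have {}hb y : h y = 0.
  apply: nr_eq0; apply/eqP; rewrite eq_le nr_ge0 andbT.
  have := hb _ y; rewrite mul0r; apply=> z.
  by rewrite -ah -ak subrr scale0r.
by rewrite ah hb.
Qed.

Lemma pos_le_bdd a (t : R) : 0 <= t -> pos a -> pos (fun x => t%:C%C *: x - a x) -> bdd a t.
Proof.
move=> t0 pa pta; have as_ := pos_adj pa.
have [h [hs _ ah hc]] := pos_sqrt pa; have [k [ks _ ak kc]] := pos_sqrt pta.
have hk : commute_with h k.
  by apply: (kc h h) => // y; rewrite (adjB hs) (adjZ hs) !ah.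
have hb : bdd h (Num.sqrt t).
  by apply: (sum_squares_bdd t0 hs ks hk) => x; rewrite -ah -ak addrC subrK.
move=> x; rewrite ah; apply: le_trans (hb _) _.
rewrite -[X in _ <= X * _](sqr_sqrtr t0) expr2 -mulrA.
by rewrite ler_wpM2l ?sqrtr_ge0.
Qed.

(* [n] is the negative part [(|a| - a) / 2], so that [n a n = - n ^ 3],
   and [n ^ 3 = m ^ 2] with [m = n |a| ^ (1 / 2)]. *)
Lemma negative_part a : adj a a -> exists n m, [/\ adj n n, adj m m,
  forall x, n (a (n x)) = - m (m x) & (forall x, m x = 0) -> pos a].
Proof.
move=> as_; have [c [cs pc ac cc]] := pos_sqrt (pos_square as_).
have [g [gs _ cg gc]] := pos_sqrt pc.
have ca : commute_with a c by apply: (cc a a).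
pose n x := (2^-1)%:C%C *: (c x - a x).
have ns : adj n n by apply: adj_scaleR; exact: adj_sub.
have nc : commute_with n c by move=> x; rewrite /n (adjZ cs) (adjB cs) ca.
have na : commute_with n a by move=> x; rewrite /n (adjZ as_) (adjB as_) ca.
have ng : commute_with n g by apply: (gc n n).
have half x : (2^-1)%:C%C *: (x + x) = x.
  rewrite -{1 2}[x]scale1r -scalerDl scalerA -(rmorphD (real_complex R) 1 1) -rmorphM.
  by rewrite (_ : 2^-1 * (1 + 1) = 1) ?rmorph1 ?scale1r //; lra.
have nac x : n (a x) = - n (c x).
  apply/eqP; rewrite -subr_eq0 opprK -(adjD ns) /n (adjD cs) (adjD as_) -ac ca.
  by rewrite [X in _ - X]addrC subrr scaler0.
have nn x : n (n x) = n (c x).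
  by rewrite {2}/n (adjZ ns) (adjB ns) nac opprK half.
exists n, (fun x => n (g x)); split=> //.
- by move=> x y; rewrite ns gs ng.
- by move=> x; rewrite nac -nc -ng -cg.
- move=> m0; apply: pos_ext pc => x.
  have n0 : n x = 0 by apply: sq0 => //; rewrite nn cg m0.
  apply/eqP; rewrite -subr_eq0 -[_ - _]half scalerDr -/(n x) n0 addr0.
  by rewrite eqxx.
Qed.

End Positive.

(** * Positivity of [x^* x] *)

Section Fukamiya.
Variables (R : realType) (M : cstarAlg R) (F : hilbMod M).
Local Notation C := (complex R).
Hypothesis CS : forall x y : F, nr (hip x y) <= nr x * nr y.
Implicit Types (f g h k a b y : F -> F).

(** With [u = y + y^*] and [v = i (y - y^*] [)] self-adjoint, the sum is [(u^2 + v^2) / 2]. *)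
Lemma pos_star_add y y' : adj y y' -> pos (fun z => y' (y z) + y (y' z)).
Proof.
move=> yy; have yy' := adjC yy.
have conji : conjc 'i%C = - 'i%C :> C by apply/eqP; rewrite eq_complex /= oppr0 !eqxx.
have ii : 'i%C * 'i%C = -1 :> C.
  by apply/eqP; rewrite eq_complex /= !mul0r !mulr0 mul1r add0r addr0 oppr0 !eqxx.
pose u z := y z + y' z; pose v z := 'i%C *: (y z - y' z).
have us : adj u u by move=> s t; rewrite (adj_add yy yy') addrC.
have vs : adj v v.
  by move=> s t; rewrite (adj_scale _ (adj_sub yy yy')) conji -opprB scalerN scaleNr opprK.
have p : pos (fun z => (2^-1)%:C%C *: (u (u z) + v (v z))).
  by apply: pos_scale; [by rewrite invr_ge0|have := pos_add CS (pos_square us) (pos_square vs)].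
apply: pos_ext p => z.
have vv : v (v z) = - (y (y z - y' z) - y' (y z - y' z)).
  by rewrite /v (adjZ yy) (adjZ yy') -scalerBr scalerA ii scaleN1r.
have uu : u (u z) = y (y z + y' z) + y' (y z + y' z) by [].
rewrite vv uu !(adjB yy, adjB yy', adjD yy, adjD yy').
set A := y (y z); set B := y (y' z); set D := y' (y z); set E := y' (y' z).
have -> : A + B + (D + E) + - (A - B - (D - E)) = (D + B) + (D + B).
  rewrite opprB opprB [D - E + _]addrC addrACA [A + B + _]addrC [_ + (A + B)]addrA subrK.
  by rewrite [D + E + _]addrACA subrr addr0 addrACA [B + D]addrC.
rewrite -{1 2}[D + B]scale1r -scalerDl scalerA -(rmorphD (real_complex R) 1 1) -rmorphM.
by rewrite (_ : 2^-1 * (1 + 1) = 1) ?rmorph1 ?scale1r //; lra.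
Qed.

(** An algebraic substitute for the fact that [y^* y] and [y y^*] have the same spectrum off 0.
    Adding [m^2] to the positive [y^* y + y y^*] shows that [y y^*] is positive, say [w^2]. The same
    sum for [m y^*] is [- w^4 - m^4]; adding [m^4] makes [- w^4] positive, so [w^2 = 0]. *)
Lemma star_neg y y' m : adj y y' -> adj m m -> (forall z, y' (y z) = - m (m z)) ->
  forall z, y z = 0.
Proof.
move=> yy ms ym; have yy' := adjC yy.
have [w [ws yw]] : pos (fun z => y (y' z)).
  apply: pos_ext (pos_add CS (pos_star_add yy) (pos_square ms)) => z.
  by rewrite ym addrAC addNr add0r.
have zz := adj_comp ms yy'.
have w2s : adj (fun z => w (w z)) (fun z => w (w z)) by exact: adj_comp.
have m2s : adj (fun z => m (m z)) (fun z => m (m z)) by exact: adj_comp.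
have pw : pos (fun z => - (w (w (w (w z))))).
  apply: pos_ext (pos_add CS (pos_star_add zz) (pos_square m2s)) => z /=.
  rewrite ym (adjN ms) subrK.
  have -> : m (m (y' z)) = - y' (y (y' z)) by rewrite ym opprK.
  by rewrite (adjN yy) !yw.
have w4 z : w (w z) = 0.
  by apply: (sq0 w2s); exact: (pos_opp0 CS (pos_square w2s) pw).
have y'0 z : y' z = 0 by apply: hip_eq0; rewrite yy' yw w4 hip0r.
by move=> z; apply: hip_eq0; rewrite yy y'0 hip0r.
Qed.

(** Let [n] be the negative part of [x^* x]. Then [y = x n] has [y^* y = - m^2], so [star_neg] makes
    [y], hence [m], vanish. *)
Lemma pos_star x x' : adj x x' -> pos (fun z : F => x' (x z)).
Proof.
move=> xx; have xx' := adjC xx.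
have [n [m [ns ms nm]]] := negative_part CS (adj_comp xx' xx).
apply => z; apply: (sq0 ms).
have y0 := star_neg (adj_comp xx ns) ms nm.
by apply: oppr_inj; rewrite -nm y0 (adj0 xx') (adj0 ns) oppr0.
Qed.

End Fukamiya.

(** * The order of a C*-algebra and Cauchy-Schwarz *)

Section Order.
Variables (R : realType) (M : cstarAlg R).
Local Notation C := (complex R).
Implicit Types a b c : M.

Lemma regular_CS (a b : regularMod M) : nr (hip a b) <= nr a * nr b.
Proof. by rewrite /=; apply: le_trans (cmul_nr _ _) _; rewrite cstar_nr. Qed.
Let CS := regular_CS.

Lemma lmul_adj a : @adj R M (regularMod M) (cmul a) (cmul (cstar a)).
Proof. by move=> x y; exact: lmul_subproof. Qed.

Lemma lmul_bdd a : @bdd R M (regularMod M) (cmul a) (nr a).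
Proof. by move=> x; exact: cmul_nr. Qed.

Lemma bdd_lmul a t : 0 <= t -> @bdd R M (regularMod M) (cmul a) t -> nr a <= t.
Proof.
move=> t0 /(_ (cstar a)); have := cmulV_nr (cstar a); rewrite cstarK => ->; rewrite cstar_nr expr2.
have [->//|a0] := eqVneq (nr a) 0.
by rewrite ler_pM2r // lt_def a0 nr_ge0.
Qed.

Lemma lmul_inj a b : (forall c, cmul a c = cmul b c) -> a = b.
Proof.
move=> h; apply/eqP; rewrite -subr_eq0; apply/eqP/nr_eq0/eqP.
rewrite eq_le nr_ge0 andbT; apply: bdd_lmul => // c.
by rewrite cmulDl cmulNl h subrr nr0 mul0r.
Qed.

(** Positivity is read off left multiplication, since the operators on [M] contain an identity even
    if [M] has no unit. *)
Definition mpos a := @pos R M (regularMod M) (cmul a).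

Lemma mpos_star a : mpos (cmul (cstar a) a).
Proof.
apply: pos_ext (pos_star CS (lmul_adj a)) => x; exact: cmulA.
Qed.

Lemma mpos_hip (F : hilbMod M) (x : F) : mpos (hip x x).
Proof. by have [b ->] := hip_ge0 x; exact: mpos_star. Qed.

Lemma mpos_add a b : mpos a -> mpos b -> mpos (a + b).
Proof. by move=> pa pb; apply: pos_ext (pos_add CS pa pb) => x; rewrite cmulDl. Qed.

Lemma mpos0 : mpos 0.
Proof. by apply: pos_ext (pos0 _) => x; rewrite cmul0l. Qed.

Lemma mpos_sum I (s : seq I) (f : I -> M) : (forall i, mpos (f i)) -> mpos (\sum_(i <- s) f i).
Proof.
move=> pf; elim: s => [|i s IH]; first by rewrite big_nil; exact: mpos0.
by rewrite big_cons; exact: mpos_add.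
Qed.

Lemma mpos_scale (t : R) a : 0 <= t -> mpos a -> mpos (t%:C%C *: a).
Proof. by move=> t0 pa; apply: pos_ext (pos_scale t0 pa) => x; rewrite cmulZl. Qed.

Lemma mpos_opp0 a : mpos a -> mpos (- a) -> a = 0.
Proof.
move=> pa pna; apply: lmul_inj => c; rewrite cmul0l.
by apply: (pos_opp0 CS pa); apply: pos_ext pna => x; rewrite cmulNl.
Qed.

Lemma mpos_near a (t : R) : mpos a -> 0 < t -> nr a <= t ->
  @pos R M (regularMod M) (fun x => t%:C%C *: x - cmul a x).
Proof.
move=> pa t0 at_; have idt : @adj R M (regularMod M) (fun x => t%:C%C *: x) (fun x => t%:C%C *: x).
  by apply: adj_scaleR => x y.
apply: (near_pos CS _ t0); first exact: adj_sub idt (pos_adj pa).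
move=> x; rewrite opprB addrC subrK; apply: le_trans (lmul_bdd a x) _.
by rewrite ler_wpM2r ?nr_ge0.
Qed.

Lemma mpos_norm a b : mpos a -> mpos (b - a) -> nr a <= nr b.
Proof.
move=> pa pba; have [b0|b0] := eqVneq (nr b) 0.
  by rewrite (mpos_opp0 pa) ?nr0 ?nr_ge0 // -sub0r -(nr_eq0 b0).
have bp : 0 < nr b by rewrite lt_def b0 nr_ge0.
have pb : mpos b by rewrite -(subrK a b); exact: mpos_add.
apply: bdd_lmul; first exact: nr_ge0.
apply: (pos_le_bdd CS (nr_ge0 _) pa).
apply: pos_ext (pos_add CS (mpos_near pb bp (lexx _)) pba) => x.
by rewrite cmulDl cmulNl addrA subrK.
Qed.

Lemma mpos_conj_le p c (t : R) : mpos p -> 0 < t -> nr p <= t ->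
  mpos (t%:C%C *: cmul (cstar c) c - cmul (cstar c) (cmul p c)).
Proof.
move=> pp t0 pt; have [h [h' [hh E]]] := pos_conj (lmul_adj c) (mpos_near pp t0 pt).
apply: pos_ext (pos_star CS hh) => x.
by rewrite -E !cmulDl cmulDr cmulZr !cmulZl !cmulNl cmulNr !cmulA.
Qed.

Section CauchySchwarz.
Variables (F : hilbMod M) (I : Type) (s : seq I) (v w : I -> F).
Local Notation G f := (\sum_(i <- s) hip (f i) (f i)).

(** Expand [sum <u_i, u_i> >= 0] for [u_i = t w_i - v_i a] and bound [a^* (G v) a] by [t a^* a], for
    [t] slightly above [nr (G v)]. *)
Lemma CS_sum : nr (\sum_(i <- s) hip (v i) (w i)) ^+ 2 <= nr (G v) * nr (G w).
Proof.
set a := \sum_(i <- s) _.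
have as_ : cstar a = \sum_(i <- s) hip (w i) (v i).
  by rewrite cstar_sum; apply: eq_bigr => i _; rewrite hipC.
have pv : mpos (G v) by apply: mpos_sum => i; exact: mpos_hip.
have key (t : R) : 0 < t -> nr (G v) <= t -> nr a ^+ 2 <= t * nr (G w).
  move=> t0 vt; pose u i := t%:C%C *: w i - hact (v i) a.
  have pu : mpos (G u) by apply: mpos_sum => i; exact: mpos_hip.
  have E : G u = (t * t)%:C%C *: G w - t%:C%C *: cmul (cstar a) a - t%:C%C *: cmul (cstar a) a
      + cmul (cstar a) (cmul (G v) a).
    have Ea : cmul (cstar a) a = \sum_(i <- s) cmul (hip (w i) (v i)) a.
      by rewrite as_ cmul_suml.
    have Eb : cmul (cstar a) a = \sum_(i <- s) cmul (cstar a) (hip (v i) (w i)).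
      by rewrite -cmul_sumr.
    rewrite {1}Ea Eb cmul_suml cmul_sumr !scaler_sumr -!sumrN -!big_split /=.
    apply: eq_bigr => i _.
    rewrite /u !(hipBl, hipBr) !(hipZl, hipZ) !conjc_real !scalerA -rmorphM !hipA !hipAl.
    by rewrite opprB cmulA addrA addrAC.
  have := mpos_add pu (mpos_conj_le a pv t0 vt); rewrite E.
  rewrite addrA [_ + _ + t%:C%C *: _]addrAC subrK addrK => p.
  have := mpos_norm (mpos_scale (ltW t0) (mpos_star a)) p.
  rewrite !nrZr cmulV_nr !ger0_norm ?mulr_ge0 ?(ltW t0) // -mulrA.
  by rewrite ler_pM2l.
apply: (@le_small _ _ _ (nr (G w))); first exact: nr_ge0.
move=> e e0; rewrite -mulrDl; apply: key; last by rewrite lerDl ltW.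
by rewrite ltr_wpDl ?nr_ge0.
Qed.

End CauchySchwarz.

Lemma CS_hip (F : hilbMod M) (x y : F) : nr (hip x y) <= nr x * nr y.
Proof.
have := @CS_sum F unit [:: tt] (fun=> x) (fun=> y); rewrite !big_seq1 !hip_nr -exprMn.
by rewrite ler_pXn2r // nnegrE ?mulr_ge0 ?nr_ge0.
Qed.

Lemma adjOp_bdd (F : hilbMod M) (A : adjOp F) : exists c : R, 0 <= c /\ bdd A c.
Proof. exact: adj_bounded (@CS_hip F) _ _ (adjOp_adj A). Qed.

(** With [n] and [m] from the negative part, [<n x, a n x> = - <m x, m x>] is both positive and
    negative, hence 0. *)
Lemma lance (F : hilbMod M) (a : F -> F) :
  adj a a -> (forall x, mpos (hip x (a x))) -> pos a.
Proof.
move=> as_ pa; have [n [m [ns ms nm h]]] := negative_part (@CS_hip F) as_.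
apply: h => x; apply: hip_eq0; apply: mpos_opp0; first exact: mpos_hip.
by rewrite ms -hipNr -nm -ns.
Qed.

Lemma mpos_hip_pos (F : hilbMod M) (a : F -> F) x : pos a -> mpos (hip x (a x)).
Proof. by move=> [h [hs ->]]; rewrite -hs; exact: mpos_hip. Qed.

End Order.

(** * Frames *)

Section StarHom.
Variables (R : realType) (M N : cstarAlg R) (F : hilbMod N) (phi : M -> adjOp F).
Hypothesis hphi : star_hom phi.

Lemma star_hom_adj (a : M) x y : hip (phi a x) y = hip x (phi (cstar a) y).
Proof. by case: hphi => _ _ _ st; rewrite adjP st. Qed.

Lemma star_hom0 (x : F) : phi 0 x = 0.
Proof. by case: hphi => _ hZ _ _; rewrite -[0 in LHS](scale0r 0) hZ scale0r. Qed.

Lemma star_homN (a : M) (x : F) : phi (- a) x = - phi a x.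
Proof. by case: hphi => _ hZ _ _; rewrite -scaleN1r hZ scaleN1r. Qed.

Lemma star_hom_sum I (s : seq I) (a : I -> M) (x : F) :
  phi (\sum_(i <- s) a i) x = \sum_(i <- s) phi (a i) x.
Proof.
elim: s => [|i s IH]; first by rewrite !big_nil star_hom0.
by rewrite !big_cons; case: hphi => -> _ _ _; rewrite IH.
Qed.

(** For [nr b <= 1], [cstar_sqrt] gives [s] in [M] with [1 - b^* b = (1 - s)^2] formally, so
    [z = x - phi s x] has [<z, z> = <x, x> - <phi b x, phi b x>]. *)
Lemma star_hom_nr (a : M) (x : F) : nr (phi a x) <= nr a * nr x.
Proof.
case: (hphi) => hD hZ hM _.
have le1 (b : M) : nr b <= 1 -> nr (phi b x) <= nr x.
  move=> b1; pose p := cmul (cstar b) b.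
  have p1 : nr p <= 1 by rewrite cmulV_nr expr_le1 ?nr_ge0.
  have [s [ss ps]] : exists s, cstar s = s /\ p = s + s - cmul s s.
    by apply: cstar_sqrt => //; rewrite cstarM cstarK.
  pose z := x - phi s x.
  have Ez : hip z z = hip x x - hip (phi b x) (phi b x).
    rewrite (star_hom_adj b) -hM -/p ps !(hD, star_homN, hM).
    rewrite /z hipBl !hipBr (star_hom_adj s) ss.
    by rewrite (star_hom_adj s) ss !(hipD, hipNr) !opprD !opprK !addrA.
  have : nr (hip (phi b x) (phi b x)) <= nr (hip x x).
    by apply: mpos_norm; [exact: mpos_hip|rewrite -Ez; exact: mpos_hip].
  by rewrite !hip_nr ler_pXn2r // nnegrE nr_ge0.
have [a0|a0] := eqVneq (nr a) 0.
  by rewrite (nr_eq0 a0) star_hom0 !nr0 mul0r.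
have ap : 0 < nr a by rewrite lt_def a0 nr_ge0.
have := le1 ((nr a)^-1%:C%C *: a); rewrite hZ !nrZr gtr0_norm ?invr_gt0 //.
by rewrite mulVf // => /(_ (lexx _)); rewrite mulrC ler_pdivrMr // mulrC.
Qed.

End StarHom.

Section Frames.
Variables (R : realType) (M : cstarAlg R) (F : hilbMod M).
Local Notation C := (complex R).
Let CS := @CS_hip R M F.
Implicit Types (x y z : F).

Lemma pos_congr (a g g' : F -> F) : adj g g' -> pos a -> pos (fun x => g' (a (g x))).
Proof.
move=> gg pa; have [h [h' [hh E]]] := pos_conj gg pa.
by apply: pos_ext (pos_star CS hh) => x; rewrite E.
Qed.

Section Powers.
Variable E : F -> F.
Hypotheses (pE : pos E) (p1E : pos (fun x => x - E x)).
Let P x := x - E x.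
Let Es := pos_adj pE.

Lemma iter_adj n : adj (iter n E) (iter n E).
Proof. by elim: n => [|n IH] x y //=; rewrite Es IH -iterSr. Qed.

Lemma iter_pos n : pos (iter n E).
Proof.
have [e [es Ee]] := pE.
have ads m : adj (iter m e) (iter m e).
  by elim: m => [|m IH] x y //=; rewrite es IH -iterSr.
exists (iter n e); split=> // x; rewrite -iterD.
elim: n => [//|n IH]; by rewrite addSn addnS /= -IH -Ee.
Qed.

Lemma iter_comm n x : iter n E (E x) = E (iter n E x).
Proof. by rewrite -iterSr. Qed.

Lemma iterP_comm n x : iter n E (P x) = P (iter n E x).
Proof. by rewrite /P (adjB (iter_adj n)) iter_comm. Qed.

Lemma iter_le1 n x : nr (iter n E x) <= nr x.
Proof.
have E1 : bdd E 1.
  apply: (pos_le_bdd CS ler01 pE); apply: pos_ext p1E => y.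
  by rewrite rmorph1 scale1r.
by elim: n => [//|n IH] /=; apply: le_trans (E1 _) _; rewrite mul1r.
Qed.

Lemma telescope_iter n x : \sum_(j < n) iter j E (P x) = x - iter n E x.
Proof.
elim: n => [|n IH]; first by rewrite big_ord0 subrr.
by rewrite big_ord_recr /= IH iterP_comm addrA subrK.
Qed.

(** The scalar inequality [x^m (1 - x) <= 1/m] on [[0, 1]]: [E^j P] decreases in [j], so [m E^m P]
    is at most [sum_(j < m) E^j P = 1 - E^m <= 1]. *)
Lemma iterP_bdd n : bdd (fun x => iter n.+1 E (P x)) n.+1%:R^-1.
Proof.
set m := n.+1.
have Ps : adj P P by apply: pos_adj.
have step j : pos (fun x => iter j E (P x) - iter j.+1 E (P x)).
  by apply: pos_ext (pos_congr Ps (iter_pos j)).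
have mono j d : pos (fun x => iter j E (P x) - iter (d + j) E (P x)).
  elim: d => [|d IH]; first by apply: pos_ext (pos0 _) => x; rewrite subrr.
  by apply: pos_ext (pos_add CS IH (step (d + j)%N)) => x; rewrite addrA subrK.
have p0 : pos (fun x => iter m E (P x)).
  have [e [es Ee]] := pE.
  have ads k : adj (iter k e) (iter k e).
    by elim: k => [|k IH] x y //=; rewrite es IH -iterSr.
  have ee k x : iter k e (iter k e x) = iter k E x.
    rewrite -iterD; elim: k => [//|k IH]; by rewrite addSn addnS /= IH -Ee.
  have eP k x : iter k e (P x) = P (iter k e x).
    by rewrite /P (adjB (ads k)) !Ee -!iterSr -!iterS iterSr.
  by apply: pos_ext (pos_congr (ads m) p1E) => x; rewrite -[_ - _]/(P _) eP ee iterP_comm.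
have psum : pos (fun x => \sum_(j < m) (iter j E (P x) - iter m E (P x))).
  apply: (pos_sum CS (index_enum 'I_m)) => j.
  by apply: pos_ext (mono j (m - j)%N) => x; rewrite subnK // ltnW.
have m0 : 0 <= m%:R :> R by [].
have pm : pos (fun x => m%:R%:C%C *: iter m E (P x)) by exact: pos_scale p0.
have mb : bdd (fun x => m%:R%:C%C *: iter m E (P x)) 1.
  apply: (pos_le_bdd CS ler01 pm).
  apply: pos_ext (pos_add CS psum (iter_pos m)) => x.
  rewrite sumrB telescope_iter sumr_const card_ord addrAC subrK rmorph1 scale1r.
  by rewrite rmorph_nat scaler_nat.
move=> x; have := mb x; rewrite nrZr ger0_norm // mul1r => h.
by rewrite mulrC ler_pdivlMr ?ltr0n // mulrC.
Qed.

End Powers.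

(** The row [e], as an operator from [M^k] to [F], has norm at most 1. *)
Definition row_contraction k (e : 'I_k -> F) := forall a : 'I_k -> M,
  nr (\sum_(i < k) hact (e i) (a i)) ^+ 2 <= nr (\sum_(i < k) cmul (cstar (a i)) (a i)).

Definition rank_sum k (e : 'I_k -> F) y := \sum_(i < k) hact (e i) (hip (e i) y).

Lemma rank_sum_hip k (e : 'I_k -> F) x y :
  hip x (rank_sum e y) = \sum_(i < k) cmul (hip x (e i)) (hip (e i) y).
Proof. by rewrite hip_sumr; apply: eq_bigr => i _; rewrite hipA. Qed.

Lemma rank_sum_adj k (e : 'I_k -> F) : adj (rank_sum e) (rank_sum e).
Proof.
move=> x y; rewrite -[LHS]hipC !rank_sum_hip cstar_sum; apply: eq_bigr => i _.
by rewrite cstarM !hipC.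
Qed.

Lemma rank_sum_pos k (e : 'I_k -> F) : pos (rank_sum e).
Proof.
apply: lance; first exact: rank_sum_adj.
move=> x; rewrite rank_sum_hip; apply: mpos_sum => i.
by rewrite -(hipC (e i)); exact: mpos_star.
Qed.

Lemma row_contraction_le1 k (e : 'I_k -> F) :
  row_contraction e -> pos (fun y => y - rank_sum e y).
Proof.
move=> re; have idt : adj (@id F) id by [].
have b1 : bdd (rank_sum e) 1.
  move=> y; rewrite mul1r; have := re (fun i => hip (e i) y).
  rewrite -/(rank_sum e y).
  under eq_bigr => i _ do rewrite hipC.
  rewrite -rank_sum_hip => /le_trans/(_ (CS _ _)).
  have [->|r0] := eqVneq (nr (rank_sum e y)) 0; first by rewrite nr_ge0.
  by rewrite expr2 ler_pM2r // lt_def r0 nr_ge0.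
have := pos_near CS (rank_sum_pos e) ltr01 b1 => b2.
apply: (near_pos CS _ ltr01); first exact: adj_sub idt (rank_sum_adj e).
move=> y; rewrite rmorph1 scale1r opprB addrC subrK; exact: b1.
Qed.

(* [e i = D (x i)] where [D ^ 2 t = 1 + E + .. + E ^ (N - 1)] and [1 - E = t ^-1 sum_i |x i><x i|]. *)
Lemma frame k (x : 'I_k -> F) (eps : R) : 0 < eps -> exists e : 'I_k -> F,
  [/\ row_contraction e, forall j l, nr (hip (x j) (x l - rank_sum e (x l))) <= eps &
      forall j, nr (x j - rank_sum e (x j)) <= eps].
Proof.
move=> e0; pose Th := rank_sum x.
have Ths : adj Th Th by exact: rank_sum_adj.
have [t [t0 Tt]] := pos_bound CS Ths.
have t1 : 0 <= t^-1 by rewrite invr_ge0 ltW.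
pose E y := y - t^-1%:C%C *: Th y.
have idt : adj (@id F) id by [].
have Es : adj E E by apply: adj_sub => //; exact: adj_scaleR.
have PE y : y - E y = t^-1%:C%C *: Th y by rewrite /E opprB addrC subrK.
have pP : pos (fun y => y - E y).
  by apply: pos_ext (pos_scale t1 (rank_sum_pos x)) => y; rewrite PE.
have pE : pos E.
  apply: (near_pos CS Es ltr01) => y; rewrite rmorph1 scale1r PE nrZr ger0_norm // mul1r.
  by rewrite mulrC ler_pdivrMr // mulrC.
(* For [y = E^(m+1) x_j], the sum [A] is at least its term of index [j], which is [<y, y>^2]; on the
   other side [Th = t (1 - E)], and [iterP_bdd] bounds the whole sum. *)
have small m j : nr (iter m.+1 E (x j)) ^+ 2 <= t * (m.+1 + m).+1%:R^-1.
  set k' := m.+1; set y := iter k' E (x j).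
  have ThE n z : Th (iter n E z) = iter n E (Th z).
    have Tp u : Th u = t%:C%C *: (u - E u).
      by rewrite PE scalerA -rmorphM mulfV ?gt_eqF // rmorph1 scale1r.
    by rewrite !Tp (adjZ (iter_adj pE n)) iterP_comm.
  pose A := hip y (iter k' E (Th (iter k' E y))).
  have EA : A = \sum_(i < k) cmul (hip y (iter k' E (x i))) (hip (iter k' E (x i)) y).
    rewrite /A -(iter_adj pE) rank_sum_hip; apply: eq_bigr => i _.
    by rewrite (iter_adj pE) -(iter_adj pE k' (x i)).
  have pA : mpos (A - cmul (hip y y) (hip y y)).
    rewrite EA (bigD1 j) //= addrC addrK big_mkcond; apply: mpos_sum => i.
    by case: ifP => _; [rewrite -(hipC _ y); exact: mpos_star|exact: mpos0].
  have py : mpos (cmul (hip y y) (hip y y)) by rewrite -{1}hipC; exact: mpos_star.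
  have h1 := mpos_norm py pA; rewrite -{1}hipC cmulV_nr hip_nr in h1.
  have h2 : nr A <= nr y * (t * ((k' + m).+1%:R^-1 * nr y)).
    apply: le_trans (CS _ _) _; rewrite ler_wpM2l ?nr_ge0 //.
    have -> : iter k' E (Th (iter k' E y)) = t%:C%C *: iter (k' + k') E (y - E y).
      by rewrite ThE -iterD PE (adjZ (iter_adj pE _)) scalerA -rmorphM mulfV ?gt_eqF // rmorph1 scale1r.
    rewrite nrZr gtr0_norm // ler_wpM2l ?(ltW t0) //.
    have -> : (k' + k')%N = (k' + m).+1 by rewrite addnS.
    exact: (iterP_bdd pE pP).
  have := le_trans h1 h2.
  have [->|y0] := eqVneq (nr y) 0.
    by rewrite expr0n /= mulr_ge0 ?(ltW t0) ?invr_ge0.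
  have yp : 0 < nr y ^+ 2 by rewrite exprn_gt0 // lt_def y0 nr_ge0.
  move=> h; rewrite -(ler_pM2r yp) -expr2; apply: le_trans h _.
  by rewrite expr2 !mulrA [nr y * t]mulrC -!mulrA ler_wpM2l ?(ltW t0) // mulrCA.
(* Squares of residuals are below [d]: [d <= eps] serves products of two residuals, [d <= eps^2] a
   single one. *)
pose d := Num.min eps (eps ^+ 2).
have d0 : 0 < d by rewrite lt_min e0 exprn_gt0.
have [m hm] := archi_inv (divr_gt0 d0 t0).
(* An even exponent, so that [<x_j, E^N x_l>] splits into a product of two residuals [E^(m+1) x]. *)
pose N := (m.+1 + m.+1)%N.
have sm j : nr (iter m.+1 E (x j)) ^+ 2 <= d.
  apply: le_trans (small m j) _; rewrite mulrC -ler_pdivlMr //.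
  by apply: hm; rewrite (leq_trans _ (leq_addl _ _)).
have ThE n z : Th (iter n E z) = iter n E (Th z).
  have Tp u : Th u = t%:C%C *: (u - E u).
    by rewrite PE scalerA -rmorphM mulfV ?gt_eqF // rmorph1 scale1r.
  by rewrite !Tp (adjZ (iter_adj pE n)) iterP_comm.
pose W y := \sum_(j < N) iter j E y.
have pW : pos (fun y => t^-1%:C%C *: W y).
  by apply: pos_scale => //; apply: (pos_sum CS (index_enum 'I_N)) => j; exact: iter_pos.
have [D [Ds _ WD DC]] := pos_sqrt CS pW.
have ThD y : Th (D y) = D (Th y).
  apply: (DC Th Th) => // z; rewrite /W (adjZ Ths) (adj_sum Ths); congr (_ *: _).
  by apply: eq_bigr => j _; rewrite ThE.
pose e i := D (x i).
have Eres y : rank_sum e y = y - iter N E y.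
  have -> : rank_sum e y = D (Th (D y)).
    rewrite (adj_sum Ds); apply: eq_bigr => i _.
    by rewrite (adjA Ds) /e Ds.
  rewrite -ThD -WD (adjZ Ths) /W (adj_sum Ths) -(telescope_iter pE) scaler_sumr.
  by apply: eq_bigr => j _; rewrite PE (adjZ (iter_adj pE j)) ThE.
exists e; split.
- move=> a; set y := \sum_(i < k) _.
  have h : nr (\sum_(i < k) cmul (cstar (hip (e i) y)) (hip (e i) y)) <= nr (hip y y).
    under eq_bigr => i _ do rewrite hipC.
    rewrite -rank_sum_hip; apply: mpos_norm; first exact: mpos_hip_pos (rank_sum_pos e).
    rewrite -hipBr Eres opprB addrC subrK; exact: mpos_hip_pos (iter_pos pE N).
  have := @CS_sum _ _ (regularMod M) _ (index_enum 'I_k) (fun i => hip (e i) y) a.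
  have -> : \sum_(i < k) hip (hip (e i) y : regularMod M) (a i) = hip y y.
    by rewrite [in RHS]/y hip_sumr; apply: eq_bigr => i _; rewrite hipA /= hipC.
  move=> h2; have := le_trans h2 (ler_wpM2r (nr_ge0 _) h).
  have [->|y0] := eqVneq (nr y) 0; first by rewrite expr0n nr_ge0.
  have yp : 0 < nr y ^+ 2 by rewrite exprn_gt0 // lt_def y0 nr_ge0.
  by rewrite hip_nr expr2 ler_pM2l.
- move=> j l; rewrite Eres opprB addrC subrK /N iterD -(iter_adj pE).
  apply: le_trans (CS _ _) _.
  have := sm j; have := sm l; have : d <= eps by rewrite ge_min lexx.
  move: (nr_ge0 (iter m.+1 E (x j))) (nr_ge0 (iter m.+1 E (x l))).
  move: (nr _) (nr _) => u v u0 v0 h1 h2 h3.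
  have : 0 <= (u - v) ^+ 2 by exact: sqr_ge0.
  rewrite !expr2 in h2 h3 *; lra.
- move=> j; rewrite Eres opprB addrC subrK /N iterD.
  apply: le_trans (iter_le1 pE pP _ _) _.
  rewrite -(@ler_pXn2r _ 2) ?nnegrE ?nr_ge0 ?(ltW e0) //.
  by apply: le_trans (sm j) _; rewrite ge_min lexx orbT.
Qed.

End Frames.

(** * Positive definite kernels and tensor products *)

Section Kernels.
Variable R : realType.
Local Notation C := (complex R).

(* Finite lists over a positive definite kernel stand for the vectors of the
   pre-Hilbert space it generates, so that no completion is needed. *)
Record kernel := Kernel {
  kT :> Type ;
  kf : kT -> kT -> C ;
  kscal : C -> kT -> kT ;
  kfC : forall i j, conjc (kf i j) = kf j i ;
  kfZ : forall c i j, kf i (kscal c j) = c * kf i j ;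
  kf_ge0 : forall s : seq kT, 0 <= complex.Re (\sum_(i <- s) \sum_(j <- s) kf i j) }.

Section Theory.
Variable I : kernel.
Implicit Types (u v w : seq I) (i j : I).

Definition bf u v : C := \sum_(i <- u) \sum_(j <- v) kf i j.
Definition sn u : R := Num.sqrt (complex.Re (bf u u)).
Definition scal (c : C) u : seq I := [seq kscal c i | i <- u].
Definition sub u v := u ++ scal (-1) v.

Lemma bf_catl u v w : bf (u ++ v) w = bf u w + bf v w.
Proof. by rewrite /bf big_cat. Qed.

Lemma bf_catr u v w : bf u (v ++ w) = bf u v + bf u w.
Proof. by rewrite /bf -big_split; apply: eq_bigr => i _; rewrite big_cat. Qed.

Lemma bf_scalr c u v : bf u (scal c v) = c * bf u v.
Proof.
rewrite /bf mulr_sumr; apply: eq_bigr => i _; rewrite big_map mulr_sumr.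
by apply: eq_bigr => j _; rewrite kfZ.
Qed.

Lemma bfC u v : conjc (bf u v) = bf v u.
Proof.
rewrite /bf conj_sum [RHS]exchange_big; apply: eq_bigr => i _.
by rewrite conj_sum; apply: eq_bigr => j _; rewrite kfC.
Qed.

Lemma bf_scall c u v : bf (scal c u) v = conjc c * bf u v.
Proof. by rewrite -bfC bf_scalr conjM bfC. Qed.

Lemma bf_subl u v w : bf (sub u v) w = bf u w - bf v w.
Proof. by rewrite bf_catl bf_scall conjN1 mulN1r. Qed.

Lemma bf_subr u v w : bf u (sub v w) = bf u v - bf u w.
Proof. by rewrite bf_catr bf_scalr mulN1r. Qed.

Lemma bf_nill v : bf [::] v = 0. Proof. by rewrite /bf big_nil. Qed.

Lemma sn_ge0 u : 0 <= sn u. Proof. exact: sqrtr_ge0. Qed.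

Lemma sn_sqr u : sn u ^+ 2 = complex.Re (bf u u).
Proof. by rewrite sqr_sqrtr // kf_ge0. Qed.

Lemma bf_sn u : bf u u = (sn u ^+ 2)%:C%C.
Proof.
rewrite sn_sqr; have := bfC u u; case: (bf u u) => a b [] /eqP.
by rewrite eq_sym -addr_eq0 -mulr2n mulrn_eq0 /= => /eqP ->.
Qed.

Lemma bf_cab u : cab (bf u u) = sn u ^+ 2.
Proof. by rewrite bf_sn cabR ger0_norm // sqr_ge0. Qed.

Lemma sn_cat_sqr u v : sn (u ++ v) ^+ 2 = sn u ^+ 2 + 2 * complex.Re (bf u v) + sn v ^+ 2.
Proof.
rewrite !sn_sqr bf_catl !bf_catr !ReD -(bfC u v) ReJ; lra.
Qed.

Lemma sn_scal c u : sn (scal c u) = cab c * sn u.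
Proof.
apply/eqP; rewrite -(eqrXn2 (n := 2)) ?mulr_ge0 ?sn_ge0 ?cab_ge0 //.
rewrite exprMn !sn_sqr bf_scall bf_scalr mulrA mulJ_cab.
by rewrite ReZ.
Qed.

Lemma sn_sub_sqr u v : sn (sub u v) ^+ 2 = sn u ^+ 2 - 2 * complex.Re (bf u v) + sn v ^+ 2.
Proof. by rewrite sn_cat_sqr sn_scal bf_scalr mulN1r ReN cabN cab1 mul1r mulrN. Qed.

Lemma bf_CS u v : cab (bf u v) <= sn u * sn v.
Proof.
set b := bf u v; set B := cab b.
have key t : 0 <= sn u ^+ 2 - 2 * (t * B ^+ 2) + (t * B * sn v) ^+ 2.
  have := sqr_ge0 (sn (sub u (scal (t%:C%C * conjc b) v))).
  rewrite sn_sub_sqr sn_scal bf_scalr -mulrA -/b mulJ_cab -rmorphM /= cabM cabR cabJ -/B.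
  by rewrite !exprMn -normrX ger0_norm // sqr_ge0.
have B0 : 0 <= B by exact: cab_ge0.
rewrite -(@ler_pXn2r _ 2) ?nnegrE ?mulr_ge0 ?sn_ge0 //.
have [v0|v0] := eqVneq (sn v) 0.
  rewrite v0 mulr0 expr0n /=; apply: (@le0_small _ _ (sn u ^+ 2)); first exact: sqr_ge0.
  move=> e e0; have := key ((2 * e)^-1); rewrite v0 mulr0 expr0n addr0 /= subr_ge0.
  have -> : 2 * ((2 * e)^-1 * B ^+ 2) = B ^+ 2 / e by field; rewrite gt_eqF.
  by rewrite ler_pdivrMr // mulrC.
have vp : 0 < sn v ^+ 2 by rewrite exprn_gt0 // lt_def v0 sn_ge0.
have := key (sn v ^+ 2)^-1; rewrite !exprMn.
have -> : (sn v ^+ 2)^-1 ^+ 2 * B ^+ 2 * sn v ^+ 2 = B ^+ 2 / sn v ^+ 2.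
  by field; rewrite lt_neqAle eq_sym in vp; case/andP: vp; rewrite sqrf_eq0.
rewrite -(mulrC (B ^+ 2)) => h; rewrite -ler_pdivrMr //; lra.
Qed.

Lemma sn_cat u v : sn (u ++ v) <= sn u + sn v.
Proof.
rewrite -(@ler_pXn2r _ 2) ?nnegrE ?addr_ge0 ?sn_ge0 // sn_cat_sqr sqrrD.
have := le_trans (Re_cab _) (bf_CS u v); rewrite mulr2n; lra.
Qed.

(* Bilinear identities determine the seminorm of a combination. *)
Lemma sn_ext u v : (forall w, bf u w = bf v w) -> sn u = sn v.
Proof. by move=> h; rewrite /sn h -bfC h bfC. Qed.

Lemma sn_le u v : sn u <= sn (sub u v) + sn v.
Proof.
have -> : sn u = sn (sub u v ++ v) by apply: sn_ext => z; rewrite bf_catl bf_subl subrK.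
exact: sn_cat.
Qed.

End Theory.

Definition pull_kernel (I : kernel) (J : Type) (e : J -> I) (sc : C -> J -> J)
    (esc : forall c i j, kf i (e (sc c j)) = c * kf i (e j)) : kernel.
Proof.
apply: (@Kernel J (fun i j => kf (e i) (e j)) sc) => [i j|c i j|s].
- exact: kfC.
- exact: esc.
- have := @kf_ge0 I [seq e j | j <- s].
  by rewrite big_map; under eq_bigr do rewrite big_map.
Defined.

End Kernels.

Section ModuleKernels.
Variables (R : realType) (M : cstarAlg R).
Local Notation C := (complex R).

(** A space with a left action of [M], seen through its form. [mact_bd] bounds each matrix
    coefficient with its own constant, enough to replace an inner product by its frame approximation
    inside a finite sum. *)
Record mkernel := MKernel {
  mk :> kernel R ;
  mact : M -> mk -> mk ;
  mact_adj : forall a i j, kf (mact a i) j = kf i (mact (cstar a) j) ;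
  mactD : forall a b i j, kf i (mact (a + b) j) = kf i (mact a j) + kf i (mact b j) ;
  mactZ : forall (c : C) a i j, kf i (mact (c *: a) j) = c * kf i (mact a j) ;
  mactM : forall a b i j, kf i (mact (cmul a b) j) = kf i (mact a (mact b j)) ;
  mact_bd : forall i j, exists c : R, 0 <= c /\ forall a, cab (kf i (mact a j)) <= c * nr a }.

Section Tensor.
Variables (F : corr M) (I : mkernel).

Lemma mact0 (i j : I) : kf i (mact 0 j) = 0.
Proof. by rewrite -(scale0r 0) mactZ mul0r. Qed.

Lemma mact_sum (A : Type) (s : seq A) (f : A -> M) (i j : I) :
  kf i (mact (\sum_(x <- s) f x) j) = \sum_(x <- s) kf i (mact (f x) j).
Proof.
elim: s => [|x s IH]; first by rewrite !big_nil mact0.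
by rewrite !big_cons mactD IH.
Qed.

(** Up to a small error [<x_j, x_l>] is [sum_i <x_j, f_i> <f_i, x_l>] for a frame [f], and then the
    double sum is a sum over [i] of squared lengths of [sum_l <f_i, x_l> v_l]. *)
Lemma tensor_ge0 (s : seq (F * I)) :
  0 <= complex.Re (\sum_(p <- s) \sum_(q <- s) kf p.2 (mact (hip p.1 q.1) q.2)).
Proof.
set k := size s; pose x (j : 'I_k) := (tnth (in_tuple s) j).1.
pose v (j : 'I_k) := (tnth (in_tuple s) j).2.
rewrite big_tnth -/k; under eq_bigr => j _ do rewrite big_tnth -/k.
rewrite -[X in complex.Re X]/(\sum_j \sum_l kf (v j) (mact (hip (x j) (x l)) (v l))).
pose c j l := sval (cid (mact_bd (v j) (v l))).
have c0 j l : 0 <= c j l by rewrite /c; case: cid => ? [].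
have cP j l a : cab (kf (v j) (mact a (v l))) <= c j l * nr a.
  by rewrite /c; case: cid => ? [].
rewrite -oppr_le0; apply: (@le0_small _ _ (\sum_j \sum_l c j l)).
  by apply: sumr_ge0 => j _; exact: sumr_ge0.
move=> e e0; have [f [_ f1 _]] := frame x e0.
pose d j l := hip (x j) (x l - rank_sum f (x l)).
have E j l : kf (v j) (mact (hip (x j) (x l)) (v l)) = kf (v j) (mact (d j l) (v l)) +
    \sum_(i < k) kf (mact (hip (f i) (x j)) (v j)) (mact (hip (f i) (x l)) (v l)).
  have -> : hip (x j) (x l) = d j l + \sum_(i < k) cmul (hip (x j) (f i)) (hip (f i) (x l)).
    by rewrite /d hipBr rank_sum_hip subrK.
  rewrite mactD mact_sum; congr (_ + _); apply: eq_bigr => i _.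
  by rewrite mactM mact_adj hipC.
under eq_bigr => j _ do under eq_bigr => l _ do rewrite E.
under eq_bigr => j _ do rewrite big_split /=.
rewrite big_split /= ReD opprD.
set A := \sum_j _; set B := \sum_j _.
have B0 : 0 <= complex.Re B.
  have -> : B = \sum_(i < k) \sum_(j < k) \sum_(l < k)
      kf (mact (hip (f i) (x j)) (v j)) (mact (hip (f i) (x l)) (v l)).
    by rewrite /B [RHS]exchange_big; apply: eq_bigr => j _; rewrite exchange_big.
  rewrite (big_morph _ (@ReD R) (erefl : complex.Re (0 : C) = 0)).
  apply: sumr_ge0 => i _.
  have := @kf_ge0 R I [seq mact (hip (f i) (x j)) (v j) | j <- index_enum 'I_k].
  by rewrite big_map; under eq_bigr do rewrite big_map.
apply: (@le_trans _ _ (cab A)).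
  by have := NRe_cab A; lra.
rewrite mulr_sumr; apply: le_trans (cab_sum _ _ _) (ler_sum _ _) => j _.
rewrite mulr_sumr; apply: le_trans (cab_sum _ _ _) (ler_sum _ _) => l _. 
by apply: le_trans (cP _ _ _) _; rewrite mulrC; apply: ler_wpM2r; [exact: c0|exact: f1].
Qed.

Definition tensor_kernel : kernel R.
Proof.
apply: (@Kernel R (F * I)%type (fun p q => kf p.2 (mact (hip p.1 q.1) q.2))
  (fun c p => (p.1, kscal c p.2))).
- by move=> p q; rewrite kfC mact_adj hipC.
- by move=> c p q; rewrite /= -{1}(cstarK (hip _ _)) -mact_adj kfZ mact_adj cstarK.
- exact: tensor_ge0.
Defined.

(** Again an [mkernel], through the action on the first factor, so that [X(n) (x) (X(1) (x) H)] can
    be formed. *)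
Definition tens : mkernel.
Proof.
apply: (@MKernel tensor_kernel (fun a p => (lact a p.1, p.2))) => /=.
- by move=> a p q /=; rewrite (star_hom_adj (@lact_hom _ _ F)).
- by move=> a b p q /=; case: (@lact_hom _ _ F) => -> _ _ _; rewrite hipD mactD.
- by move=> c a p q /=; case: (@lact_hom _ _ F) => _ -> _ _; rewrite hipZ mactZ.
- by move=> a b p q /=; case: (@lact_hom _ _ F) => _ _ -> _.
move=> p q; have [c [c0 cP]] := mact_bd p.2 q.2.
exists (c * (nr p.1 * nr q.1)); split; first by rewrite !mulr_ge0 ?nr_ge0.
move=> a; apply: le_trans (cP _) _; rewrite -mulrA ler_wpM2l //.
apply: le_trans (CS_hip _ _) _; rewrite -mulrA ler_wpM2l ?nr_ge0 // mulrC.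
exact: star_hom_nr (@lact_hom _ _ F) _ _.
Defined.

Lemma tens_kfE (p q : tens) : kf p q = kf p.2 (mact (hip p.1 q.1) q.2).
Proof. by []. Qed.

Definition tmap (A : F -> F) (u : seq tens) : seq tens := [seq ((A p.1, p.2) : tens) | p <- u].

Lemma tmap_adj A A' u w : adj A A' -> bf (tmap A u) w = bf u (tmap A' w).
Proof.
move=> AA; rewrite /bf big_map; apply: eq_bigr => p _; rewrite big_map; apply: eq_bigr => q _.
by rewrite !tens_kfE AA.
Qed.

(** Write [c^2 - A^* A = B^2]; the difference of the squared seminorms is the squared seminorm of
    [(B (x) 1) u]. *)
Lemma tmap_bdd A A' c u : adj A A' -> 0 < c -> bdd A c -> sn (tmap A u) <= c * sn u.
Proof.
move=> AA c0 Ac; have CS := @CS_hip _ _ F.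
have pA := pos_star CS AA; have c2 : 0 < c ^+ 2 by rewrite exprn_gt0.
have Ab : bdd (fun x => A' (A x)) (c ^+ 2).
  move=> x; apply: le_trans (adj_bdd CS AA (ltW c0) Ac _) _.
  by rewrite expr2 -mulrA ler_wpM2l ?(ltW c0).
have idt : adj (fun x : F => (c ^+ 2)%:C%C *: x) (fun x => (c ^+ 2)%:C%C *: x).
  by apply: adj_scaleR => x y.
have [B [Bs BE]] : pos (fun x => (c ^+ 2)%:C%C *: x - A' (A x)).
  apply: (near_pos CS _ c2); first exact: adj_sub idt (pos_adj pA).
  by move=> x; rewrite opprB addrC subrK; exact: Ab.
rewrite -(@ler_pXn2r _ 2) ?nnegrE ?mulr_ge0 ?sn_ge0 ?(ltW c0) // exprMn.
rewrite -subr_ge0; have -> : c ^+ 2 * sn u ^+ 2 - sn (tmap A u) ^+ 2 = sn (tmap B u) ^+ 2.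
  rewrite !sn_sqr -ReZ -ReN -ReD; congr complex.Re.
  rewrite /bf !big_map mulr_sumr -sumrN -big_split; apply: eq_bigr => p _ /=.
  rewrite !big_map mulr_sumr -sumrN -big_split; apply: eq_bigr => q _ /=.
  rewrite -mactZ -mulN1r -mactZ -mactD; congr (kf _ (mact _ _)).
  by rewrite AA Bs -BE hipBr hipZ scaleN1r.
exact: sqr_ge0.
Qed.

End Tensor.
End ModuleKernels.

Section HilbertSpace.
Variables (R : realType) (H : hilbSpace R).
Local Notation C := (complex R).
Implicit Types x y z : H.

Definition ip x y : C := hip x y.

Lemma ipC x y : conjc (ip x y) = ip y x.
Proof. exact: (@hipC R (complexAlg R) H x y). Qed.

Lemma ipDr x y z : ip x (y + z) = ip x y + ip x z.
Proof. exact: (@hipD R (complexAlg R) H). Qed.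

Lemma ipDl x y z : ip (x + y) z = ip x z + ip y z.
Proof. exact: (@hipDl R (complexAlg R) H). Qed.

Lemma ipZr (c : C) x y : ip x (c *: y) = c * ip x y.
Proof. exact: (@hipZ R (complexAlg R) H). Qed.

Lemma ipZl (c : C) x y : ip (c *: x) y = conjc c * ip x y.
Proof. exact: (@hipZl R (complexAlg R) H). Qed.

Lemma ip0r x : ip x 0 = 0. Proof. exact: (@hip0r R (complexAlg R) H). Qed.

Lemma ip0l x : ip 0 x = 0. Proof. exact: (@hip0l R (complexAlg R) H). Qed.

Lemma ipNr x y : ip x (- y) = - ip x y.
Proof. by rewrite -scaleN1r ipZr mulN1r. Qed.

Lemma ipNl x y : ip (- x) y = - ip x y.
Proof. by rewrite -scaleN1r ipZl conjN1 mulN1r. Qed.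

Lemma ipBr x y z : ip x (y - z) = ip x y - ip x z.
Proof. by rewrite ipDr ipNr. Qed.

Lemma ipBl x y z : ip (x - y) z = ip x z - ip y z.
Proof. by rewrite ipDl ipNl. Qed.

Lemma ip_sumr I (s : seq I) (f : I -> H) x : ip x (\sum_(i <- s) f i) = \sum_(i <- s) ip x (f i).
Proof. by elim/big_rec2: _ => [|i u v _ <-]; rewrite ?ip0r ?ipDr. Qed.

Lemma ip_suml I (s : seq I) (f : I -> H) x : ip (\sum_(i <- s) f i) x = \sum_(i <- s) ip (f i) x.
Proof. by elim/big_rec2: _ => [|i u v _ <-]; rewrite ?ip0l ?ipDl. Qed.

Lemma ipxx x : ip x x = (nr x ^+ 2)%:C%C.
Proof.
rewrite -(@hip_nr R (complexAlg R) H x).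
have [b E] := @hip_ge0 R (complexAlg R) H x.
have -> : ip x x = (cab b ^+ 2)%:C%C by rewrite -mulJ_cab; exact: E.
congr (_%:C%C); rewrite E.
by rewrite -[RHS]/(cab (conjc b * b)) mulJ_cab cabR ger0_norm // sqr_ge0.
Qed.

Lemma Re_ipxx x : complex.Re (ip x x) = nr x ^+ 2.
Proof. by rewrite ipxx. Qed.

Lemma ip_CS x y : cab (ip x y) <= nr x * nr y.
Proof. exact: (@CS_hip R (complexAlg R) H x y). Qed.

Lemma ip_inj x y : (forall z, ip z x = ip z y) -> x = y.
Proof. exact: (@hip_inj R (complexAlg R) H x y). Qed.

End HilbertSpace.

Section HilbertKernel.
Variables (R : realType) (M : cstarAlg R) (H : hilbSpace R) (sigma : M -> adjOp H).
Local Notation C := (complex R).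
Hypothesis hsigma : star_hom sigma.

(** Operators [E] for which [M] still acts by adjoints in the form [<h, E l>]. Besides the identity
    and the defect, complements such as [1 - E], [1 - B^2] and [c^2 - B B^*] serve: positivity of
    their tensor kernel is an inequality between two seminorms. *)
Record invariant_form := InvariantForm {
  iform :> H -> H ;
  iform_adj : adj iform iform ;
  iform_ge0 : forall h, 0 <= complex.Re (ip h (iform h)) ;
  iform_comm : forall a h, iform (sigma a h) = sigma a (iform h) }.

Variable E : invariant_form.

Lemma iform_ip x y : ip (E x) y = ip x (E y).
Proof. exact: (@iform_adj E). Qed.

Definition hilb_kernel : kernel R.
Proof.
apply: (@Kernel R H (fun h l => ip h (E l)) (fun c h => c *: h)).
- by move=> h l; rewrite ipC; exact: iform_adj.
- by move=> c h l; rewrite (adjZ (@iform_adj E)) ipZr.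
- move=> s; have := iform_ge0 E (\sum_(h <- s) h).
  rewrite (adj_sum (@iform_adj E)) ip_suml.
  by under eq_bigr do rewrite ip_sumr.
Defined.

Definition hker : mkernel M.
Proof.
apply: (@MKernel _ _ hilb_kernel (fun a h => sigma a h)) => /=.
- by move=> a h l; rewrite iform_comm; exact: (star_hom_adj hsigma).
- by move=> a b h l; case: (hsigma) => sD _ _ _; rewrite sD (adjD (@iform_adj E)) ipDr.
- by move=> c a h l; case: (hsigma) => _ sZ _ _; rewrite sZ (adjZ (@iform_adj E)) ipZr.
- by move=> a b h l; case: (hsigma) => _ _ sM _; rewrite sM.
move=> h l; exists (nr (E h) * nr l); split; first by rewrite mulr_ge0 ?nr_ge0.
move=> a; have -> : ip h (E (sigma a l)) = ip (E h) (sigma a l) by rewrite iform_ip.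
apply: le_trans (ip_CS _ _) _; rewrite -mulrA ler_wpM2l ?nr_ge0 // mulrC.
exact: star_hom_nr hsigma _ _.
Defined.

End HilbertKernel.

(** * Contractivity of a representation on the tensor product *)

Section Contraction.
Variables (R : realType) (M : cstarAlg R) (H : hilbSpace R) (sigma : M -> adjOp H).
Local Notation C := (complex R).
Hypothesis hsigma : star_hom sigma.

Definition id_form : invariant_form sigma.
Proof.
apply: (@InvariantForm _ _ _ sigma id) => //.
by move=> h; rewrite Re_ipxx sqr_ge0.
Defined.

Variables (F : corr M) (tau : F -> adjOp H).
Hypothesis tau_lin : forall h, linear (fun x => tau x h).
Hypothesis tau_cc : forall k (x : 'I_k -> 'I_k -> F),
  mxop_norm (fun i j => tau (x i j)) <= mxlink_norm x.
Hypothesis tau_right : forall x (a : M) h, tau (hact x a) h = tau x (sigma a h).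

Lemma tauD x y h : tau (x + y) h = tau x h + tau y h.
Proof. by have := tau_lin h 1 x y; rewrite !scale1r. Qed.

Lemma tau0 h : tau 0 h = 0.
Proof. by have := tauD 0 0 h; rewrite addr0 => /eqP; rewrite -subr_eq0 opprD addrA subrr sub0r oppr_eq0 => /eqP. Qed.

Lemma tau_sum I (s : seq I) (f : I -> F) h : tau (\sum_(i <- s) f i) h = \sum_(i <- s) tau (f i) h.
Proof. by elim/big_rec2: _ => [|i u v _ <-]; rewrite ?tau0 ?tauD. Qed.

Lemma colnorm_nr N (G : hilbMod N) k (v : 'I_k -> G) i : nr (v i) <= @colnorm R N G k v.
Proof.
rewrite -(ger0_norm (nr_ge0 (v i))) -sqrtr_sqr ler_wsqrtr // -hip_nr.
apply: mpos_norm; first exact: mpos_hip.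
rewrite (bigD1 i) //= addrC addrK big_mkcond; apply: mpos_sum => j.
by case: ifP => _; [exact: mpos_hip|exact: mpos0].
Qed.

Lemma colnorm_le N (G : hilbMod N) k (v : 'I_k -> G) :
  @colnorm R N G k v ^+ 2 <= \sum_(i < k) nr (v i) ^+ 2.
Proof.
rewrite sqr_sqrtr; last exact: nr_ge0.
apply: le_trans (nr_sum _ _ _) _; apply: ler_sum => i _.
by rewrite hip_nr.
Qed.

Lemma colnorm_row N (G : hilbMod N) k (v : 'I_k.+1 -> G) :
  (forall i, i != ord0 -> v i = 0) -> @colnorm R N G k.+1 v = nr (v ord0).
Proof.
move=> v0; rewrite /colnorm (bigD1 ord0) //= big1 => [|i i0]; last by rewrite v0 // hip0l.
rewrite addr0 -[complex.Re _]/(nr (hip (v ord0) (v ord0))) hip_nr sqrtr_sqr.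
by rewrite ger0_norm // nr_ge0.
Qed.

(** Complete contractivity is applied to the square matrix with first row [e] and zeros elsewhere,
    whose norm in the linking algebra is at most 1. *)
Lemma tau_row k (e : 'I_k -> F) (h : 'I_k -> H) : row_contraction e ->
  nr (\sum_(i < k) tau (e i) (h i)) ^+ 2 <= \sum_(i < k) nr (h i) ^+ 2.
Proof.
case: k e h => [|k] e h re; first by rewrite !big_ord0 nr0 expr0n.
pose x (i j : 'I_k.+1) := if i == ord0 then e j else 0.
have link1 : mxlink_norm x <= 1.
  apply: ge_sup.
    exists (colnorm (fun i => \sum_(j < k.+1) hact (x i j) (0 : M))).
    exists (fun=> 0) => //=; rewrite /colnorm big1 => [|i _]; last by rewrite hip0r.
    by rewrite normr0 sqrtr0.
  move=> _ [a /= a1 <-]; rewrite colnorm_row => [|i /negPf i0]; last first.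
    by rewrite big1 // => j _; rewrite /x i0 hact0l.
  rewrite -(@ler_pXn2r _ 2) ?nnegrE ?nr_ge0 // /x eqxx; apply: le_trans (re a) _.
  rewrite expr1n; have : colnorm a ^+ 2 <= 1 by rewrite expr_le1 ?sqrtr_ge0.
  by rewrite sqr_sqrtr //; exact: nr_ge0.
have op1 (v : 'I_k.+1 -> H) : colnorm v <= 1 -> nr (\sum_(i < k.+1) tau (e i) (v i)) <= 1.
  move=> v1; apply: le_trans (le_trans (tau_cc x) link1).
  have -> : nr (\sum_(i < k.+1) tau (e i) (v i)) =
      colnorm (fun i => \sum_(j < k.+1) tau (x i j) (v j)).
    rewrite colnorm_row /x ?eqxx // => i /negPf ->.
    by rewrite big1 // => j _; rewrite tau0.
  apply: ub_le_sup; last by exists v.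
  have bt j : exists c, 0 <= c /\ bdd (tau (e j)) c.
    exact: adjOp_bdd.
  pose c j := sval (cid (bt j)).
  have c0 j : 0 <= c j by rewrite /c; case: cid => ? [].
  have cP j : bdd (tau (e j)) (c j) by rewrite /c; case: cid => ? [].
  exists (\sum_j c j) => _ [w /= w1 <-].
  rewrite colnorm_row => [|i /negPf i0]; last first.
    by rewrite big1 // => j _; rewrite /x i0 tau0.
  apply: le_trans (nr_sum _ _ _) _; apply: ler_sum => j _; rewrite /x eqxx.
  apply: le_trans (cP _ _) _; rewrite ler_piMr ?c0 //.
  exact: le_trans (colnorm_nr w j) w1.
set S := \sum_(i < _) _ ^+ 2.
have S0 : 0 <= S by apply: sumr_ge0 => i _; exact: sqr_ge0.
have [S00|Sn] := eqVneq S 0.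
  have h0 i : h i = 0.
    apply: nr_eq0; apply/eqP; rewrite -sqrf_eq0; apply/eqP.
    have := @psumr_eq0P R _ predT (fun i => nr (h i) ^+ 2).
    by move=> /(_ (fun i _ => sqr_ge0 _) S00 i isT).
  rewrite S00 big1 ?nr0 ?expr0n // => i _.
  by rewrite h0 (adj0 (adjOp_adj _)).
have Sp : 0 < Num.sqrt S by rewrite sqrtr_gt0 lt_def Sn.
pose v i := (Num.sqrt S)^-1%:C%C *: h i.
have := op1 v _; have -> : \sum_(i < k.+1) tau (e i) (v i) =
    (Num.sqrt S)^-1%:C%C *: \sum_(i < k.+1) tau (e i) (h i).
  by rewrite scaler_sumr; apply: eq_bigr => i _; rewrite (adjZ (adjOp_adj _)).
rewrite nrZr gtr0_norm ?invr_gt0 // mulrC ler_pdivrMr // mul1r => hh.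
rewrite -[S]sqr_sqrtr // ler_pXn2r ?nnegrE ?nr_ge0 ?sqrtr_ge0 //; apply: hh.
rewrite -(@ler_pXn2r _ 2) ?nnegrE ?sqrtr_ge0 // expr1n; apply: le_trans (colnorm_le _) _.
under eq_bigr => i _ do rewrite nrZr exprMn.
rewrite -mulr_sumr -/S ger0_norm ?invr_ge0 ?sqrtr_ge0 // exprVn sqr_sqrtr //.
by rewrite mulVf.
Qed.

Lemma tau_nr x h : nr (tau x h) <= nr x * nr h.
Proof.
have [x0|x0] := eqVneq (nr x) 0; first by rewrite (nr_eq0 x0) tau0 !nr0 mul0r.
have xp : 0 < nr x by rewrite lt_def x0 nr_ge0.
have := @tau_row 1 (fun=> (nr x)^-1%:C%C *: x) (fun=> h).
rewrite !big_ord1 => /(_ _) hh.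
have : nr (tau ((nr x)^-1%:C%C *: x) h) <= nr h.
  rewrite -(@ler_pXn2r _ 2) ?nnegrE ?nr_ge0 //; apply: hh => a.
  rewrite !big_ord1 cmulV_nr ler_pXn2r ?nnegrE ?nr_ge0 //.
  have hactn (y : F) b : nr (hact y b) <= nr y * nr b.
    rewrite -(@ler_pXn2r _ 2) ?nnegrE ?mulr_ge0 ?nr_ge0 // -hip_nr hipA hipAl.
    apply: le_trans (cmul_nr _ _) _; rewrite exprMn -hip_nr [nr b ^+ 2]expr2 mulrA.
    rewrite ler_wpM2r ?nr_ge0 //; apply: le_trans (cmul_nr _ _) _.
    by rewrite cstar_nr mulrC.
  apply: le_trans (hactn _ _) _; rewrite nrZr gtr0_norm ?invr_gt0 // mulVf //.
  by rewrite mul1r.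
have -> : tau ((nr x)^-1%:C%C *: x) h = (nr x)^-1%:C%C *: tau x h.
  by have := tau_lin h (nr x)^-1%:C%C x 0; rewrite !addr0 tau0 addr0.
by rewrite nrZr gtr0_norm ?invr_gt0 // mulrC ler_pdivrMr // mulrC.
Qed.

Definition tau_ker := tens F (hker hsigma id_form).

(** Expanding the [x_j] over a frame [f] turns the sum into a row [sum_i tau (f_i) y_i], with
    [y_i = sum_l sigma <f_i, x_l> h_l], to which [tau_row] applies; [sum_i |y_i|^2] is the squared
    seminorm of [u], both up to a small error. *)
Lemma tau_contraction (u : seq tau_ker) : nr (\sum_(p <- u) tau p.1 p.2) <= sn u.
Proof.
set k := size u; pose x (j : 'I_k) := (tnth (in_tuple u) j).1.
pose h (j : 'I_k) : H := (tnth (in_tuple u) j).2.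
have Eu : \sum_(p <- u) tau p.1 p.2 = \sum_(j < k) tau (x j) (h j) by rewrite big_tnth.
have Su : sn u ^+ 2 = complex.Re (\sum_(j < k) \sum_(l < k) ip (h j) (sigma (hip (x j) (x l)) (h l))).
  by rewrite sn_sqr /bf big_tnth; congr complex.Re; apply: eq_bigr => j _; rewrite big_tnth.
rewrite -(@ler_pXn2r _ 2) ?nnegrE ?nr_ge0 ?sn_ge0 // Su Eu.
set S := complex.Re _.
pose K1 := \sum_j nr (h j); pose K2 := \sum_j \sum_l nr (h j) * nr (h l).
have K10 : 0 <= K1 by apply: sumr_ge0 => j _; exact: nr_ge0.
have K20 : 0 <= K2 by do 2 (apply: sumr_ge0 => ? _); rewrite mulr_ge0 ?nr_ge0.
have S0 : 0 <= S by rewrite /S -Su sqr_ge0.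
suff key e : 0 < e -> nr (\sum_j tau (x j) (h j)) <= e * K1 + Num.sqrt (S + e * K2).
  move: key; set A := nr _ => key; have A0 : 0 <= A by exact: nr_ge0.
  apply: (@le_small _ _ _ (K2 + 2 * (A * K1))); first by rewrite addr_ge0 ?mulr_ge0.
  move=> e e0; have := key _ e0; have SK : 0 <= S + e * K2 by rewrite addr_ge0 // mulr_ge0 // ltW.
  rewrite -lerBlDl => hA.
  have [hp|hn] := leP 0 (A - e * K1).
    have := hA; rewrite -(@ler_pXn2r _ 2) ?nnegrE ?sqrtr_ge0 // sqr_sqrtr //.
    have := sqr_ge0 (e * K1); rewrite !expr2; lra.
  have eK : 0 <= e * K1 by rewrite mulr_ge0 // ltW.
  have : A * A <= A * (e * K1) by rewrite ler_wpM2l // ltW // -subr_lt0.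
  have : 0 <= A * (e * K1) by rewrite mulr_ge0.
  have : 0 <= e * K2 by rewrite mulr_ge0 // ltW.
  rewrite expr2; lra.
move=> e0; have [f [rf f1 f2]] := frame x e0.
pose y i := \sum_l sigma (hip (f i) (x l)) (h l).
have -> : \sum_j tau (x j) (h j) =
    \sum_j tau (x j - rank_sum f (x j)) (h j) + \sum_i tau (f i) (y i).
  have -> : \sum_i tau (f i) (y i) = \sum_j tau (rank_sum f (x j)) (h j).
    under [RHS]eq_bigr => j _ do rewrite tau_sum.
    rewrite exchange_big; apply: eq_bigr => i _.
    by rewrite (adj_sum (adjOp_adj _)); apply: eq_bigr => j _; rewrite tau_right.
  by rewrite -big_split /=; apply: eq_bigr => j _; rewrite -tauD subrK.
apply: le_trans (nrD _ _) (lerD _ _).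
  apply: le_trans (nr_sum _ _ _) _; rewrite mulr_sumr; apply: ler_sum => j _.
  by apply: le_trans (tau_nr _ _) _; rewrite ler_wpM2r ?nr_ge0.
rewrite -(ger0_norm (nr_ge0 (\sum_i tau (f i) (y i)))) -sqrtr_sqr ler_wsqrtr //.
apply: le_trans (tau_row _ rf) _.
have -> : \sum_i nr (y i) ^+ 2 =
    complex.Re (\sum_j \sum_l ip (h j) (sigma (hip (x j) (rank_sum f (x l))) (h l))).
  under [in RHS]eq_bigr => j _ do under eq_bigr => l _ do
    rewrite rank_sum_hip (star_hom_sum hsigma) ip_sumr.
  under [in RHS]eq_bigr => j _ do rewrite exchange_big.
  rewrite exchange_big (big_morph _ (@ReD R) (erefl : complex.Re (0 : C) = 0)) /=.
  apply: eq_bigr => i _; rewrite -Re_ipxx ip_suml; congr complex.Re.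
  apply: eq_bigr => j _; rewrite ip_sumr; apply: eq_bigr => l _.
  case: (hsigma) => _ _ sM _; rewrite sM.
  by rewrite [LHS](star_hom_adj hsigma) hipC.
rewrite /S -lerBlDl -ReN -ReD -sumrB.
apply: le_trans (Re_cab _) _; rewrite mulr_sumr; apply: le_trans (cab_sum _ _ _) (ler_sum _ _) => j _.
rewrite -sumrB mulr_sumr; apply: le_trans (cab_sum _ _ _) (ler_sum _ _) => l _.
have -> : ip (h j) (sigma (hip (x j) (rank_sum f (x l))) (h l)) - ip (h j) (sigma (hip (x j) (x l)) (h l))
    = - ip (h j) (sigma (hip (x j) (x l - rank_sum f (x l))) (h l)).
  case: (hsigma) => sD _ _ _; rewrite hipBr sD (star_homN hsigma) ipDr ipNr opprD opprK addrC.
  by [].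
rewrite cabN; apply: le_trans (ip_CS _ _) _; rewrite mulrCA ler_wpM2l ?nr_ge0 //.
apply: le_trans (star_hom_nr hsigma _ _) _; rewrite ler_wpM2r ?nr_ge0 //.
Qed.

End Contraction.

(** * Contractions out of incomplete spaces *)

Section Approximants.
Variables (R : realType) (H : hilbSpace R).
Local Notation C := (complex R).

Definition Ps (J : kernel R) (f : J -> H) (u : seq J) : H := \sum_(j <- u) f j.

Record contr (J : kernel R) := Contr {
  cfun :> J -> H ;
  cfunZ : forall c j, cfun (kscal c j) = c *: cfun j ;
  cfun_le : forall u, nr (Ps cfun u) <= sn u }.

Section Single.
Variables (J : kernel R) (Phi Psi : contr J).
Implicit Types (u v w : seq J) (g h : H).

Lemma Ps_cat u v : Ps Phi (u ++ v) = Ps Phi u + Ps Phi v.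
Proof. by rewrite /Ps big_cat. Qed.

Lemma Ps_scal c u : Ps Phi (scal c u) = c *: Ps Phi u.
Proof. by rewrite /Ps big_map scaler_sumr; apply: eq_bigr => j _; rewrite cfunZ. Qed.

Lemma Ps_sub u v : Ps Phi (sub u v) = Ps Phi u - Ps Phi v.
Proof. by rewrite Ps_cat Ps_scal scaleN1r. Qed.

(* [u] approximates the vector [Phi ^* h], which lives in the completion only. *)
Definition apx h u (e : R) := forall w, cab (bf u w - ip h (Ps Phi w)) <= e * sn w.

Lemma sn_bf_le u (c : R) : 0 <= c -> cab (bf u u) <= c * sn u -> sn u <= c.
Proof.
move=> c0; rewrite bf_cab expr2.
have [->//|u0] := eqVneq (sn u) 0.
by rewrite ler_pM2r // lt_def u0 sn_ge0.
Qed.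

Lemma apx_sn h u e : 0 <= e -> apx h u e -> sn u <= nr h + e.
Proof.
move=> e0 hu; apply: sn_bf_le; first by rewrite addr_ge0 ?nr_ge0.
apply: le_trans (cab_le _ (ip h (Ps Phi u))) _; rewrite mulrDl addrC lerD //.
by apply: le_trans (ip_CS _ _) _; rewrite ler_wpM2l ?nr_ge0 ?cfun_le.
Qed.

Lemma apx_dist h u v e d : 0 <= e -> 0 <= d -> apx h u e -> apx h v d -> sn (sub u v) <= e + d.
Proof.
move=> e0 d0 hu hv; apply: sn_bf_le; first exact: addr_ge0.
rewrite [bf (sub u v) _]bf_subl mulrDl.
apply: le_trans (cabB_le _ (ip h (Ps Phi (sub u v))) _) (lerD (hu _) _).
by rewrite cabBC.
Qed.

(** The Riesz theorem without completeness: take [u] within [e^2] of the supremum of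
    [2 Re <h, Phi v> - |v|^2], perturb it by [- t conj(D) w], and choose [t = e / (B sn w)]. *)
Lemma apx_ex h (e : R) : 0 < e -> exists u, apx h u e.
Proof.
move=> e0; pose val v := 2 * complex.Re (ip h (Ps Phi v)) - sn v ^+ 2.
have vub v : val v <= nr h ^+ 2.
  have : complex.Re (ip h (Ps Phi v)) <= nr h * sn v.
    apply: le_trans (Re_cab _) (le_trans (ip_CS _ _) _).
    by rewrite ler_wpM2l ?nr_ge0 ?cfun_le.
  rewrite /val; have := sqr_ge0 (nr h - sn v); rewrite !expr2; lra.
pose S : set R := range val.
have supS : has_sup S.
  split; first by exists (val [::]), [::].
  by exists (nr h ^+ 2) => _ [v _ <-].
have [_ [u _ <-] hu] := @sup_adherent _ S (e ^+ 2) (exprn_gt0 _ e0) supS.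
have umax v : val v <= val u + e ^+ 2.
  have : val v <= sup S by apply: (ub_le_sup (proj2 supS)); exists v.
  lra.
exists u => w; set D := bf u w - _; set B := cab D.
have B0 : 0 <= B by exact: cab_ge0.
have key (t : R) : 2 * (t * B ^+ 2) <= e ^+ 2 + (t * B * sn w) ^+ 2.
  have := umax (u ++ scal ((- t)%:C%C * conjc D) w).
  rewrite /val sn_cat_sqr sn_scal Ps_cat Ps_scal ipDr ipZr ReD bf_scalr.
  have -> : complex.Re ((- t)%:C%C * conjc D * bf u w) =
      complex.Re ((- t)%:C%C * conjc D * ip h (Ps Phi w)) - t * B ^+ 2.
    rewrite -[bf u w](subrK (ip h (Ps Phi w))) -/D mulrDr ReD addrC; congr (_ + _).
    by rewrite -mulrA mulJ_cab -rmorphM /= mulNr.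
  rewrite cabM cabR cabJ normrN -/B !exprMn real_normK ?num_real //.
  lra.
have [w0|w0] := eqVneq (sn w) 0.
  rewrite w0 mulr0; suff -> : B = 0 by [].
  apply/eqP; rewrite -sqrf_eq0 eq_le sqr_ge0 andbT.
  apply: (@le0_small _ _ (e ^+ 2)); first exact: sqr_ge0.
  move=> d d0; have := key ((2 * d)^-1); rewrite w0 mulr0 expr0n addr0 /=.
  have -> : 2 * ((2 * d)^-1 * B ^+ 2) = B ^+ 2 / d by field; rewrite gt_eqF.
  by rewrite ler_pdivrMr // mulrC.
have [B00|Bn] := eqVneq B 0; first by rewrite B00 mulr_ge0 ?sn_ge0 // ltW.
have wp : 0 < sn w by rewrite lt_def w0 sn_ge0.
have Bp : 0 < B by rewrite lt_def Bn.
have := key (e / (B * sn w)).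
have -> : e / (B * sn w) * B * sn w = e by field; rewrite ?(gt_eqF wp) ?(gt_eqF Bp).
have -> : 2 * (e / (B * sn w) * B ^+ 2) = 2 * (e * B / sn w).
  by field; rewrite ?(gt_eqF wp) ?(gt_eqF Bp).
move=> h1; have : e * B / sn w <= e ^+ 2 by lra.
by rewrite ler_pdivrMr // expr2 -mulrA ler_pM2l.
Qed.

End Single.

Section Product.
Variables (J : kernel R).
Implicit Types (u v w : seq J) (g h : H) (Phi Psi : contr J).

Lemma Qex Phi Psi h : exists l : H, forall e u, 0 < e -> apx Psi h u e -> nr (Ps Phi u - l) <= e.
Proof.
have [e e0|e e' _ _ e0 e0' [u [hu ->]] [u' [hu' ->]]|l hl] :=
  @approx_point _ H (fun e x => exists u, apx Psi h u e /\ x = Ps Phi u).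
- by have [u hu] := apx_ex Psi h e0; exists (Ps Phi u), u.
- rewrite -Ps_sub; apply: le_trans (cfun_le _ _) _.
  exact: (apx_dist (ltW e0) (ltW e0') hu hu').
by exists l => e u e0 hu; apply: hl => //; exists u.
Qed.

(* [Phi Psi ^*] *)
Definition Qfun Phi Psi h : H := sval (cid (Qex Phi Psi h)).

Lemma QfunP Phi Psi h e u : 0 < e -> apx Psi h u e -> nr (Ps Phi u - Qfun Phi Psi h) <= e.
Proof. by rewrite /Qfun; case: cid => l hl /=; exact: hl. Qed.

(** The identity [<Phi^* g, Psi^* h> = <g, Phi Psi^* h>], for approximants. *)
Lemma apx_bf Phi Psi g h u v (e d : R) : 0 <= e -> 0 < d -> apx Phi g u e -> apx Psi h v d ->
  cab (bf u v - ip g (Qfun Phi Psi h)) <= e * (nr h + d) + nr g * d.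
Proof.
move=> e0 d0 gu hv; apply: le_trans (cabB_le _ (ip g (Ps Phi v)) _) (lerD _ _).
  by apply: le_trans (gu v) _; rewrite ler_wpM2l // (apx_sn (ltW d0) hv).
rewrite -ipBr; apply: le_trans (ip_CS _ _) _; rewrite ler_wpM2l ?nr_ge0 //.
exact: QfunP hv.
Qed.

Lemma Qfun_adj Phi Psi g h : ip (Qfun Psi Phi g) h = ip g (Qfun Phi Psi h).
Proof.
apply/eqP; rewrite -subr_eq0; apply/eqP/cab_eq0/eqP; rewrite eq_le cab_ge0 andbT.
apply: (@le_small1 _ _ _ (2 * (nr g + nr h + 1))).
  by rewrite mulr_ge0 ?addr_ge0 ?nr_ge0.
move=> e e0 e1; rewrite add0r.
have [u hu] := apx_ex Phi g e0; have [v hv] := apx_ex Psi h e0.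
have h1 := apx_bf (ltW e0) e0 hu hv; have h2 := apx_bf (ltW e0) e0 hv hu.
apply: le_trans (cabB_le _ (bf u v) _) _.
have -> : cab (ip (Qfun Psi Phi g) h - bf u v) = cab (bf v u - ip h (Qfun Psi Phi g)).
  by rewrite cabBC -(bfC v u) -(ipC h) -conjN -conjD cabJ.
apply: le_trans (lerD h2 h1) _; rewrite !mulrDr.
have : e * e <= e * 1 by rewrite ler_pM2l.
rewrite !mulr1 (mulrC (nr h)) (mulrC (nr g)); lra.
Qed.

Definition Qop Phi Psi : adjOp H := @AdjOp _ _ H (Qfun Phi Psi) (Qfun Psi Phi)
  (fun g h => @Qfun_adj Psi Phi g h).

Lemma Qfun_nr Phi Psi h : nr (Qfun Phi Psi h) <= nr h.
Proof.
apply: (@le_small _ _ _ 2) => // e e0.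
have [u hu] := apx_ex Psi h e0; have := QfunP Phi e0 hu; rewrite nrBC.
have := nr_le (Qfun Phi Psi h) (Ps Phi u).
have := le_trans (cfun_le Phi u) (apx_sn (ltW e0) hu); lra.
Qed.

Lemma Qfun_ge0 Phi h : 0 <= complex.Re (ip h (Qfun Phi Phi h)).
Proof.
rewrite -oppr_le0; apply: (@le0_small _ _ (2 * nr h + 1)).
  by rewrite addr_ge0 ?mulr_ge0 ?nr_ge0.
move=> e0 e00; pose e := Num.min e0 1.
have e0' : 0 < e by rewrite lt_min e00 ltr01.
have [u hu] := apx_ex Phi h e0'.
have h1 := apx_bf (ltW e0') e0' hu hu.
have := NRe_cab (ip h (Qfun Phi Phi h) - bf u u).
rewrite ReD ReN -sn_sqr cabBC.
have := sqr_ge0 (sn u).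
have ee : e <= e0 by rewrite ge_min lexx.
have e1 : e <= 1 by rewrite ge_min lexx orbT.
have := nr_ge0 h.
have : e * (nr h + e) + nr h * e <= e0 * (2 * nr h + 1).
  have -> : e * (nr h + e) + nr h * e = e * (2 * nr h + e) by lra.
  by rewrite ler_pM ?(ltW e0') ?addr_ge0 ?mulr_ge0 ?nr_ge0 ?(ltW e0') // lerD2l.
lra.
Qed.

(* Intertwining: if [f] on lists is adjoint to [f'] and [Phi] carries [f'] to [b'], then [f]
   carries approximants of [h] to approximants of [b h]. *)
Lemma apx_map Phi (f f' : seq J -> seq J) (b b' : H -> H) (c : R) h u e :
  (forall v w, bf (f v) w = bf v (f' w)) -> (forall w, sn (f' w) <= c * sn w) ->
  (forall x y, ip (b x) y = ip x (b' y)) -> (forall w, Ps Phi (f' w) = b' (Ps Phi w)) ->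
  0 <= e -> apx Phi h u e -> apx Phi (b h) (f u) (e * c).
Proof.
move=> ff fc bb Pf e0 hu w; rewrite ff bb -Pf; apply: le_trans (hu _) _.
by rewrite -mulrA ler_wpM2l.
Qed.

Lemma Qfun_comm Phi Psi (f f' : seq J -> seq J) (B : adjOp H) (c : R) h :
  (forall v w, bf (f v) w = bf v (f' w)) -> 0 < c -> (forall w, sn (f' w) <= c * sn w) ->
  (forall w, Ps Psi (f' w) = aadj B (Ps Psi w)) -> (forall w, Ps Phi (f w) = B (Ps Phi w)) ->
  Qfun Phi Psi (B h) = B (Qfun Phi Psi h).
Proof.
move=> ff c0 fc Pf' Pf; have [k [k0 Bk]] := adjOp_bdd B.
apply/eqP; rewrite -subr_eq0; apply/eqP.
apply: (@nr_eq0_small _ _ _ (c + k)); first by rewrite addr_ge0 // ltW.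
move=> s s0; have [u hu] := apx_ex Psi h s0.
have hBu : apx Psi (B h) (f u) (s * c).
  by apply: (apx_map ff fc _ Pf' (ltW s0) hu) => x y; exact: (adjP B).
have h1 := QfunP Phi (mulr_gt0 s0 c0) hBu; have h2 := QfunP Phi s0 hu.
apply: le_trans (nrB_le _ (B (Ps Phi u)) _) _; rewrite mulrDr; apply: lerD.
  by rewrite nrBC -Pf.
rewrite -(adjB (adjOp_adj B)); apply: le_trans (Bk _) _.
by rewrite mulrC ler_wpM2r.
Qed.

End Product.

Section Dense.
Variables (I J : kernel R) (e : J -> I).
Hypothesis eE : forall i j, kf (e i) (e j) = kf i j.
Definition dense_in := forall (u : seq I) (d : R), 0 < d ->
  exists w : seq J, sn (sub u (map e w)) <= d.
Hypothesis de : dense_in.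
Implicit Types (Phi Psi : contr J).

Lemma bf_map u v : bf (map e u) (map e v) = bf u v.
Proof.
rewrite /bf big_map; apply: eq_bigr => i _; rewrite big_map.
by apply: eq_bigr => j _.
Qed.

Lemma sn_map u : sn (map e u) = sn u.
Proof. by rewrite /sn bf_map. Qed.

Lemma dense_small (z : seq I) k : 0 <= k ->
  (forall w, cab (bf z (map e w)) <= k * sn w) -> sn z <= k.
Proof.
move=> k0 h; apply: (@le_small _ _ _ 2) => // d d0.
have [w hw] := de z d0.
have : sn (map e w) <= k + d.
  apply: sn_bf_le; first by rewrite addr_ge0 // ltW.
  have -> : bf (map e w) (map e w) = bf z (map e w) - bf (sub z (map e w)) (map e w).
    by rewrite bf_subl opprB addrC subrK.
  apply: le_trans (cabD _ _) _; rewrite cabN mulrDl sn_map lerD //.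
  apply: le_trans (bf_CS _ _) _; rewrite sn_map ler_wpM2r ?sn_ge0 //.
have := sn_le z (map e w); lra.
Qed.

(** Like [apx], but [u] ranges over the larger kernel and is tested on the dense part where [Phi] is
    defined. Adjoints of shifts, and the inclusion of [X(n+1)], lead out of that part. *)
Definition fapx Phi (h : H) (u : seq I) (d : R) :=
  forall w : seq J, cab (bf u (map e w) - ip h (Ps Phi w)) <= d * sn w.

Lemma apx_fapx Phi h u d : apx Phi h u d -> fapx Phi h (map e u) d.
Proof. by move=> hu w; rewrite bf_map; exact: hu. Qed.

Lemma fapx_dist Phi h u v d k : 0 <= d -> 0 <= k -> fapx Phi h u d -> fapx Phi h v k ->
  sn (sub u v) <= d + k.
Proof.
move=> d0 k0 hu hv; apply: dense_small; first exact: addr_ge0.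
move=> w; rewrite bf_subl mulrDl.
apply: le_trans (cabB_le _ (ip h (Ps Phi w)) _) (lerD (hu _) _).
by rewrite cabBC.
Qed.

Lemma fapx_bf Phi Psi g h u v (d k : R) : 0 <= d -> 0 <= k ->
  fapx Phi g u d -> fapx Psi h v k ->
  cab (bf u v - ip g (Qfun Phi Psi h)) <= d * (nr h + k) + nr g * k.
Proof.
move=> d0 k0 gu hv.
apply: (@le_small1 _ _ _ (2 * (nr h + nr g + d + k + 2))).
  by rewrite mulr_ge0 ?addr_ge0 ?nr_ge0.
move=> s s0 s1; have [u0 hu0] := apx_ex Phi g s0; have [v0 hv0] := apx_ex Psi h s0.
have h1 := fapx_dist d0 (ltW s0) gu (apx_fapx hu0).
have h2 := fapx_dist k0 (ltW s0) hv (apx_fapx hv0).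
have h3 := apx_bf (ltW s0) s0 hu0 hv0.
have n0 := apx_sn (ltW s0) hu0; have m0 := apx_sn (ltW s0) hv0.
have mv : sn v <= nr h + s + (k + s).
  by apply: le_trans (sn_le _ (map e v0)) _; rewrite sn_map addrC lerD.
have -> : bf u v - ip g (Qfun Phi Psi h) = bf (sub u (map e u0)) v +
    bf (map e u0) (sub v (map e v0)) + (bf u0 v0 - ip g (Qfun Phi Psi h)).
  by rewrite bf_subl bf_subr bf_map addrA [_ + (_ - bf u0 v0)]addrA !subrK.
apply: le_trans (cabD _ _) _; apply: le_trans (lerD (cabD _ _) h3) _.
have b1 : cab (bf (sub u (map e u0)) v) <= (d + s) * (nr h + s + (k + s)).
  by apply: le_trans (bf_CS _ _) _; rewrite ler_pM ?sn_ge0.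
have b2 : cab (bf (map e u0) (sub v (map e v0))) <= (nr g + s) * (k + s).
  by apply: le_trans (bf_CS _ _) _; rewrite ler_pM ?sn_ge0 // sn_map.
apply: le_trans (lerD (lerD b1 b2) (lexx _)) _.
have ss : s * s <= s by rewrite ler_piMl // ltW.
have := nr_ge0 g; have := nr_ge0 h; move: (nr g) (nr h) => a b b0 a0; nra.
Qed.

End Dense.
End Approximants.

Section Single.
Variables (R : realType) (M : cstarAlg R) (F : corr M) (K : mkernel M).
Local Notation C := (complex R).

Lemma mactN (a : M) (i j : K) : kf i (mact (- a) j) = - kf i (mact a j).
Proof. by rewrite -scaleN1r mactZ mulN1r. Qed.

Definition sg (x : F) (i : K) : seq (tens F K) := [:: ((x, i) : tens F K)].

Lemma bf_sgl x i (w : seq (tens F K)) :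
  bf (sg x i) w = \sum_(q <- w) kf i (mact (hip x q.1) q.2).
Proof. by rewrite /bf big_seq1. Qed.

Lemma bf_sg_sub x y i w : bf (sub (sg x i) (sg y i)) w = bf (sg (x - y) i) w.
Proof.
rewrite bf_subl !bf_sgl -sumrB; apply: eq_bigr => q _.
by rewrite hipBl mactD mactN.
Qed.

Lemma bf_sg_sum I (s : seq I) (f : I -> F) i w :
  bf [seq ((f a, i) : tens F K) | a <- s] w = bf (sg (\sum_(a <- s) f a) i) w.
Proof.
rewrite bf_sgl /bf big_map exchange_big; apply: eq_bigr => q _ /=.
by rewrite hip_suml mact_sum.
Qed.

Lemma sn_sg_sqr x i : sn (sg x i) ^+ 2 = complex.Re (kf i (mact (hip x x) i)).
Proof. by rewrite sn_sqr bf_sgl big_seq1. Qed.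

End Single.

Section Embedding.
Variables (R : realType) (M : cstarAlg R) (H : hilbSpace R) (rho : M -> adjOp H).
Hypothesis hrho : star_hom rho.
Hypothesis faithful : forall a, (forall x, rho a x = 0) -> a = 0.
Local Notation C := (complex R).

(** If [m] is attached to the negative part [n] of [b], then [|rho (m c) g|^2] is minus the form of
    [rho b] at [rho (n c) g], so it vanishes and faithfulness gives [m c = 0]. *)
Lemma faithful_mpos (b : M) : cstar b = b ->
  (forall h, 0 <= complex.Re (ip h (rho b h))) -> mpos b.
Proof.
move=> bs bp.
have [n [m [ns ms nm pb]]] :=
  negative_part (@regular_CS R M) (fun x y => etrans (@lmul_adj R M b x y) (congr1 (fun z => hip x (cmul z y)) bs)).
apply: pb => c; apply: faithful => g; apply: nr_eq0; apply/eqP; rewrite -sqrf_eq0 eq_le sqr_ge0 andbT -Re_ipxx.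
have -> : ip (rho (m c) g) (rho (m c) g) = - ip (rho (n c) g) (rho b (rho (n c) g)).
  have hM : forall a b' x, rho (cmul a b') x = rho a (rho b' x) by case: hrho.
  have E : cmul (cstar (m c)) (m c) = - cmul (cstar (n c)) (cmul b (n c)).
    have := ms c (m c); rewrite -[m (m c)]opprK -nm hipNr -ns; exact.
  have -> : ip (rho (m c) g) (rho (m c) g) = ip g (rho (cmul (cstar (m c)) (m c)) g).
    by rewrite hM; exact: (star_hom_adj hrho).
  rewrite E (star_homN hrho) ipNr !hM; congr (- _).
  by rewrite [RHS](star_hom_adj hrho).
by rewrite ReN oppr_le0 bp.
Qed.

End Embedding.

(** * Density in the C*- and the W*-setting *)

Section Total.
Variables (R : realType) (M : cstarAlg R) (H : hilbSpace R) (sigma : M -> adjOp H).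
Hypothesis hsigma : star_hom sigma.
Local Notation C := (complex R).

(* The span of the range of [t] tensored with [H] is dense in [F] tensored with [H]. *)
Definition total (F : hilbMod M) (A : Type) (t : A -> F) := forall (y : F) (h : H) (d : R), 0 < d ->
  exists s : seq A, complex.Re (ip h (sigma (hip (y - \sum_(a <- s) t a) (y - \sum_(a <- s) t a)) h)) <= d.

Lemma dense_span_nr (V : normedModType C) (A : Type) (t : A -> V) : dense_span t ->
  forall y (d : R), 0 < d -> exists s : seq A, nr (y - \sum_(a <- s) t a) <= d.
Proof.
move=> dt y d d0.
have : closure [set z | exists s : seq A, z = \sum_(i <- s) t i] y by rewrite dt.
have dC : 0 < d%:C%C :> C by rewrite ltcR.
move=> /(_ (ball y d%:C%C)) [|_ [[s ->] /=]]; first exact: nbhsx_ballx.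
rewrite -ball_normE /= => h; exists s; apply: ltW.
by rewrite -ltcR -nrE.
Qed.

Lemma sigma_hip_le (F : hilbMod M) (x : F) h :
  complex.Re (ip h (sigma (hip x x) h)) <= (nr x * nr h) ^+ 2.
Proof.
apply: le_trans (Re_cab _) (le_trans (ip_CS _ _) _).
rewrite exprMn mulrC -hip_nr expr2 mulrA ler_wpM2r ?nr_ge0 //.
exact: star_hom_nr.
Qed.

Lemma dense_total (F : hilbMod M) (A : Type) (t : A -> F) : dense_span t -> total t.
Proof.
move=> dt y h d d0; pose e := Num.min 1 d / (nr h + 1).
have hp : 0 < nr h + 1 by rewrite ltr_wpDl ?nr_ge0.
have m0 : 0 < Num.min 1 d by rewrite lt_min ltr01.
have [s hs] := dense_span_nr dt y (divr_gt0 m0 hp); exists s.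
apply: le_trans (sigma_hip_le _ _) _.
have h1 : nr (y - \sum_(a <- s) t a) * nr h <= Num.min 1 d.
  move: hs; rewrite ler_pdivlMr // => h1; apply: le_trans h1.
  by rewrite ler_wpM2l ?nr_ge0 // lerDl.
apply: (@le_trans _ _ (Num.min 1 d * 1)).
  rewrite expr2 ler_pM ?mulr_ge0 ?nr_ge0 //; apply: le_trans h1 _.
  by rewrite ge_min lexx.
by rewrite mulr1 ge_min lexx orbT.
Qed.

Variable E : invariant_form sigma.
Hypothesis E1 : forall h, complex.Re (ip h (E h)) <= nr h ^+ 2.

Lemma iform_le (F : corr M) (x : F) (h : H) :
  complex.Re (ip h (E (sigma (hip x x) h))) <= complex.Re (ip h (sigma (hip x x) h)).
Proof.
have c_adj : adj (fun h => h - E h) (fun h => h - E h).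
  by apply: adj_sub => //; exact: iform_adj.
have c_ge0 g : 0 <= complex.Re (ip g (g - E g)).
  by rewrite ipBr ReD ReN Re_ipxx subr_ge0.
have c_comm a g : sigma a g - E (sigma a g) = sigma a (g - E g).
  by rewrite (adjB (adjOp_adj _)) iform_comm.
have := @kf_ge0 _ (tens F (hker hsigma (InvariantForm c_adj c_ge0 c_comm))) [:: (x, h)].
rewrite !big_seq1 /= ipBr ReD ReN subr_ge0; exact.
Qed.

(** [total] approximates [y] only in the seminorm of one given [h]. This suffices, because the
    finitely many elementary tensors of a list are approximated one by one. *)
Lemma total_dense (F : corr M) (A : Type) (t : A -> F) (J : kernel R)
    (e : J -> tens F (hker hsigma E)) (mkJ : A -> H -> J) : total t ->
  (forall a h, e (mkJ a h) = (t a, h)) -> dense_in e.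
Proof.
move=> tt eE u; elim: u => [|[y h] u IH] d d0.
  exists [::]; rewrite /sn bf_nill /= sqrtr0; exact: ltW.
have d2 : 0 < d / 2 by rewrite divr_gt0.
have [w hw] := IH _ d2.
have [s hs] := tt y h ((d / 2) ^+ 2) (exprn_gt0 _ d2).
exists ([seq mkJ a h | a <- s] ++ w).
pose p : seq (tens F (hker hsigma E)) := sg (y - \sum_(a <- s) t a) (h : hker hsigma E).
have -> : sn (sub (((y, h) : tens F (hker hsigma E)) :: u) (map e ([seq mkJ a h | a <- s] ++ w))) = sn (p ++ sub u (map e w)).
  apply: sn_ext => z; rewrite map_cat -map_comp.
  have -> : [seq (e \o mkJ^~ h) i | i <- s] = [seq (t a, h) : tens F (hker hsigma E) | a <- s].
    by apply: eq_map => a /=; rewrite eE.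
  rewrite -[_ :: u]/(sg y (h : hker hsigma E) ++ u).
  rewrite [RHS]bf_catl !bf_subl !bf_catl bf_sg_sum /p -(bf_sg_sub y _ (h : hker hsigma E)) bf_subl opprD addrACA.
  by [].
apply: le_trans (sn_cat _ _) _; rewrite [leRHS]splitr lerD //.
rewrite -(@ler_pXn2r _ 2) ?nnegrE ?sn_ge0 ?(ltW d2) // sn_sg_sqr.
by apply: le_trans hs; exact: iform_le.
Qed.

End Total.

(** * Density of [K] in its self-dual completion, after tensoring with the space of [M] *)

Section SelfDual.
Variables (R : realType) (M : cstarAlg R) (v : vonNeumann M).
Variables (F K : corr M) (j : K -> F).
Hypothesis cj : self_dual_completion j.
Local Notation C := (complex R).
Local Notation G := (vspace v).
Local Notation rho := (vrep v).
Let hrho : star_hom rho := @vrep_hom R M v.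
Local Notation gker := (hker hrho (id_form rho)).
Local Notation VK := (tens K gker).
Local Notation VF := (tens F gker).

Let e (p : VK) : VF := (j p.1, p.2).

Lemma j_hip x y : hip (j x) (j y) = hip x y. Proof. by case: cj => [[]]. Qed.

Lemma jZ c x : j (c *: x) = c *: j x.
Proof.
case: cj => [[[lj _] _ _] _ _].
have j0 : j 0 = 0.
  have := lj 1 0 0; rewrite !scale1r addr0 => /eqP.
  by rewrite -subr_eq0 opprD addrA subrr sub0r oppr_eq0 => /eqP.
by have := lj c x 0; rewrite !addr0 j0 addr0.
Qed.

Lemma jD x y : j (x + y) = j x + j y.
Proof. by case: cj => [[[lj _] _ _] _ _]; have := lj 1 x y; rewrite !scale1r. Qed.

Lemma jN x : j (- x) = - j x.
Proof. by rewrite -scaleN1r jZ scaleN1r. Qed.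

Lemma jA x a : j (hact x a) = hact (j x) a.
Proof. by case: cj => [[[_ aj] _ _] _ _]. Qed.

Lemma j_sum I (s : seq I) (f : I -> K) : j (\sum_(i <- s) f i) = \sum_(i <- s) j (f i).
Proof.
elim: s => [|i s IH]; first by rewrite !big_nil -[0 in LHS](scale0r 0) jZ scale0r.
by rewrite !big_cons jD IH.
Qed.

Lemma j_nr x : nr (j x) = nr x.
Proof.
apply/eqP; rewrite -(eqrXn2 (n := 2)) ?nr_ge0 // -!hip_nr j_hip.
by [].
Qed.

Lemma e_kf (p q : VK) : kf (e p) (e q) = kf p q.
Proof. by rewrite !tens_kfE j_hip. Qed.

(** The adjoint of [g |-> z (x) g], restricted to the image of [K (x) G]. *)
Definition pairing (z : F) (p : VK) : G := rho (hip z (j p.1)) p.2.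

Lemma pairing_ip z f u : ip f (Ps (pairing z) u) = bf (sg z (f : gker)) (map e u).
Proof. by rewrite /Ps ip_sumr bf_sgl big_map. Qed.

Lemma sg_nr (z : F) (f : G) : sn (sg z (f : gker)) <= nr z * nr f.
Proof.
rewrite -(@ler_pXn2r _ 2) ?nnegrE ?sn_ge0 ?mulr_ge0 ?nr_ge0 // sn_sg_sqr.
exact: sigma_hip_le.
Qed.

Lemma pairing_nr z u : nr (Ps (pairing z) u) <= nr z * sn u.
Proof.
have [->|w0] := eqVneq (nr (Ps (pairing z) u)) 0; first by rewrite mulr_ge0 ?nr_ge0 ?sn_ge0.
have wp : 0 < nr (Ps (pairing z) u) by rewrite lt_def w0 nr_ge0.
rewrite -(ler_pM2l wp) -expr2 -Re_ipxx pairing_ip.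
apply: le_trans (Re_cab _) (le_trans (bf_CS _ _) _).
rewrite (sn_map e_kf) mulrA ler_wpM2r ?sn_ge0 // mulrC; exact: sg_nr.
Qed.

Lemma pairingZ z c p : pairing z (kscal c p) = c *: pairing z p.
Proof. by rewrite /pairing /= (adjZ (adjOp_adj _)). Qed.

Lemma pairing_contr z : nr z <= 1 -> exists P : contr G VK, forall p, P p = pairing z p.
Proof.
move=> z1; unshelve eexists (@Contr _ _ _ (pairing z) (pairingZ z) _); last by [].
by move=> u; apply: le_trans (pairing_nr z u) _; rewrite ler_piMl ?sn_ge0.
Qed.

Lemma Ps_ext (J : kernel R) (f g : J -> G) u : (forall p, f p = g p) -> Ps f u = Ps g u.
Proof. by move=> fg; apply: eq_bigr. Qed.

Section Commutant.
Variable B : adjOp G.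
Hypothesis BM : forall a x, B (rho a x) = rho a (B x).

Lemma adj_ipE x y : ip (B x) y = ip x (aadj B y).
Proof. exact: (adjP B). Qed.

Lemma rho_ip a x y : ip (rho a x) y = ip x (rho (cstar a) y).
Proof. exact: (star_hom_adj hrho). Qed.

Lemma aadj_comm a x : aadj B (rho a x) = rho a (aadj B x).
Proof.
apply: ip_inj => z; rewrite -adj_ipE -[in LHS](cstarK a) -rho_ip -BM adj_ipE.
by rewrite rho_ip cstarK.
Qed.

Let f (u : seq VK) : seq VK := [seq ((p.1, B p.2) : VK) | p <- u].
Let f' (u : seq VK) : seq VK := [seq ((p.1, aadj B p.2) : VK) | p <- u].

Lemma commutant_adj u w : bf (f u) w = bf u (f' w).
Proof.
rewrite /bf big_map; apply: eq_bigr => p _; rewrite big_map; apply: eq_bigr => q _.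
by rewrite !tens_kfE /= adj_ipE aadj_comm.
Qed.

Lemma commutant_bdd : exists c : R, 0 < c /\ forall u : seq VK, sn (f' u) <= c * sn u.
Proof.
have [c0 [c00 Bc]] := adjOp_bdd B.
pose c := c0 + 1; have cp : 0 < c by rewrite ltr_wpDl.
have Bc' : bdd B c.
  by move=> x; apply: le_trans (Bc x) _; rewrite ler_wpM2r ?nr_ge0 // lerDl.
exists c; split=> // u.
pose D (x : G) := (c ^+ 2)%:C%C *: x - B (aadj B x).
have BB : adj (fun x => B (aadj B x)) (fun x => B (aadj B x)).
  exact: adj_comp (adjOp_adj B) (adjC (adjOp_adj B)).
have D_adj : adj D D.
  by apply: adj_sub => //; apply: adj_scaleR => x y.
have D_ge0 x : 0 <= complex.Re (ip x (D x)).
  have -> : ip x (D x) = ((c * nr x) ^+ 2 - nr (aadj B x) ^+ 2)%:C%C.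
    rewrite ipBr ipZr ipxx -[ip x (B _)]ipC adj_ipE ipC ipxx -rmorphM -rmorphB.
    by rewrite exprMn.
  rewrite /= subr_ge0 ler_pXn2r ?nnegrE ?mulr_ge0 ?nr_ge0 ?(ltW cp) //.
  exact: (adj_bdd (@CS_hip _ _ G) (adjOp_adj B) (ltW cp) Bc').
have D_comm a x : D (rho a x) = rho a (D x).
  by rewrite /D (adjB (adjOp_adj _)) (adjZ (adjOp_adj _)) aadj_comm BM.
have := @kf_ge0 _ (tens K (hker hrho (InvariantForm D_adj D_ge0 D_comm))) u.
have E : \sum_(p <- u) \sum_(q <- u) @kf _ (tens K (hker hrho (InvariantForm D_adj D_ge0 D_comm))) p q =
    (c ^+ 2)%:C%C * bf u u - bf (f' u) (f' u).
  rewrite /bf big_map mulr_sumr -sumrB; apply: eq_bigr => p _.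
  rewrite big_map mulr_sumr -sumrB; apply: eq_bigr => q _.
  rewrite !tens_kfE /= /D ipBr ipZr; congr (_ - _).
  by rewrite -[LHS]ipC adj_ipE ipC aadj_comm.
rewrite E ReD ReN ReZ -!sn_sqr subr_ge0 => h.
by rewrite -(@ler_pXn2r _ 2) ?nnegrE ?mulr_ge0 ?sn_ge0 ?(ltW cp) // exprMn.
Qed.

End Commutant.

Section Projection.
Variables (y : F) (P : contr G VK).
Hypothesis Py : forall p, P p = pairing y p.

(* [rho a] is the compression of [P] to the operator [L_z ^* Pi L_y], where [Pi] projects on
   the closure of [j K (x) G] and [L_x g = x (x) g]. *)
Definition rel z a := exists c : R, forall e u g, 0 < e -> apx P g u e ->
  nr (Ps (pairing z) u - rho a g) <= c * e.

Lemma rhoD a b x : rho (a + b) x = rho a x + rho b x.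
Proof. by case: hrho. Qed.

Lemma rhoZ (c : C) a x : rho (c *: a) x = c *: rho a x.
Proof. by case: hrho. Qed.

Lemma rhoM a b x : rho (cmul a b) x = rho a (rho b x).
Proof. by case: hrho. Qed.

Lemma rel_uniq z a b : rel z a -> rel z b -> a = b.
Proof.
move=> [c hc] [d hd]; apply/eqP; rewrite -subr_eq0; apply/eqP/(@vrep_faithful R M v) => g.
apply: (@nr_eq0_small _ _ _ (`|c| + `|d|)); first by rewrite addr_ge0.
move=> s s0; have [u hu] := apx_ex P g s0.
rewrite rhoD (star_homN hrho); apply: le_trans (nrB_le _ (Ps (pairing z) u) _) _.
have h1 := hc _ _ _ s0 hu; have h2 := hd _ _ _ s0 hu.
rewrite nrBC mulrDr mulrC [X in _ <= _ + X]mulrC; apply: lerD.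
  by apply: le_trans h1 _; rewrite ler_pM2r // ler_norm.
by apply: le_trans h2 _; rewrite ler_pM2r // ler_norm.
Qed.

Lemma Ps_pairingD z t u : Ps (pairing (z + t)) u = Ps (pairing z) u + Ps (pairing t) u.
Proof. by rewrite /Ps -big_split; apply: eq_bigr => p _; rewrite /pairing hipDl rhoD. Qed.

Lemma Ps_pairingZ (c : C) z u : Ps (pairing (c *: z)) u = conjc c *: Ps (pairing z) u.
Proof. by rewrite /Ps scaler_sumr; apply: eq_bigr => p _; rewrite /pairing hipZl rhoZ. Qed.

Lemma Ps_pairingA z b u : Ps (pairing (hact z b)) u = rho (cstar b) (Ps (pairing z) u).
Proof.
rewrite /Ps (adj_sum (adjOp_adj _)); apply: eq_bigr => p _.
by rewrite /pairing hipAl rhoM.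
Qed.

Lemma rel_lin (c : C) z t a b : rel z a -> rel t b -> rel (c *: z + t) (conjc c *: a + b).
Proof.
move=> [k hk] [l hl]; exists (cab c * k + l) => s u g s0 hu.
rewrite Ps_pairingD Ps_pairingZ rhoD rhoZ opprD addrACA -scalerBr mulrDl.
apply: le_trans (nrD _ _) (lerD _ (hl _ _ _ s0 hu)).
by rewrite nrZ cabJ -mulrA ler_wpM2l ?cab_ge0 // (hk _ _ _ s0 hu).
Qed.

Lemma rel_act z b a : rel z a -> rel (hact z b) (cmul (cstar b) a).
Proof.
move=> [k hk]; exists (nr b * k) => s u g s0 hu.
rewrite Ps_pairingA rhoM -(adjB (adjOp_adj _)).
apply: le_trans (star_hom_nr hrho _ _) _; rewrite cstar_nr -mulrA ler_wpM2l ?nr_ge0 //.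
exact: hk.
Qed.

(** Up to scaling [z] into the unit ball, [L_z^* Pi L_y] is [Qop P' P]. It commutes with every [B]
    in the commutant of [rho], since [1 (x) B] preserves [K (x) G]; hence it lies in the
    bicommutant. *)
Lemma rel_ex z : exists a, rel z a.
Proof.
pose l := nr z + 1; have lp : 0 < l by rewrite ltr_wpDl ?nr_ge0.
pose z' := l^-1%:C%C *: z.
have z1 : nr z' <= 1.
  by rewrite nrZr gtr0_norm ?invr_gt0 // mulrC ler_pdivrMr // mul1r lerDl.
have [P' hP'] := pairing_contr z1.
have [B BM|a ha] := @vrep_bicommutant R M v (Qop P' P).
  move=> g /=; have [c [c0 hc]] := commutant_bdd BM.
  apply: (Qfun_comm _ (commutant_adj BM) c0 hc) => w.
    rewrite (adj_sum (adjC (adjOp_adj B))) /Ps big_map; apply: eq_bigr => p _.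
    by rewrite !Py /pairing /= aadj_comm.
  rewrite (adj_sum (adjOp_adj B)) /Ps big_map; apply: eq_bigr => p _.
  by rewrite !hP' /pairing /= BM.
exists (l%:C%C *: a), l => s u g s0 hu.
have -> : Ps (pairing z) u = l%:C%C *: Ps P' u.
  rewrite (Ps_ext _ hP') Ps_pairingZ conjc_real scalerA -rmorphM mulfV ?gt_eqF //.
  by rewrite rmorph1 scale1r.
rewrite rhoZ -ha -scalerBr nrZr gtr0_norm // ler_pM2l //.
exact: QfunP hu.
Qed.

Lemma rel_j k : rel (j k) (hip (j k) y).
Proof.
exists (nr k) => s u g s0 hu.
set D := _ - _.
have [D0|D0] := eqVneq (nr D) 0; first by rewrite D0 mulr_ge0 ?nr_ge0 // ltW.
have Dp : 0 < nr D by rewrite lt_def D0 nr_ge0.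
rewrite -(ler_pM2l Dp) -expr2 -Re_ipxx.
have -> : ip D D = ip D (Ps (pairing (j k)) u) - ip D (rho (hip (j k) y) g) by rewrite -ipBr.
have -> : ip D (Ps (pairing (j k)) u) = conjc (bf u [:: ((k, D) : VK)]).
  by rewrite pairing_ip bfC -[sg _ _]/(map e [:: ((k, D) : VK)]) (bf_map e_kf).
have -> : ip D (rho (hip (j k) y) g) = conjc (ip g (Ps P [:: ((k, D) : VK)])).
  rewrite ipC /Ps big_seq1 Py /pairing /= -[hip (j k) y]hipC -[in RHS](cstarK (hip y _)).
  by rewrite rho_ip !cstarK.
rewrite -conjN -conjD; apply: le_trans (Re_cab _) _; rewrite cabJ.
apply: le_trans (hu _) _.
have : sn [:: ((k, D) : VK)] <= nr k * nr D.
  rewrite -(sn_map e_kf) -(j_nr k); exact: sg_nr.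
move=> h; apply: le_trans (ler_wpM2l (ltW s0) h) _.
by rewrite (_ : nr D * _ = s * (nr k * nr D)) //; ring.
Qed.

(** [rho a^*] is [L_y^* Pi L_z], where [L_y] is a contraction, so [a a^* <= <z, z>]; the order is
    tested in the faithful representation. *)
Lemma rel_bound z a : rel z a -> nr a <= nr z.
Proof.
move=> [c hc].
have key h : nr (rho (cstar a) h) ^+ 2 <= complex.Re (ip h (rho (hip z z) h)).
  set g := rho (cstar a) h; pose S := sn (sg z (h : gker)).
  have ES : S ^+ 2 = complex.Re (ip h (rho (hip z z) h)) by rewrite /S sn_sg_sqr.
  rewrite -ES ler_pXn2r ?nnegrE ?nr_ge0 ?sn_ge0 //.
  have [->|g0] := eqVneq (nr g) 0; first exact: sn_ge0.
  have gp : 0 < nr g by rewrite lt_def g0 nr_ge0.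
  rewrite -(ler_pM2r gp); apply: (@le_small _ _ _ (S + nr h * `|c|)).
    by rewrite addr_ge0 ?sn_ge0 // mulr_ge0 ?nr_ge0.
  move=> s s0; have [u hu] := apx_ex P g s0.
  rewrite -expr2 -Re_ipxx.
  have -> : ip g g = ip h (rho a g) by rewrite {1}/g rho_ip cstarK.
  rewrite -[rho a g](subKr (Ps (pairing z) u)) ipBr ReD ReN pairing_ip.
  have h1 := le_trans (Re_cab _) (bf_CS (sg z (h : gker)) (map e u)).
  rewrite (sn_map e_kf) -/S in h1.
  have h2 : S * sn u <= S * (nr g + s) by rewrite ler_wpM2l ?sn_ge0 // (apx_sn (ltW s0) hu).
  have h3 := le_trans (NRe_cab _) (ip_CS h (Ps (pairing z) u - rho a g)).
  have h4 : nr (Ps (pairing z) u - rho a g) <= `|c| * s.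
    by apply: le_trans (hc _ _ _ s0 hu) _; rewrite ler_pM2r // ler_norm.
  have := ler_wpM2l (nr_ge0 h) h4; lra.
have p : mpos (hip z z - cmul a (cstar a)).
  apply: (faithful_mpos hrho (@vrep_faithful R M v)).
    by rewrite cstarD cstarN hipC cstarM cstarK.
  move=> h; rewrite rhoD (star_homN hrho) ipBr ReD ReN subr_ge0; apply: le_trans (key h).
  by rewrite rhoM -[in X in X <= _](cstarK a) -rho_ip !cstarK Re_ipxx.
have pa : mpos (cmul a (cstar a)) by rewrite -{1}(cstarK a); exact: mpos_star.
have := mpos_norm pa p; rewrite -{1}(cstarK a) cmulV_nr cstar_nr hip_nr.
by rewrite ler_pXn2r ?nnegrE ?nr_ge0.
Qed.

(** The map [z |-> a_z^*], that is [L_y^* Pi L_z], is a bounded module map on [F], so it is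
    [<y0, .>] by self-duality. It agrees with [<y, .>] on the image of [K], where [Pi] acts
    trivially, and uniqueness in the completion gives [y0 = y]. *)
Lemma rel_self : rel y (hip y y).
Proof.
pose a z := sval (cid (rel_ex z)).
have az z : rel z (a z) by rewrite /a; case: cid.
pose tau z : regularMod M := cstar (a z).
case: (cj) => _ sdF uniq.
have [||y0 hy0] := sdF tau.
- split=> [c z t|z b].
    rewrite /tau (rel_uniq (az _) (rel_lin c (az z) (az t))).
    by rewrite cstarD cstarZ conjcK.
  rewrite /tau (rel_uniq (az _) (rel_act b (az z))).
  by rewrite cstarM cstarK.
- exists 1 => z; rewrite mul1r !nrE lecR.
  by rewrite [X in X <= _]cstar_nr (rel_bound (az z)).
have aj k : tau (j k) = hip y (j k).
  by rewrite /tau (rel_uniq (az _) (rel_j k)) hipC.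
have [||y' [hy' uy']] := uniq (fun k => hip y (j k)).
- split=> [c z t|z b]; first by rewrite jD jZ hipD hipZ.
  by rewrite jA hipA.
- exists `|y| => k; rewrite !nrE -rmorphM lecR; apply: le_trans (CS_hip _ _) _.
  by rewrite j_nr.
have y0y : y0 = y.
  have -> : y = y' by rewrite -(uy' y).
  by apply/esym/uy' => k; rewrite -hy0 aj.
have -> : hip y y = a y by rewrite -[a y]cstarK -/(tau y) hy0 y0y hipC.
exact: az.
Qed.

(** [rel_self] says that [L_y^* Pi L_y = L_y^* L_y], so [y (x) g] is at distance 0 from the range of
    [Pi]. *)
Lemma projection_dense g d : 0 < d -> exists u, sn (sub (sg y (g : gker)) (map e u)) <= d.
Proof.
move=> d0; have [c hc] := rel_self.
pose k := 3 * (nr g * `|c|) + nr g + 1.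
have kp : 0 < k by rewrite /k ltr_wpDl // addr_ge0 ?mulr_ge0 ?nr_ge0.
pose s := Num.min 1 (d ^+ 2 / k).
have s0 : 0 < s by rewrite lt_min ltr01 divr_gt0 // exprn_gt0.
have [u hu] := apx_ex P g s0; exists u.
rewrite -(@ler_pXn2r _ 2) ?nnegrE ?sn_ge0 ?(ltW d0) // sn_sub_sqr (sn_map e_kf) -pairing_ip.
rewrite sn_sg_sqr -[kf _ _]/(ip g (rho (hip y y) g)).
have PP : Ps P u = Ps (pairing y) u by apply: Ps_ext.
set A := ip g (rho (hip y y) g); set B := ip g (Ps (pairing y) u).
have h1 : cab (A - B) <= nr g * (`|c| * s).
  rewrite cabBC -ipBr; apply: le_trans (ip_CS _ _) _; rewrite ler_wpM2l ?nr_ge0 //.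
  by apply: le_trans (hc _ _ _ s0 hu) _; rewrite ler_pM2r // ler_norm.
have h2 : cab (bf u u - B) <= s * (nr g + s).
  rewrite /B -PP; apply: le_trans (hu u) _.
  by rewrite ler_pM2l // (apx_sn (ltW s0) hu).
have e1 := Re_cab (A - B); have e2 := Re_cab (bf u u - B).
rewrite !ReD !ReN in e1 e2; rewrite sn_sqr.
have s1 : s <= 1 by rewrite ge_min lexx.
have sk : s * k <= d ^+ 2 by rewrite -ler_pdivlMr // ge_min lexx orbT.
have ss : s * s <= s by rewrite ler_piMl // ltW.
have gc : 0 <= nr g * `|c| * s by rewrite !mulr_ge0 ?nr_ge0 // ltW.
move: sk; rewrite /k; lra.
Qed.

End Projection.
End SelfDual.

Section CommonApproximation.
Variables (R : realType) (M : cstarAlg R) (v : vonNeumann M).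
Variables (F K : corr M) (j : K -> F).
Hypothesis cj : self_dual_completion j.
Local Notation C := (complex R).
Local Notation G := (vspace v).
Local Notation rho := (vrep v).
Local Notation gker := (hker (@vrep_hom R M v) (id_form rho)).
Local Notation VK := (tens K gker).
Local Notation VF := (tens F gker).
Let e (p : VK) : VF := (j p.1, p.2).

Lemma sn_sum (J : kernel R) (u : seq J) : sn u <= \sum_(p <- u) sn [:: p].
Proof.
elim: u => [|p u IH]; first by rewrite big_nil /sn bf_nill /= sqrtr0.
by rewrite big_cons -cat1s; apply: le_trans (sn_cat _ _) _; rewrite lerD2l.
Qed.

(** In the manner of Kaplansky density, one bounded [k] must serve all the vectors. Take
    [j k = theta y], with [theta] the frame operator for the first components of all the separate
    approximants: [theta] almost fixes these, while [theta] and [1 - theta] are contractions. *)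
Lemma common_approx y (A : finType) (gs : A -> G) (d : R) : nr y <= 1 -> 0 < d ->
  exists k, nr (j k) <= 1 /\ forall a, sn (sg (y - j k) (gs a : gker)) <= d.
Proof.
move=> y1 d0; have d2 : 0 < d / 2 by rewrite divr_gt0.
have [P hP] := pairing_contr v cj y1.
have U a := projection_dense cj hP (gs a) d2.
pose u a := sval (cid (U a)).
have hu a : sn (sub (sg y (gs a : gker)) (map e (u a))) <= d / 2 by rewrite /u; case: cid.
pose us : seq (K * G) := flatten [seq (u a : seq (K * G)) | a <- index_enum A].
pose w := \sum_(p <- us) nr p.2.
have w0 : 0 <= w by apply: sumr_ge0 => p _; exact: nr_ge0.
have wp : 0 < w + 1 by rewrite ltr_wpDl.
pose x (i : 'I_(size us)) := (tnth (in_tuple us) i).1.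
have [f [rf _ fx]] := frame x (divr_gt0 d2 wp).
pose jf i := j (f i).
have rjf : row_contraction jf.
  move=> a; under eq_bigr => i _ do rewrite -(jA cj).
  rewrite -(j_sum cj) (j_nr cj); exact: rf.
pose D z := z - rank_sum jf z.
have CS := @CS_hip _ _ F.
have pD : pos D by exact: row_contraction_le1.
have Dj k : D (j k) = j (k - rank_sum f k).
  rewrite (jD cj) (jN cj) (j_sum cj); congr (_ - _); apply: eq_bigr => i _.
  by rewrite (jA cj) (j_hip cj).
have D1 : bdd D 1.
  apply: (pos_le_bdd CS ler01 pD); apply: pos_ext (rank_sum_pos jf) => z.
  by rewrite rmorph1 scale1r /D opprB addrC subrK.
have T1 : bdd (rank_sum jf) 1.
  apply: (pos_le_bdd CS ler01 (rank_sum_pos jf)); apply: pos_ext pD => z.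
  by rewrite rmorph1 scale1r.
pose k := \sum_i hact (f i) (hip (jf i) y).
have jk : j k = rank_sum jf y.
  by rewrite /k (j_sum cj); apply: eq_bigr => i _; rewrite (jA cj).
exists k; split.
  by rewrite jk; apply: le_trans (T1 y) _; rewrite mul1r.
move=> a; rewrite jk -/(D y).
have -> : sg (D y) (gs a : gker) = tmap D (sg y (gs a : gker)) by [].
apply: le_trans (sn_le _ (tmap D (map e (u a)))) _.
have -> : sub (tmap D (sg y (gs a : gker))) (tmap D (map e (u a))) =
    tmap D (sub (sg y (gs a : gker)) (map e (u a))).
  by rewrite /tmap /sub /scal map_cat -!map_comp.
rewrite [leRHS]splitr; apply: lerD.
  apply: le_trans (tmap_bdd _ (pos_adj pD) ltr01 D1) _.
  by rewrite mul1r.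
apply: le_trans (sn_sum _) _; rewrite !big_map.
apply: (@le_trans _ _ (\sum_(p <- u a) nr (D (j p.1)) * nr (p.2 : G))).
  apply: ler_sum => p _; exact: (sg_nr (D (j p.1)) (p.2 : G)).
apply: (@le_trans _ _ (\sum_(p <- us) nr (D (j p.1)) * nr (p.2 : G))).
  rewrite /us big_flatten big_map (bigD1_seq a) ?mem_index_enum ?index_enum_uniq //=.
  rewrite lerDl; apply: sumr_ge0 => b _; apply: sumr_ge0 => p _.
  by rewrite mulr_ge0 ?nr_ge0.
rewrite big_tnth.
apply: (@le_trans _ _ (d / 2 / (w + 1) * w)).
  rewrite /w [X in _ <= _ * X]big_tnth mulr_sumr; apply: ler_sum => i _.
  rewrite ler_wpM2r ?nr_ge0 // Dj (j_nr cj); exact: fx.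
rewrite mulrAC ler_pdivrMr // ler_pM2l // lerDl //.
Qed.

End CommonApproximation.

(** * Transfer of density to [H] by normality *)

Section Ultraweak.
Variables (R : realType).
Local Notation C := (complex R).

Lemma sums_toP (f : nat -> C) l : sums_to f l ->
  forall d : R, 0 < d -> exists N, forall n, (N <= n)%N -> cab (\sum_(i < n) f i - l) <= d.
Proof.
move=> fl d d0; move/cvgrPdist_le: fl => /(_ d%:C%C); rewrite ltcR => /(_ d0) [N _ hN].
exists N => n Nn; rewrite cabBC -lecR -[X in X <= _](@nrE _ (complexB R)).
exact: hN.
Qed.

Lemma ultraweak_vector (H : hilbSpace R) (h : H) : ultraweak (fun A : adjOp H => ip h (A h)).
Proof.
pose x (i : nat) := if i is 0 then h else 0; exists x, x; split.
  exists (`|h| * `|h|); case=> [|n]; first by rewrite big_ord0 mulr_ge0.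
  rewrite big_ord_recl /= big1 ?addr0 // => i _; by rewrite normr0 mul0r.
move=> A; apply/cvgrPdist_le => d d0; exists 1%N => // [[//|n]] _ /=.
rewrite big_ord_recl big1 /= => [|i _]; last exact: ip0l.
by rewrite addr0 subrr normr0 ltW.
Qed.

Lemma ultraweak_tail (G : hilbSpace R) (f : adjOp G -> C) (d : R) : ultraweak f -> 0 < d ->
  exists L (xi eta : nat -> G), forall (A : adjOp G) c, 0 <= c -> bdd A c ->
    cab (f A) <= \sum_(l < L) cab (ip (xi l) (A (eta l))) + c * d.
Proof.
move=> [xi [eta [[B hB] hf]]] d0.
pose b n := \sum_(i < n) nr (xi i) * nr (eta i).
have bB n : b n <= complex.Re B.
  have := hB n; rewrite lecE => /andP[_]; apply: le_trans.
  rewrite (big_morph _ (@ReD R) (erefl : complex.Re (0 : C) = 0)) /b.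
  by apply: ler_sum => i _; rewrite !nrE -rmorphM.
have [L hL] := bounded_tail bB d0; exists L, xi, eta => A c c0 Ac.
apply: (@le_small _ _ _ 1) => // s s0; rewrite mulr1.
have [N hN] := sums_toP (hf A) s0.
pose n := maxn N L; have Ln : (L <= n)%N by exact: leq_maxr.
apply: le_trans (cab_le _ (\sum_(i < n) ip (xi i) (A (eta i)))) _.
rewrite cabBC addrC; apply: lerD; last exact: hN (leq_maxl _ _).
have hn : \sum_(L <= i < n) nr (xi i) * nr (eta i) <= d.
  have := hL n; rewrite /b -!(big_mkord xpredT (fun i => nr (xi i) * nr (eta i))).
  by rewrite (big_cat_nat (leq0n L) Ln) /= lerD2l.
rewrite -(big_mkord xpredT (fun i => ip (xi i) (A (eta i)))) (big_cat_nat (leq0n L) Ln) /=.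
apply: le_trans (cabD _ _) (lerD _ _).
  by rewrite big_mkord; exact: cab_sum.
apply: le_trans (cab_sum _ _ _) _; apply: le_trans (ler_wpM2l c0 hn).
rewrite mulr_sumr; apply: ler_sum => i _; apply: le_trans (ip_CS _ _) _.
by rewrite mulrCA ler_wpM2l ?nr_ge0.
Qed.

End Ultraweak.

Section WStarTotal.
Variables (R : realType) (M : cstarAlg R) (v : vonNeumann M).
Variables (H : hilbSpace R) (sigma : M -> adjOp H).
Hypothesis hsigma : star_hom sigma.
Hypothesis normal : weak_continuous (predual v) (@ultraweak R H) sigma.
Local Notation C := (complex R).
Local Notation rho := (vrep v).
Local Notation G := (vspace v).

Lemma normal_small h (d : R) : 0 < d -> exists (m : nat) (f : 'I_m -> M -> C) (s : R),
  [/\ 0 < s, forall i, predual v (f i) &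
    forall a, (forall i, cab (f i a) < s) -> complex.Re (ip h (sigma a h)) <= d].
Proof.
move=> d0; have dC : 0 < d%:C%C :> C by rewrite ltcR.
have [m [f [s [s0 hf hs]]]] := normal 0 (ultraweak_vector h) dC.
have f0 i : f i 0 = 0.
  have [g [xi [eta [_ hg]]] E] := hf i; rewrite E.
  apply: cab_eq0; apply/eqP; rewrite eq_le cab_ge0 andbT.
  apply: (@le_small _ _ _ 1) => // t t0; rewrite add0r mulr1.
  have [N hN] := sums_toP (hg (rho 0)) t0; have := hN N (leqnn N).
  rewrite big1 => [|l _]; first by rewrite sub0r cabN.
  by rewrite (star_hom0 (@vrep_hom R M v)); exact: ip0r.
move: s0; rewrite ltcE /= => /andP[/eqP si sr].
exists m, f, (complex.Re s); split=> // a ha.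
have : `|ip h (sigma a h) - ip h (sigma 0 h)| < d%:C%C.
  apply: hs => i; rewrite f0 subr0 cabE ltcE /= si eqxx /=; exact: ha.
rewrite (star_hom0 hsigma) ip0r subr0 cabE ltcR => h1.
exact: le_trans (Re_cab _) (ltW h1).
Qed.

Variables (F K : corr M) (j : K -> F).
Hypothesis cj : self_dual_completion j.

(** Normality reduces the functional of [h] to finitely many predual functionals, and each of these
    to finitely many vectors of [G] plus a tail; [common_approx] handles all these vectors at once,
    and its norm bound controls the tail. *)
Lemma wstar_single1 y h (d : R) : nr y <= 1 -> 0 < d ->
  exists k, complex.Re (ip h (sigma (hip (y - j k) (y - j k)) h)) <= d.
Proof.
move=> y1 d0; have [m [f [s [s0 hf hs]]]] := normal_small h d0.
(* As [|y - j k| <= 2], a tail costs at most [4 dl = s / 4]; with [t] below, the finite sums cost at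
   most [s / 4] more. *)
pose dl := s / 16; have dl0 : 0 < dl by rewrite divr_gt0.
have tail i : exists L (xi eta : nat -> G), forall a,
    cab (f i a) <= \sum_(l < L) cab (ip (xi l) (rho a (eta l))) + nr a * dl.
  have [g ug gE] := hf i; have [L [xi [eta hg]]] := ultraweak_tail ug dl0.
  exists L, xi, eta => a; rewrite gE; apply: hg; first exact: nr_ge0.
  by move=> x; exact: star_hom_nr (@vrep_hom R M v) _ _.
pose L i := sval (cid (tail i)).
pose xi i := sval (cid (svalP (cid (tail i)))).
pose eta i := sval (cid (svalP (cid (svalP (cid (tail i)))))).
have hL i a : cab (f i a) <= \sum_(l < L i) cab (ip (xi i l) (rho a (eta i l))) + nr a * dl.
  exact: (svalP (cid (svalP (cid (svalP (cid (tail i))))))) a.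
pose N := (\max_(i < m) L i)%N.
pose gs (p : 'I_m * 'I_N * bool) : G := if p.2 then xi p.1.1 p.1.2 else eta p.1.1 p.1.2.
pose t := Num.min 1 (s / (4 * N.+1%:R)).
have t0 : 0 < t by rewrite lt_min ltr01 divr_gt0 // mulr_gt0 // ltr0n.
have [k [k1 hk]] := common_approx cj gs y1 t0.
exists k; apply: hs => i.
apply: le_lt_trans (hL _ _) _.
have na : nr (hip (y - j k) (y - j k)) <= 4.
  rewrite hip_nr; have : nr (y - j k) <= 2.
    by apply: le_trans (nrD _ _) _; rewrite nrN; lra.
  have := nr_ge0 (y - j k); rewrite expr2; nra.
have term l : (l < N)%N -> cab (ip (xi i l) (rho (hip (y - j k) (y - j k)) (eta i l))) <= t.
  move=> lN; pose g1 : hker (@vrep_hom R M v) (id_form rho) := xi i l.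
  pose g2 : hker (@vrep_hom R M v) (id_form rho) := eta i l.
  have E : ip (xi i l) (rho (hip (y - j k) (y - j k)) (eta i l)) =
      bf (sg (y - j k) g1) (sg (y - j k) g2) by rewrite bf_sgl big_seq1.
  rewrite E; apply: le_trans (bf_CS _ _) _.
  have := hk (i, Ordinal lN, true); have := hk (i, Ordinal lN, false); rewrite /gs /= => h2 h1.
  apply: (@le_trans _ _ (t * t)); first by rewrite ler_pM ?sn_ge0.
  by rewrite ler_piMl ?(ltW t0) // ge_min lexx.
have LN : (L i <= N)%N by exact: leq_bigmax.
have sum : \sum_(l < L i) cab (ip (xi i l) (rho (hip (y - j k) (y - j k)) (eta i l))) <= N%:R * t.
  apply: (@le_trans _ _ (\sum_(l < L i) t)).
    by apply: ler_sum => l _; apply: term; exact: leq_trans LN.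
  by rewrite sumr_const card_ord -[X in X <= _]mulr_natl; apply: ler_wpM2r; [exact: ltW|rewrite ler_nat].
have Nt : N%:R * t <= s / 4.
  apply: (@le_trans _ _ (N.+1%:R * t)); first by rewrite ler_wpM2r ?(ltW t0) // ler_nat.
  have : t <= s / (4 * N.+1%:R) by rewrite ge_min lexx orbT.
  by rewrite ler_pdivlMr ?mulr_gt0 ?ltr0n // => h1; rewrite ler_pdivlMr // (_ : _ * 4 = t * (4 * N.+1%:R)) //; ring.
have h4 : nr (hip (y - j k) (y - j k)) * dl <= 4 * dl by rewrite ler_pM2r.
apply: le_lt_trans (lerD (le_trans sum Nt) h4) _; rewrite /dl; lra.
Qed.

Lemma wstar_single y h (d : R) : 0 < d ->
  exists k, complex.Re (ip h (sigma (hip (y - j k) (y - j k)) h)) <= d.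
Proof.
move=> d0; pose l := nr y + 1; have lp : 0 < l by rewrite ltr_wpDl ?nr_ge0.
have ll : l%:C%C * l^-1%:C%C = 1 :> C by rewrite -rmorphM mulfV ?rmorph1 // gt_eqF.
have y1 : nr (l^-1%:C%C *: y) <= 1.
  by rewrite nrZr gtr0_norm ?invr_gt0 // mulrC ler_pdivrMr // mul1r lerDl.
have [k hk] := wstar_single1 h y1 (divr_gt0 d0 (exprn_gt0 2 lp)).
exists (l%:C%C *: k).
have -> : y - j (l%:C%C *: k) = l%:C%C *: (l^-1%:C%C *: y - j k).
  by rewrite (jZ cj) scalerBr scalerA ll scale1r.
rewrite hipZl hipZ conjc_real; case: (hsigma) => _ sZ _ _; rewrite !sZ !ipZr !ReZ.
by move: hk; rewrite ler_pdivlMr ?exprn_gt0 // expr2 mulrC mulrA.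
Qed.

Lemma wstar_total (A : Type) (t0 : A -> K) : dense_span t0 ->
  total sigma (fun a => j (t0 a)).
Proof.
move=> dt y h d d0.
pose K' := hker hsigma (id_form sigma).
have s0 : 0 < Num.sqrt d by rewrite sqrtr_gt0.
have s2 : 0 < Num.sqrt d / 2 by rewrite divr_gt0.
have [k hk] := wstar_single y h (exprn_gt0 2 s2).
have hp : 0 < nr h + 1 by rewrite ltr_wpDl ?nr_ge0.
have [s hs] := dense_span_nr dt k (divr_gt0 s2 hp); exists s.
pose z := y - \sum_(a <- s) j (t0 a); have h1 : sn (sg (y - j k) (h : K')) <= Num.sqrt d / 2.
  rewrite -(@ler_pXn2r _ 2) ?nnegrE ?sn_ge0 ?(ltW s2) // sn_sg_sqr; exact: hk.
pose z' := j k - \sum_(a <- s) j (t0 a).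
have h2 : sn (sg z' (h : K')) <= Num.sqrt d / 2.
  rewrite -(@ler_pXn2r _ 2) ?nnegrE ?sn_ge0 ?(ltW s2) // sn_sg_sqr.
  apply: le_trans (sigma_hip_le hsigma _ _) _.
  rewrite ler_pXn2r ?nnegrE ?(ltW s2) ?mulr_ge0 ?nr_ge0 //.
  have -> : nr z' = nr (k - \sum_(a <- s) t0 a).
    by rewrite /z' -(j_sum cj) -(jN cj) -(jD cj) (j_nr cj).
  move: hs; rewrite ler_pdivlMr // => hs; apply: le_trans hs.
  by rewrite ler_wpM2l ?nr_ge0 // lerDl.
apply: (@le_trans _ _ (sn (sg z (h : K')) ^+ 2)); first by rewrite sn_sg_sqr; exact: lexx.
rewrite -[d]sqr_sqrtr ?(ltW d0) // ler_pXn2r ?nnegrE ?sn_ge0 ?(ltW s0) //.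
have -> : sn (sg z (h : K')) = sn (sg (y - j k) (h : K') ++ sg z' (h : K')).
  apply: sn_ext => w; rewrite bf_catl !bf_sgl -big_split; apply: eq_bigr => q _.
  have -> : z = y - j k + z' by rewrite addrA subrK.
  by rewrite hipDl mactD.
by apply: le_trans (sn_cat _ _) _; rewrite [leRHS]splitr lerD.
Qed.

End WStarTotal.

(** * Representations of subproduct systems *)

Section HilbertMaps.
Variables (R : realType) (M : cstarAlg R) (H : hilbSpace R) (sigma : M -> adjOp H).
Hypothesis hsigma : star_hom sigma.
Local Notation C := (complex R).
Variable F : corr M.
Local Notation VF := (tens F (hker hsigma (id_form sigma))).

Definition hmap (B : H -> H) (u : seq VF) : seq VF := [seq ((p.1, B p.2) : VF) | p <- u].

Lemma sigma_ip a x y : ip (sigma a x) y = ip x (sigma (cstar a) y).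
Proof. exact: (star_hom_adj hsigma). Qed.

Variable B : H -> H.
Hypotheses (B_adj : adj B B) (B_comm : forall a h, B (sigma a h) = sigma a (B h)).
Hypothesis B1 : bdd B 1.

Lemma hmap_sn u : sn (hmap B u) <= sn u.
Proof.
have B_ip x y : ip (B x) y = ip x (B y) by exact: B_adj.
pose D x := x - B (B x).
have D_adj : adj D D by apply: adj_sub => //; exact: adj_comp.
have D_ge0 x : 0 <= complex.Re (ip x (D x)).
  rewrite ipBr -B_ip ReD ReN !Re_ipxx subr_ge0 ler_pXn2r ?nnegrE ?nr_ge0 //.
  by have := B1 x; rewrite mul1r.
have D_comm a x : D (sigma a x) = sigma a (D x).
  by rewrite /D (adjB (adjOp_adj _)) !B_comm.
have := @kf_ge0 _ (tens F (hker hsigma (InvariantForm D_adj D_ge0 D_comm))) u.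
have -> : \sum_(p <- u) \sum_(q <- u) @kf _ (tens F (hker hsigma (InvariantForm D_adj D_ge0 D_comm))) p q =
    bf u u - bf (hmap B u) (hmap B u).
  rewrite /bf big_map -sumrB; apply: eq_bigr => p _.
  rewrite big_map -sumrB; apply: eq_bigr => q _.
  by rewrite !tens_kfE /= ipBr B_ip !B_comm.
rewrite ReD ReN -!sn_sqr subr_ge0 => h.
by rewrite -(@ler_pXn2r _ 2) ?nnegrE ?sn_ge0.
Qed.

End HilbertMaps.

Section Representation.
Variables (R : realType) (M : cstarAlg R) (s : setting M) (X : standard_subproduct s).
Variables (H : hilbSpace R) (T : forall n, spX X n -> adjOp H) (hT : covariant_rep T).
Local Notation C := (complex R).
Local Notation sigma := (@T 0 : M -> adjOp H).
Let hsigma : star_hom sigma := rep_hom hT.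
Local Notation idH := (hker hsigma (id_form sigma)).
Local Notation V n := (tens (spX X n) idH).

Lemma T_le n (u : seq (V n)) : nr (Ps (fun p : V n => T p.1 p.2) u) <= sn u.
Proof.
exact: (@tau_contraction _ _ _ _ hsigma _ (@T n) (rep_linear hT (n := n)) (@rep_cc _ _ _ _ _ _ hT n)
  (rep_right hT (n := n)) u).
Qed.

Lemma T_scal n c (p : V n) : T (kscal c p).1 (kscal c p).2 = c *: T p.1 (p.2 : H).
Proof. exact: adjZ (adjOp_adj _) _ _. Qed.

Definition Tc n : contr H (V n) := Contr (@T_scal n) (@T_le n).

Lemma T_nr n (x : spX X n) h : nr (T x h) <= nr x * nr h.
Proof.
exact: (@tau_nr _ _ _ _ (@T n) (rep_linear hT (n := n)) (@rep_cc _ _ _ _ _ _ hT n)).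
Qed.

(* [Q n = T~_n T~_n ^*] for the contraction [T~_n (x (x) h) = T_n(x) h]. *)
Definition Q n : H -> H := Qfun (Tc n) (Tc n).

Lemma Q_adj n : adj (Q n) (Q n).
Proof. exact: (Qfun_adj (Tc n) (Tc n)). Qed.

Lemma Q_nr n h : nr (Q n h) <= nr h. Proof. exact: Qfun_nr. Qed.

Lemma Q_ge0 n h : 0 <= complex.Re (ip h (Q n h)). Proof. exact: Qfun_ge0. Qed.

Lemma Q_comm n a h : Q n (sigma a h) = sigma a (Q n h).
Proof.
have [c [c0 hc]] := adjOp_bdd (lact (cstar a) : adjOp (spX X n)).
have aa : adj (@lact R M (spX X n) a) (lact (cstar a)).
  by move=> x y; exact: star_hom_adj (@lact_hom _ _ _) _ _ _.
apply: (@Qfun_comm _ _ _ (Tc n) (Tc n) (tmap (lact a)) (tmap (lact (cstar a))) (sigma a) (c + 1)).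
- by move=> u w; exact: tmap_adj.
- by rewrite ltr_wpDl.
- move=> w; apply: tmap_bdd (adjC aa) _ _; first by rewrite ltr_wpDl.
  by move=> x; apply: le_trans (hc x) _; rewrite ler_wpM2r ?nr_ge0 // lerDl.
- move=> w; rewrite (adj_sum (adjC (adjOp_adj _))) /Ps big_map; apply: eq_bigr => p _ /=.
  by rewrite (rep_left hT); case: hsigma => _ _ _ ->.
- move=> w; rewrite (adj_sum (adjOp_adj _)) /Ps big_map; apply: eq_bigr => p _ /=.
  by rewrite (rep_left hT).
Qed.

(** [T~_0] preserves inner products and has dense range by nondegeneracy, so it is unitary after
    completion. *)
Lemma Q0 h : Q 0 h = h.
Proof.
apply/eqP; rewrite -subr_eq0; apply/eqP.
apply: (@nr_eq0_small _ _ _ 4) => // d d0.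
have [u hu] := apx_ex (Tc 0) h d0.
have iso (v w : seq (V 0)) : bf v w = ip (Ps (Tc 0) v) (Ps (Tc 0) w).
  rewrite /bf /Ps ip_suml; apply: eq_bigr => p _; rewrite ip_sumr; apply: eq_bigr => q _.
  rewrite [RHS](sigma_ip hsigma); have [_ _ hM _] := hsigma.
  exact: (congr1 (ip _) (hM (cstar p.1) q.1 q.2)).
set g := Ps (Tc 0) u; have h1 : nr (g - Q 0 h) <= d by exact: QfunP hu.
have h2 w : cab (ip (g - h) (Ps (Tc 0) w)) <= d * nr (Ps (Tc 0) w).
  rewrite ipBl -iso; apply: le_trans (hu w) _; rewrite ler_wpM2l ?(ltW d0) //.
  have : sn w ^+ 2 = nr (Ps (Tc 0) w) ^+ 2.
    by rewrite sn_sqr -Re_ipxx iso.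
  by move/eqP; rewrite eqrXn2 ?sn_ge0 ?nr_ge0 // => /eqP ->.
have h3 : nr (g - h) <= d * 2.
  have [->|g0] := eqVneq (nr (g - h)) 0; first by rewrite mulr_ge0 // ltW.
  have gp : 0 < nr (g - h) by rewrite lt_def g0 nr_ge0.
  suff : nr (g - h) * nr (g - h) <= d * nr (g - h).
    by rewrite ler_pM2r // => h4; apply: le_trans h4 _; rewrite ler_peMr ?ler1n // ltW.
  apply: (@le_small _ _ _ (d + nr (g - h))); first by rewrite addr_ge0 ?nr_ge0 // ltW.
  move=> t t0; have [w hw] := dense_span_nr (rep_nondegenerate hT) (g - h) t0.
  pose y := Ps (Tc 0) (w : seq (V 0)).
  have {}hw : nr (g - h - y) <= t by exact: hw.
  have e1 : nr (g - h) * nr (g - h) <= cab (ip (g - h) y) + nr (g - h) * t.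
    rewrite -expr2 -Re_ipxx -[X in ip _ X](subrK y) ipDr addrC ReD.
    apply: lerD; first exact: Re_cab.
    apply: le_trans (Re_cab _) (le_trans (ip_CS _ _) _).
    by rewrite ler_wpM2l ?nr_ge0.
  have e2 := h2 w; have e3 : nr y <= nr (g - h) + t.
    by have := nr_le y (g - h); rewrite nrBC; lra.
  have e4 : d * nr y <= d * (nr (g - h) + t) by rewrite ler_wpM2l // ltW.
  move: e1 (le_trans e2 e4); rewrite -/y; lra.
have := nrB_le (Q 0 h) g h; rewrite (nrBC (Q 0 h) g); lra.
Qed.

End Representation.

Section Setting.
Variables (R : realType) (M : cstarAlg R).
Local Notation C := (complex R).

Lemma rep_normal0 (s : setting M) (X : standard_subproduct s) (H : hilbSpace R)
    (T : forall n, spX X n -> adjOp H) (hT : covariant_rep T) :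
  if s is WStarSetting v then weak_continuous (predual v) (@ultraweak R H) (@T 0 : M -> adjOp H)
  else True.
Proof. by destruct s as [|v] => //; case: (rep_normal hT). Qed.

Variables (s : setting M) (H : hilbSpace R) (sigma : M -> adjOp H).
Hypothesis hsigma : star_hom sigma.
Hypothesis normal :
  if s is WStarSetting v then weak_continuous (predual v) (@ultraweak R H) sigma else True.

Lemma tensor_total (F G FG : corr M) (t : F -> G -> FG) : tensor_product s t ->
  total sigma (fun u : F * G => t u.1 u.2).
Proof.
case: s normal => [_|v nv] /=.
  by case=> _ _ _ _ dt; exact: dense_total.
move=> [K [t0 [j [[_ _ _ _ dt] cj tE]]]] y h d d0.
have [w hw] := wstar_total hsigma nv cj dt y h d0.
by exists w; under eq_bigr => u _ do rewrite tE.
Qed.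

Lemma tensor_hip (F G FG : corr M) (t : F -> G -> FG) : tensor_product s t ->
  forall x y x' y', hip (t x y) (t x' y') = hip y (lact (hip x x') y').
Proof.
case: s => [|v] /=; first by case.
move=> [K [t0 [j [[_ _ _ th _] cj tE]]]] x y x' y'.
by rewrite !tE (j_hip cj) th.
Qed.

Lemma direct_sum_total (X : nat -> corr M) (F : corr M) (iota : forall n, X n -> F) :
  direct_sum s iota -> total sigma (fun u : {n : nat & X n} => iota (projT1 u) (projT2 u)).
Proof.
case: s normal => [_|v nv] /=.
  by case=> _ _ dt; exact: dense_total.
move=> [K [i0 [j [[_ _ dt] cj iE]]]] y h d d0.
have [w hw] := wstar_total hsigma nv cj dt y h d0.
by exists w; under eq_bigr => u _ do rewrite iE.
Qed.

Lemma direct_sum_hip (X : nat -> corr M) (F : corr M) (iota : forall n, X n -> F) :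
  direct_sum s iota -> (forall n (x y : X n), hip (iota n x) (iota n y) = hip x y) /\
  (forall n m (x : X n) (y : X m), n <> m -> hip (iota n x) (iota m y) = 0).
Proof.
case: s => [|v] /=.
  by case=> isom orth _; split=> // n x y; case: (isom n).
move=> [K [i0 [j [[isom orth _] cj iE]]]]; split=> [n x y|n m x y nm].
  by rewrite !iE (j_hip cj); case: (isom n).
by rewrite !iE (j_hip cj) orth.
Qed.

Variable X : standard_subproduct s.

(** [sp_proj] is a choice with default value 0; the isometry [inc] leaves at most one candidate. *)
Lemma sp_projE n (z : spE X n) (x : spX X n) :
  (forall y, hip (inc y) (z - inc x) = 0) -> sp_proj z = x.
Proof.
move=> hx; rewrite /sp_proj.
set P := [set x | _]; have Px : P x by [].
have /= hz := xgetPex 0 (ex_intro P x Px); set x' := xget 0 P in hz *.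
have [[li _] _ ii] : bimodule_isometry (@inc R M X n) by exact: sp_inc_isom.
have id y : hip y (x' - x) = 0.
  rewrite -ii; have -> : inc (x' - x) = inc x' - inc x.
    by have := li (-1) x x'; rewrite !scaleN1r !(addrC (- _)).
  have -> : inc x' - inc x = (z - inc x) - (z - inc x') by rewrite opprB [RHS]addrC addrA subrK.
  by rewrite hipBr hx hz subrr.
by apply/eqP; rewrite -subr_eq0; apply/eqP/hip_eq0.
Qed.

(* [Y] is the tensor product of [X(n)] and [X(m)], [i] the inclusion of [X(n+m)] and [P] its adjoint. *)
Lemma complement n m : exists (Y : corr M) (tY : spX X n -> spX X m -> Y)
    (i : spX X (n + m) -> Y) (P : Y -> spX X (n + m)),
  [/\ total sigma (fun u : spX X n * spX X m => tY u.1 u.2),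
      forall x y x' y', hip (tY x y) (tY x' y') = hip y (lact (hip x x') y'),
      forall x y, hip (i x) (i y) = hip x y,
      forall x y, hip (i x) y = hip x (P y) &
      forall x y, P (tY x y) = sp_prod x y].
Proof.
have [Y [tY [kappa [i [[_ ht] [[lk _] _ kk] kt [[_ _ ii] ki] hc]]]]] :=
  sp_standard X (erefl (n + m)%N).
pose P y := sval (cid (hc y)).
have hP y x : hip (i x) (y - i (P y)) = 0 by rewrite /P; case: cid => z hz /=; exact: hz.
have iP x y : hip (i x) y = hip x (P y).
  by have := hP y x; rewrite hipBr ii => /eqP; rewrite subr_eq0 => /eqP.
exists Y, tY, i, P; split=> //; first exact: tensor_total.
  exact: tensor_hip.
move=> x y; apply/esym/sp_projE => z.
have kB u w : kappa (u - w) = kappa u - kappa w.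
  by have := lk (-1) w u; rewrite !scaleN1r !(addrC (- _)).
by rewrite -kt -!ki -kB kk hP.
Qed.

End Setting.

(** * The recursion from [Q n] to [Q n.+1] *)

Section Step.
Variables (R : realType) (M : cstarAlg R) (s : setting M) (X : standard_subproduct s).
Variables (H : hilbSpace R) (T : forall n, spX X n -> adjOp H) (hT : covariant_rep T).
Local Notation C := (complex R).
Local Notation sigma := (@T 0 : M -> adjOp H).
Let hsigma : star_hom sigma := rep_hom hT.
Local Notation idH := (hker hsigma (id_form sigma)).
Local Notation V n := (tens (spX X n) idH).
Local Notation W n := (tens (spX X n) (V 1)).
Local Notation Tc n := (Tc hT n).
Local Notation Q n := (Q hT n).

Lemma T_left n (a : M) (x : spX X n) h : T (lact a x) h = sigma a (T x h).
Proof. exact: rep_left. Qed.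

Lemma sigmaM a b x : sigma (cmul a b) x = sigma a (sigma b x).
Proof. by have [_ _ hM _] := hsigma; exact: hM. Qed.

Lemma sigmaD a b x : sigma (a + b) x = sigma a x + sigma b x.
Proof. by have [hD _ _ _] := hsigma; exact: hD. Qed.

Lemma sigmaZ (c : C) a x : sigma (c *: a) x = c *: sigma a x.
Proof. by have [_ hZ _ _] := hsigma; exact: hZ. Qed.

Section Fixed.
Variable n : nat.

(* [1 (x) T_1] as a map of lists. *)
Definition flat (w : seq (W n)) : seq (V n) := [seq ((p.1, T p.2.1 (p.2.2 : H)) : V n) | p <- w].

Let K1 : mkernel M := V 1.
(** The form of [1 - T~_1^* T~_1], which is positive as [T~_1] is a contraction. Its tensor product
    with [X(n)] is positive too, which makes [1 (x) T~_1] a contraction. *)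
Let dkf (p q : K1) : C := kf p q - ip (Tc 1 p) (Tc 1 q).

Lemma Tc_mact a (p : K1) : Tc 1 (mact a p) = sigma a (Tc 1 p).
Proof. exact: T_left. Qed.

Lemma dkf_ge0 (u : seq K1) : 0 <= complex.Re (\sum_(p <- u) \sum_(q <- u) dkf p q).
Proof.
have := cfun_le (Tc 1) u.
rewrite -(@ler_pXn2r _ 2) ?nnegrE ?nr_ge0 ?sn_ge0 // -Re_ipxx sn_sqr -subr_ge0 -ReN -ReD.
rewrite /bf /Ps ip_suml -sumrB.
by under eq_bigr => p _ do rewrite ip_sumr -sumrB.
Qed.

Lemma dkf_bd (p q : K1) : exists c : R, 0 <= c /\ forall a, cab (dkf p (mact a q)) <= c * nr a.
Proof.
have [c [c0 hc]] := mact_bd p q.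
exists (c + nr (Tc 1 p) * nr (Tc 1 q)); split; first by rewrite addr_ge0 ?mulr_ge0 ?nr_ge0.
move=> a; apply: le_trans (cabD _ _) _; rewrite cabN mulrDl; apply: lerD; first exact: hc.
apply: le_trans (ip_CS _ _) _; rewrite -mulrA ler_wpM2l ?nr_ge0 // Tc_mact mulrC.
exact: star_hom_nr hsigma _ _.
Qed.

Definition dker : mkernel M.
Proof.
unshelve refine (@MKernel R M (@Kernel R K1 dkf (fun c p => kscal c p) _ _ dkf_ge0)
  (fun a p => mact a p) _ _ _ _ dkf_bd).
- by move=> p q; rewrite /dkf conjD conjN kfC ipC.
- by move=> c p q; rewrite /dkf kfZ cfunZ ipZr mulrBr.
- move=> a p q; change (dkf (mact a p) q = dkf p (mact (cstar a) q)).
  by rewrite /dkf mact_adj !Tc_mact (sigma_ip hsigma).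
- move=> a b p q; change (dkf p (mact (a + b) q) = dkf p (mact a q) + dkf p (mact b q)).
  by rewrite /dkf mactD !Tc_mact sigmaD ipDr opprD addrACA.
- move=> c a p q; change (dkf p (mact (c *: a) q) = c * dkf p (mact a q)).
  by rewrite /dkf mactZ !Tc_mact sigmaZ ipZr mulrBr.
- move=> a b p q; change (dkf p (mact (cmul a b) q) = dkf p (mact a (mact b q))).
  by rewrite /dkf mactM !Tc_mact sigmaM.
Defined.

Lemma flat_sn w : sn (flat w) <= sn w.
Proof.
have := @kf_ge0 _ (tens (spX X n) dker) w.
have -> : \sum_(p <- w) \sum_(q <- w) @kf _ (tens (spX X n) dker) p q = bf w w - bf (flat w) (flat w).
  rewrite /bf big_map -sumrB; apply: eq_bigr => p _.
  rewrite big_map -sumrB; apply: eq_bigr => q _.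
  change (dkf p.2 (mact (hip p.1 q.1) q.2) = kf p.2 (mact (hip p.1 q.1) q.2) -
    ip (Tc 1 p.2) (sigma (hip p.1 q.1) (Tc 1 q.2))).
  by rewrite /dkf Tc_mact.
rewrite ReD ReN -!sn_sqr subr_ge0 => h.
by rewrite -(@ler_pXn2r _ 2) ?nnegrE ?sn_ge0.
Qed.

Lemma Psi_scal c (p : W n) : T (kscal c p).1 (T (kscal c p).2.1 (kscal c p).2.2) =
  c *: T p.1 (T p.2.1 (p.2.2 : H)).
Proof. by rewrite /= !(adjZ (adjOp_adj _)). Qed.

Lemma Ps_flat w : Ps (Tc n) (flat w) = Ps (fun p : W n => T p.1 (T p.2.1 (p.2.2 : H))) w.
Proof. by rewrite /Ps big_map. Qed.

Lemma Psi_le (w : seq (W n)) : nr (Ps (fun p : W n => T p.1 (T p.2.1 (p.2.2 : H))) w) <= sn w.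
Proof. by rewrite -Ps_flat; apply: le_trans (cfun_le _ _) (flat_sn w). Qed.

(** [T~_n (1 (x) T~_1)], from the algebraic [X(n) (x) X(1) (x) H] to [H]. *)
Definition Psi : contr H (W n) := Contr Psi_scal Psi_le.

Definition left (x : spX X n) (v : seq (V 1)) : seq (W n) := [seq ((x, p) : W n) | p <- v].
Definition left_adj (x : spX X n) (w : seq (W n)) : seq (V 1) :=
  [seq (mact (hip x q.1) q.2 : V 1) | q <- w].

Lemma left_bf x v w : bf (left x v) w = bf v (left_adj x w).
Proof.
rewrite /bf big_map; apply: eq_bigr => p _; rewrite big_map; apply: eq_bigr => q _.
by [].
Qed.

Lemma left_sn x v : sn (left x v) <= (nr x ^+ 2 + 1) * sn v.
Proof.
set c := nr x ^+ 2 + 1; have c1 : 1 <= c by rewrite lerDr sqr_ge0.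
have cp : 0 < c by exact: lt_le_trans ltr01 c1.
rewrite -(@ler_pXn2r _ 2) ?nnegrE ?sn_ge0 ?mulr_ge0 ?sn_ge0 ?(ltW cp) // sn_sqr left_bf.
have -> : left_adj x (left x v) = tmap (lact (hip x x)) v.
  by rewrite /left_adj /left -map_comp.
apply: le_trans (Re_cab _) (le_trans (bf_CS _ _) _).
have aa : adj (@lact R M (spX X 1) (hip x x)) (lact (cstar (hip x x))).
  by move=> y z; exact: star_hom_adj (@lact_hom _ _ _) _ _ _.
have bc : bdd (@lact R M (spX X 1) (hip x x)) c.
  move=> y; apply: le_trans (star_hom_nr (@lact_hom _ _ _) _ _) _.
  by rewrite ler_wpM2r ?nr_ge0 // hip_nr lerDl.
apply: le_trans (ler_wpM2l (sn_ge0 v) (tmap_bdd v aa cp bc)) _.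
rewrite exprMn mulrCA -expr2 ler_wpM2r ?sqr_ge0 //.
by rewrite expr2 ler_peMl // ltW.
Qed.

Lemma left_adj_sn x w : sn (left_adj x w) <= (nr x ^+ 2 + 1) * sn w.
Proof.
apply: sn_bf_le; first by rewrite mulr_ge0 ?sn_ge0 // addr_ge0 ?sqr_ge0.
rewrite -left_bf; apply: le_trans (bf_CS _ _) _.
by rewrite mulrAC ler_wpM2r ?sn_ge0 // left_sn.
Qed.

Lemma flat_bf (u : seq (V n)) w :
  \sum_(p <- u) ip (p.2 : H) (Ps (Tc 1) (left_adj p.1 w)) = bf u (flat w).
Proof.
rewrite /bf; apply: eq_bigr => p _; rewrite /Ps ip_sumr !big_map; apply: eq_bigr => q _.
by rewrite tens_kfE /= T_left.
Qed.

(** [Psi^* h] is [1 (x) T~_1^*] applied to [T~_n^* h]: replacing each [h_p] in [u] by an approximant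
    of [T~_1^* h_p] gives an approximant [z], and [Psi z] is close to [sum_p T_n(x_p) Q_1 h_p]. *)
Lemma Psi_apx h u e : 0 < e -> apx (Tc n) h u e ->
  nr (Ps (Tc n) (hmap (Q 1) u) - Qfun Psi Psi h) <= e.
Proof.
move=> e0 hu.
pose c1 := \sum_(p <- u) (nr p.1 ^+ 2 + 1); pose c2 := \sum_(p <- u) nr p.1.
have c10 : 0 <= c1 by apply: sumr_ge0 => p _; rewrite addr_ge0 ?sqr_ge0.
have c20 : 0 <= c2 by apply: sumr_ge0 => p _; exact: nr_ge0.
apply: (@le_small _ _ _ (c1 + c2)); first exact: addr_ge0.
move=> d d0; pose w k := sval (cid (apx_ex (Tc 1) k d0)).
have hw k : apx (Tc 1) k (w k) d by rewrite /w; case: cid.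
pose z : seq (W n) := flatten [seq left p.1 (w (p.2 : H)) | p <- (u : seq (spX X n * H))].
have zE f : bf z f = \sum_(p <- u) bf (w (p.2 : H)) (left_adj p.1 f).
  rewrite [LHS]big_flatten big_map; apply: eq_bigr => p _; exact: left_bf.
have hz : apx Psi h z (e + d * c1).
  move=> f; rewrite zE mulrDl; apply: le_trans (cabB_le _ (bf u (flat f)) _) _.
  rewrite addrC; apply: lerD.
    rewrite -Ps_flat; apply: le_trans (hu _) _.
    by rewrite ler_wpM2l ?(ltW e0) // flat_sn.
  rewrite -flat_bf -sumrB; apply: le_trans (cab_sum _ _ _) _.
  rewrite -mulrA [c1 * _]mulr_suml mulr_sumr; apply: ler_sum => p _.
  apply: le_trans (hw _ _) _; rewrite ler_wpM2l ?(ltW d0) //; exact: left_adj_sn.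
have h1 := QfunP Psi (ltr_wpDr (mulr_ge0 (ltW d0) c10) e0) hz.
apply: le_trans (nrB_le _ (Ps Psi z) _) _.
rewrite mulrDr addrA [X in X <= _]addrC; apply: lerD; first exact: h1.
have -> : Ps Psi z = \sum_(p <- u) T p.1 (Ps (Tc 1) (w (p.2 : H))).
  rewrite [LHS]big_flatten big_map; apply: eq_bigr => p _.
  by rewrite big_map (adj_sum (adjOp_adj _)).
rewrite [Ps (Tc n) _]big_map -sumrB; apply: le_trans (nr_sum _ _ _) _.
rewrite mulr_sumr; apply: ler_sum => p _ /=.
rewrite -(adjB (adjOp_adj _)); apply: le_trans (T_nr hT _ _) _.
rewrite mulrC ler_wpM2r ?nr_ge0 // nrBC; exact: (QfunP (Tc 1) d0 (hw _)).
Qed.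

(** [rep_mul] says that [Psi = T~_(n+1) (P (x) 1)], where [P] is a coisometry with adjoint [i]. Thus
    [iV] carries approximants of [T~_(n+1)^* g] to approximants of [Psi^* g] and preserves the
    form. *)
Lemma Psi_Q h : Qfun Psi Psi h = Q (n + 1)%N h.
Proof.
have [Y [tY [i [P [tot tYh ii iP Pt]]]]] := complement hsigma (rep_normal0 hT) X n 1.
pose VY := tens Y idH.
pose e (p : W n) : VY := (tY p.1 p.2.1, (p.2.2 : idH)).
have eE p q : kf (e p) (e q) = kf p q.
  by rewrite /e !tens_kfE /= tYh.
have de : dense_in e.
  apply: (@total_dense _ _ _ _ hsigma (id_form sigma) _ Y _ _ _ e
    (fun u h => (u.1, (u.2, h)) : W n) tot) => //.
  by move=> k; rewrite Re_ipxx.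
pose iV (u : seq (V (n + 1)%N)) : seq VY := [seq ((i p.1, p.2) : VY) | p <- u].
pose pi (w : seq (W n)) : seq (V (n + 1)%N) :=
  [seq ((sp_prod p.1 p.2.1, p.2.2) : V (n + 1)%N) | p <- w].
have iV_bf u w : bf (iV u) (map e w) = bf u (pi w).
  rewrite /bf big_map; apply: eq_bigr => p _; rewrite !big_map; apply: eq_bigr => q _.
  by rewrite /e !tens_kfE /= iP Pt.
have iV_iso u w : bf (iV u) (iV w) = bf u w.
  rewrite /bf big_map; apply: eq_bigr => p _; rewrite big_map; apply: eq_bigr => q _.
  by rewrite !tens_kfE /= ii.
have iPs : adj (fun y => i (P y)) (fun y => i (P y)).
  by move=> y z; rewrite iP -[RHS]hipC iP hipC.
have iP1 : bdd (fun y => i (P y)) 1.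
  move=> y; rewrite mul1r; have [->|y0] := eqVneq (nr (i (P y))) 0; first exact: nr_ge0.
  have yp : 0 < nr (i (P y)) by rewrite lt_def y0 nr_ge0.
  rewrite -(ler_pM2l yp) -expr2 -hip_nr ii -iP; exact: CS_hip.
have pi_sn w : sn (pi w) <= sn w.
  have <- : sn (iV (pi w)) = sn (pi w) by rewrite /sn iV_iso.
  have -> : iV (pi w) = tmap (fun y => i (P y)) (map e w).
    by rewrite /iV /pi /tmap -!map_comp; apply: eq_map => p /=; rewrite Pt.
  apply: le_trans (tmap_bdd _ iPs ltr01 iP1) _.
  by rewrite mul1r (sn_map eE).
have Ps_pi w : Ps (Tc (n + 1)%N) (pi w) = Ps Psi w.
  rewrite /Ps big_map; apply: eq_bigr => p _ /=; exact: rep_mul.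
have fap g u d : 0 < d -> apx (Tc (n + 1)%N) g u d -> fapx e Psi g (iV u) d.
  move=> d0 hu w; rewrite iV_bf -Ps_pi; apply: le_trans (hu _) _.
  by rewrite ler_wpM2l ?(ltW d0).
apply: ip_inj => g; apply/eqP; rewrite -subr_eq0; apply/eqP/cab_eq0/eqP.
rewrite eq_le cab_ge0 andbT; apply: (@le_small1 _ _ _ (2 * (nr g + nr h + 1))).
  by rewrite mulr_ge0 ?addr_ge0 ?nr_ge0.
move=> d d0 d1; rewrite add0r.
have [u hu] := apx_ex (Tc (n + 1)%N) g d0; have [w hw] := apx_ex (Tc (n + 1)%N) h d0.
have h1 := fapx_bf eE de (ltW d0) (ltW d0) (fap _ _ _ d0 hu) (fap _ _ _ d0 hw).
have h2 := apx_bf (ltW d0) d0 hu hw.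
rewrite iV_iso in h1.
apply: le_trans (cabB_le _ (bf u w) _) _; rewrite cabBC.
apply: le_trans (lerD h1 h2) _; rewrite !mulrDr.
have : d * d <= d * 1 by rewrite ler_pM2l.
rewrite !mulr1 (mulrC (nr g)); lra.
Qed.

(* [Q_{n+1} = T~_n (1 (x) Q_1) T~_n ^*] *)
Lemma T_step h u e : 0 < e -> apx (Tc n) h u e ->
  nr (Ps (Tc n) (hmap (Q 1) u) - Q n.+1 h) <= e.
Proof. by move=> e0 hu; rewrite -[n.+1]addn1 -Psi_Q; exact: Psi_apx. Qed.

End Fixed.
End Step.

(** * The Poisson kernel *)

Section Poisson.
Variables (R : realType) (M : cstarAlg R) (s : setting M) (X : standard_subproduct s).
Variables (H : hilbSpace R) (T : forall n, spX X n -> adjOp H) (hT : covariant_rep T).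
Variables (FX : fock X) (r : R).
Hypotheses (r0 : 0 < r) (r1 : r < 1).
Local Notation C := (complex R).
Local Notation sigma := (@T 0 : M -> adjOp H).
Let hsigma : star_hom sigma := rep_hom hT.
Local Notation idH := (hker hsigma (id_form sigma)).
Local Notation V n := (tens (spX X n) idH).
Local Notation Tc n := (Tc hT n).
Local Notation Q n := (Q hT n).

Let rr : 0 <= r ^+ 2 <= 1.
Proof. by rewrite sqr_ge0 expr_le1 ?ltW. Qed.

(* The square of the defect operator of [r T~_1]. *)
Definition defect h := h - (r ^+ 2)%:C%C *: Q 1 h.

Lemma defect_adj : adj defect defect.
Proof. by apply: adj_sub => //; apply: adj_scaleR; exact: Q_adj. Qed.

Lemma defect_Re h : complex.Re (ip h (defect h)) = nr h ^+ 2 - r ^+ 2 * complex.Re (ip h (Q 1 h)).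
Proof. by rewrite ipBr ipZr ReD ReN ReZ Re_ipxx. Qed.

Lemma defect_ge0 h : 0 <= complex.Re (ip h (defect h)).
Proof.
have [_ rr1] := andP rr.
have h1 : complex.Re (ip h (Q 1 h)) <= nr h ^+ 2.
  apply: le_trans (Re_cab _) (le_trans (ip_CS _ _) _).
  by rewrite expr2 ler_wpM2l ?nr_ge0 ?Q_nr.
rewrite defect_Re subr_ge0; apply: le_trans (ler_piMl _ rr1) h1; exact: Q_ge0.
Qed.

Lemma defect_comm a h : defect (sigma a h) = sigma a (defect h).
Proof. by rewrite /defect (adjB (adjOp_adj _)) (adjZ (adjOp_adj _)) Q_comm. Qed.

Lemma defect_le h : complex.Re (ip h (defect h)) <= nr h ^+ 2.
Proof. by rewrite defect_Re gerBl mulr_ge0 ?sqr_ge0 ?Q_ge0. Qed.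

Definition eform : invariant_form sigma := InvariantForm defect_adj defect_ge0 defect_comm.

Local Notation EH := (hker hsigma eform).
Local Notation VE := (tens (fspace FX) EH).

(* Finitely supported vectors of the Fock space tensored with [H], for the inner
   product that [defect] induces on [H]. *)
Definition finite_fock : Type := {n : nat & (spX X n * H)%type}.
Definition mkff n (x : spX X n) (h : H) : finite_fock := existT _ n (x, h).
Definition ff_scal (c : C) (q : finite_fock) : finite_fock :=
  mkff (projT2 q).1 (c *: (projT2 q).2).
Definition ff_emb (q : finite_fock) : VE := (finc FX (projT2 q).1, (projT2 q).2).

Lemma ff_scalP c (i : VE) q : kf i (ff_emb (ff_scal c q)) = c * kf i (ff_emb q).
Proof. exact: (@kfZ _ VE c i (ff_emb q)). Qed.

Definition ff_ker : kernel R := pull_kernel ff_scalP.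

Lemma ff_emb_kf (p q : ff_ker) : kf (ff_emb p) (ff_emb q) = kf p q.
Proof. by []. Qed.

Lemma ff_kf n (x y : spX X n) h l :
  @kf _ ff_ker (mkff x h) (mkff y l) = ip h (sigma (hip x y) (defect l)).
Proof.
have [iso _] := direct_sum_hip (fdirect_sum FX).
by rewrite -ff_emb_kf tens_kfE /= iso defect_comm.
Qed.

Lemma ff_kf0 n m (x : spX X n) (y : spX X m) h l : n <> m ->
  @kf _ ff_ker (mkff x h) (mkff y l) = 0.
Proof.
move=> nm; have [_ orth] := direct_sum_hip (fdirect_sum FX).
by rewrite -ff_emb_kf tens_kfE /= orth // (star_hom0 hsigma) (adj0 defect_adj) ip0r.
Qed.

Lemma ff_dense : @dense_in R VE ff_ker ff_emb.
Proof.
apply: (@total_dense _ _ _ _ hsigma eform defect_le _ _ _ ff_ker ff_emb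
  (fun u h => mkff (projT2 u) h) (direct_sum_total hsigma (rep_normal0 hT) (fdirect_sum FX))).
by [].
Qed.

Section Family.
Variables (h : H) (u : forall n, seq (V n)).

(** [Phi^* h] has components [r^n T~_n^* h], without [D], which is part of the inner product. Here
    it is cut off at [N], with [u n] approximating [T~_n^* h]. *)
Definition family N : seq ff_ker :=
  flatten [seq [seq (mkff p.1 ((r ^+ n)%:C%C *: (p.2 : H)) : ff_ker) | p <- (u n : seq (spX X n * H))]
    | n <- index_iota 0 N].

Lemma family_bf1 N m (y : spX X m) l : (m < N)%N ->
  bf (family N) [:: (mkff y l : ff_ker)] =
  (r ^+ m)%:C%C * bf (u m) [:: ((y, defect l) : V m)].
Proof.
move=> mN; pose G n := \sum_(p <- u n) @kf _ ff_ker (mkff p.1 ((r ^+ n)%:C%C *: (p.2 : H))) (mkff y l).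
have -> : bf (family N) [:: (mkff y l : ff_ker)] = \sum_(n < N) G n.
  rewrite [LHS]big_flatten big_map big_mkord; apply: eq_bigr => n _.
  by rewrite big_map; apply: eq_bigr => p _; rewrite big_seq1.
rewrite (bigD1 (Ordinal mN)) //= big1 => [|i /eqP im]; last first.
  by apply: big1 => p _; apply: ff_kf0 => E; apply: im; apply: val_inj.
rewrite addr0 /G /bf mulr_sumr; apply: eq_bigr => p _.
by rewrite big_seq1 ff_kf ipZl conjc_real tens_kfE.
Qed.

Lemma bf_sumr (K : kernel R) (v w : seq K) : bf v w = \sum_(q <- w) bf v [:: q].
Proof.
rewrite /bf exchange_big; apply: eq_bigr => q _; apply: eq_bigr => p _.
by rewrite big_seq1.
Qed.

Lemma family_bf N : bf (family N) (family N) =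
  \sum_(0 <= n < N) (r ^+ (n + n))%:C%C * bf (u n) (hmap defect (u n)).
Proof.
rewrite [LHS]bf_sumr {2}/family big_flatten big_map big_nat [RHS]big_nat.
apply: eq_bigr => n /andP[_ nN]; rewrite big_map [bf (u n) _]bf_sumr big_map mulr_sumr.
apply: eq_bigr => p _; rewrite family_bf1 //= (adjZ defect_adj).
have -> : bf (u n) [:: ((p.1, (r ^+ n)%:C%C *: defect p.2) : V n)] =
    (r ^+ n)%:C%C * bf (u n) [:: ((p.1, defect p.2) : V n)].
  exact: (bf_scalr (r ^+ n)%:C%C (u n) [:: ((p.1, defect p.2) : V n)]).
by rewrite mulrA -rmorphM -exprD.
Qed.

Definition poisson_fun (q0 : ff_ker) : H :=
  let q : finite_fock := q0 in
  (r ^+ projT1 q)%:C%C *: T (projT2 q).1 (defect (projT2 q).2).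

Variable d : R.
Hypotheses (d0 : 0 < d) (d1 : d <= 1) (hu : forall n, apx (Tc n) h (u n) d).

(** The error is measured in the seminorms of [X(n) (x) H], not in that of [ff_ker], where [D] may
    be degenerate. So this is weaker than [apx], but it suffices for a fixed [v] as [d] tends to
    0. *)
Lemma family_apx N (v : seq ff_ker) : all (fun q => projT1 (q : finite_fock) < N)%N v ->
  cab (bf (family N) v - ip h (Ps poisson_fun v)) <=
  d * \sum_(q <- v) sn [:: (((projT2 q).1, defect (projT2 q).2) : V (projT1 q))].
Proof.
elim: v => [|[m [y l]] v IH] /=.
  by rewrite /Ps !big_nil ip0r bf_sumr big_nil subr0 cab0 mulr0.
move=> /andP[mN vN]; rewrite /Ps !big_cons /= mulrDr ipDr.
rewrite bf_sumr big_cons -bf_sumr opprD addrACA.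
apply: le_trans (cabD _ _) (lerD _ (IH vN)).
rewrite (family_bf1 y l mN) /poisson_fun /= ipZr -mulrBr cabM cabR.
have := @hu m [:: ((y, defect l) : V m)]; rewrite /Ps big_seq1 /= => h1.
apply: le_trans h1; rewrite ler_piMl ?cab_ge0 // ger0_norm ?exprn_ge0 ?(ltW r0) //.
by rewrite exprn_ile1 // ltW.
Qed.

Let c := 2 * nr h + 1.

Lemma apx_err (z : C) : cab z <= d * (nr h + d) + nr h * d -> cab z <= d * c.
Proof.
move=> hz; apply: le_trans hz _; rewrite /c.
have : d * d <= d * 1 by rewrite ler_pM2l.
lra.
Qed.

Lemma family_Q n : cab (bf (u n) (u n) - ip h (Q n h)) <= d * c.
Proof.
have := apx_bf (ltW d0) d0 (@hu n) (@hu n) => h1.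
exact: apx_err h1.
Qed.

Lemma Q1_bdd : bdd (Q 1) 1. Proof. by move=> x; rewrite mul1r Q_nr. Qed.

Lemma family_Q1 n : cab (bf (u n) (hmap (Q 1) (u n)) - ip h (Q n.+1 h)) <= d * c.
Proof.
have h1 := @hu n (hmap (Q 1) (u n)).
have h2 := T_step d0 (@hu n).
have h3 : sn (hmap (Q 1) (u n)) <= nr h + d.
  apply: le_trans (hmap_sn (@Q_adj _ _ _ _ _ _ hT 1) (Q_comm hT 1) Q1_bdd _) _.
  exact: apx_sn (ltW d0) (@hu n).
suff : cab (bf (u n) (hmap (Q 1) (u n)) - ip h (Q n.+1 h)) <= d * (nr h + d) + nr h * d.
  exact: apx_err.
apply: le_trans (cabB_le _ (ip h (Ps (Tc n) (hmap (Q 1) (u n)))) _) (lerD _ _).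
  by apply: le_trans h1 _; rewrite ler_wpM2l // ltW.
by rewrite -ipBr; apply: le_trans (ip_CS _ _) _; rewrite ler_wpM2l ?nr_ge0.
Qed.

Let al n := complex.Re (ip h (Q n h)).

Lemma family_term n :
  complex.Re (bf (u n) (hmap defect (u n))) <= al n - r ^+ 2 * al n.+1 + d * (2 * c).
Proof.
have -> : bf (u n) (hmap defect (u n)) =
    bf (u n) (u n) - (r ^+ 2)%:C%C * bf (u n) (hmap (Q 1) (u n)).
  rewrite /bf mulr_sumr -sumrB; apply: eq_bigr => p _; rewrite !big_map mulr_sumr -sumrB.
  apply: eq_bigr => q _; rewrite !tens_kfE /= /defect.
  by rewrite (adjB (adjOp_adj _)) (adjZ (adjOp_adj _)) ipBr ipZr.
rewrite ReD ReN ReZ.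
have h1 := le_trans (Re_cab _) (family_Q n); have h2 := le_trans (NRe_cab _) (family_Q1 n).
rewrite !ReD !ReN -/(al _) in h1 h2.
have [_ rr1] := andP rr; have dc : 0 <= d * c by rewrite mulr_ge0 ?(ltW d0) // addr_ge0 ?mulr_ge0 ?nr_ge0.
have := ler_wpM2l (sqr_ge0 r) h2; have := ler_wpM2r dc rr1; lra.
Qed.

Lemma family_sn N : sn (family N) ^+ 2 <= nr h ^+ 2 + d * (N%:R * (2 * c)).
Proof.
have dc : 0 <= d * (2 * c) by rewrite !mulr_ge0 ?(ltW d0) // addr_ge0 ?mulr_ge0 ?nr_ge0.
have b n : r ^+ (n + n) <= 1 by rewrite exprn_ile1 // ltW.
have bp n : 0 <= r ^+ n by rewrite exprn_ge0 // ltW.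
rewrite sn_sqr family_bf (big_morph _ (@ReD R) (erefl : complex.Re (0 : C) = 0)).
(* The remainder [r^(2 N) al N] is kept for the telescoping induction, then dropped because it is
   nonnegative. *)
suff : \sum_(0 <= n < N) complex.Re ((r ^+ (n + n))%:C%C * bf (u n) (hmap defect (u n))) <=
    al 0 - r ^+ (N + N) * al N + d * (N%:R * (2 * c)).
  move=> h1; apply: le_trans h1 _; rewrite lerD2r /al Q0 Re_ipxx gerBl.
  by rewrite mulr_ge0 ?Q_ge0.
elim: N => [|N IH]; first by rewrite big_nil add0n expr0 mul1r subrr mul0r mulr0 addr0.
rewrite big_nat_recr //= ReZ; apply: le_trans (lerD IH (ler_wpM2l (bp _) (family_term N))) _.
have -> : r ^+ (N.+1 + N.+1) = r ^+ (N + N) * r ^+ 2 by rewrite -exprD addn2 addSn addnS.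
have -> : N.+1%:R = N%:R + 1 :> R by rewrite -natr1.
have := ler_wpM2r dc (b N); rewrite mul1r; lra.
Qed.

Lemma family_poisson N :
  nr (Ps poisson_fun (family N) - h) <= d * (2 * N%:R) + r ^+ N * nr h.
Proof.
have bp n : 0 <= r ^+ n by rewrite exprn_ge0 // ltW.
have E : Ps poisson_fun (family N) =
    \sum_(0 <= n < N) (r ^+ (n + n))%:C%C *: (Ps (Tc n) (u n) - (r ^+ 2)%:C%C *: Ps (Tc n) (hmap (Q 1) (u n))).
  rewrite [LHS]big_flatten big_map; apply: eq_bigr => n _.
  rewrite big_map /Ps big_map scaler_sumr -sumrB scaler_sumr; apply: eq_bigr => p _.
  rewrite /poisson_fun /= (adjZ defect_adj) (adjZ (adjOp_adj _)) scalerA -rmorphM -exprD.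
  by rewrite /defect (adjB (adjOp_adj _)) (adjZ (adjOp_adj _)).
have key : nr (Ps poisson_fun (family N) - (h - (r ^+ (N + N))%:C%C *: Q N h)) <= d * (2 * N%:R).
  rewrite E; elim: (N) => [|n IH].
    by rewrite big_nil add0n expr0 scale1r Q0 subrr subr0 nr0 !mulr0.
  rewrite big_nat_recr //=.
  have -> : h - (r ^+ (n.+1 + n.+1))%:C%C *: Q n.+1 h = h - (r ^+ (n + n))%:C%C *: Q n h +
      (r ^+ (n + n))%:C%C *: (Q n h - (r ^+ 2)%:C%C *: Q n.+1 h).
    by rewrite scalerBr addrA subrK scalerA -rmorphM -exprD addn2 addSn addnS.
  rewrite opprD addrACA -scalerBr.
  have -> : n.+1%:R = n%:R + 1 :> R by rewrite -natr1.
  rewrite !mulrDr mulr1; apply: le_trans (nrD _ _) (lerD IH _).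
  have rn : r ^+ (n + n) <= 1 by rewrite exprn_ile1 // ltW.
  rewrite nrZr ger0_norm //; apply: le_trans (ler_piMl (nr_ge0 _) rn) _.
  have h1 : nr (Ps (Tc n) (u n) - Q n h) <= d by exact: (QfunP (Tc n) d0 (@hu n)).
  have h2 := T_step d0 (@hu n).
  have -> : Ps (Tc n) (u n) - (r ^+ 2)%:C%C *: Ps (Tc n) (hmap (Q 1) (u n)) -
      (Q n h - (r ^+ 2)%:C%C *: Q n.+1 h) =
      (Ps (Tc n) (u n) - Q n h) - (r ^+ 2)%:C%C *: (Ps (Tc n) (hmap (Q 1) (u n)) - Q n.+1 h).
    by rewrite scalerBr !opprD addrACA.
  apply: le_trans (nrD _ _) _; rewrite nrN nrZr ger0_norm ?sqr_ge0 //.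
  have [_ rr1] := andP rr; have := ler_pM (sqr_ge0 r) (nr_ge0 _) rr1 h2; lra.
apply: le_trans (nrB_le _ (h - (r ^+ (N + N))%:C%C *: Q N h) _) (lerD key _).
rewrite addrAC subrr add0r nrN nrZr ger0_norm // exprD -mulrA ler_wpM2l //.
apply: le_trans (ler_wpM2l (bp N) (Q_nr hT N h)) _.
by rewrite ler_piMl ?nr_ge0 // exprn_ile1 // ltW.
Qed.

End Family.

Lemma family_ex h (d : R) : 0 < d -> exists u : forall n, seq (V n), forall n, apx (Tc n) h (u n) d.
Proof.
move=> d0; exists (fun n => sval (cid (apx_ex (Tc n) h d0))) => n.
by case: cid.
Qed.

(** For [h = Phi v], [|h|^2 = <h, Phi v>] is close to the pairing of [family] with [v], and [family]
    has norm at most [|h|] up to an error that vanishes with [d], for [N] fixed by [v]. *)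
Lemma poisson_le (v : seq ff_ker) : nr (Ps poisson_fun v) <= sn v.
Proof.
set h := Ps poisson_fun v.
have [N vN] : exists N, all (fun q => projT1 (q : finite_fock) < N)%N v.
  elim: v {h} => [|q v [N hN]]; first by exists 0%N.
  exists (maxn (projT1 (q : finite_fock)).+1 N) => /=; rewrite leq_maxl /=.
  by apply: sub_all hN => p pN; apply: leq_trans pN (leq_maxr _ _).
pose cv := \sum_(q <- v) sn [:: (((projT2 (q : finite_fock)).1, defect (projT2 q).2) : V (projT1 q))].
pose cN := N%:R * (2 * (2 * nr h + 1)).
have cv0 : 0 <= cv by apply: sumr_ge0 => q _; exact: sn_ge0.
have cN0 : 0 <= cN by rewrite !mulr_ge0 // addr_ge0 ?mulr_ge0 ?nr_ge0.
rewrite -(@ler_pXn2r _ 2) ?nnegrE ?nr_ge0 ?sn_ge0 //.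
apply: (@le_small1 _ _ _ (cN + 2 * cv)); first by rewrite addr_ge0 // mulr_ge0.
move=> e e0 e1; have [u hu] := family_ex h e0.
have h1 := family_apx hu vN; have h2 := family_sn e0 e1 hu N.
rewrite -/cv -/h in h1; rewrite -/cN in h2.
have h3 : nr h ^+ 2 <= sn (family u N) * sn v + e * cv.
  rewrite -Re_ipxx; have := Re_cab (ip h h); have := cab_le (ip h h) (bf (family u N) v).
  rewrite cabBC; have := bf_CS (family u N) v; lra.
have := sqr_ge0 (sn (family u N) - sn v); rewrite !expr2 in h2 h3 *; lra.
Qed.

Lemma poisson_scal c (q : ff_ker) : poisson_fun (kscal c q) = c *: poisson_fun q.
Proof.
rewrite /poisson_fun /= (adjZ defect_adj) (adjZ (adjOp_adj _)) !scalerA.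
by rewrite mulrC.
Qed.

Definition poisson : contr H ff_ker := Contr poisson_scal poisson_le.

Lemma geometric_small (e : R) : 0 < e -> exists N, r ^+ N <= e.
Proof.
move=> e0; have r1' : 0 < r^-1 - 1 by rewrite subr_gt0 invf_gt1.
have b n : 1 + n%:R * (r^-1 - 1) <= r^-1 ^+ n.
  elim: n => [|n IH]; first by rewrite mul0r addr0 expr0.
  have n0 : 0 <= n%:R :> R by [].
  have := ler_wpM2r (ltW (addr_gt0 ltr01 r1')) IH; rewrite [1 + (_ - 1)]addrC subrK -exprSr.
  have := mulr_ge0 n0 (sqr_ge0 (r^-1 - 1)); rewrite -natr1 expr2; lra.
have [N hN] := archi_inv (mulr_gt0 e0 r1'); exists N.+1.
have Np : 0 < N.+1%:R :> R by rewrite ltr0n.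
have h1 := hN N (leqnn N); rewrite -[N.+1%:R^-1]mul1r ler_pdivrMr // in h1.
have h2 := b N.+1.
have pr : 0 < r ^+ N.+1 by rewrite exprn_gt0.
rewrite exprVn in h2.
have h3 : e^-1 <= (r ^+ N.+1)^-1.
  apply: le_trans h2; rewrite -[e^-1]mul1r ler_pdivrMr //.
  by move: h1; move: (N.+1%:R : R) => a; have := ltW e0; lra.
by rewrite lef_pV2 // in h3.
Qed.

(** As [|g| <= |h|], it suffices that [|h|^2 <= Re <h, g>]. For [w] near [Phi^* h] and a family [U],
    [|h|^2] is close to [<w, U>], at most [(|w|^2 + |U|^2) / 2], where [|w|^2] is close to [<h, g>]
    and [|U|^2] is at most [|h|^2] up to error. *)
Lemma poisson_Q h : Qfun poisson poisson h = h.
Proof.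
set g := Qfun _ _ h; set a := nr h; have a0 : 0 <= a by exact: nr_ge0.
suff ag : a ^+ 2 <= complex.Re (ip h g).
  apply/eqP; rewrite -subr_eq0; apply/eqP/nr_eq0/eqP; rewrite -sqrf_eq0 eq_le sqr_ge0 andbT.
  rewrite -Re_ipxx ipBl !ipBr !ReD !ReN ReD ReN -(ipC h g) ReJ !Re_ipxx.
  have : nr g ^+ 2 <= nr h ^+ 2 by rewrite ler_pXn2r ?nnegrE ?nr_ge0 // Qfun_nr.
  rewrite -/a; lra.
pose c := 2 * a + 1; have c0 : 0 <= c by rewrite addr_ge0 ?mulr_ge0.
pose K := 3 * c + 2 * (1 + a ^+ 2 + 2 * c) + 2 * (a * (2 + a)).
have K0 : 0 <= K by rewrite /K; have := sqr_ge0 a; have := mulr_ge0 a0 a0; lra.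
apply: (@le_small1 _ _ _ K) => // e e0 e1.
have [N rN] := geometric_small e0.
have Np : 0 < N%:R + 1 :> R by rewrite ltr_wpDl.
(* The errors of a family of length [N] grow like [d N], so [d] is chosen after [N]. *)
pose d := e / (N%:R + 1).
have d0 : 0 < d by rewrite divr_gt0.
have dN : d * N%:R + d = e by rewrite -[X in _ + X]mulr1 -mulrDr /d divfK // gt_eqF.
have dNp : 0 <= d * N%:R by rewrite mulr_ge0 // ltW.
have d1 : d <= 1 by lra.
have [u hu] := family_ex h d0; have [w hw] := apx_ex poisson h e0.
have h1 := family_sn d0 d1 hu N; have h2 := family_poisson d0 hu N.
rewrite -/a -/c in h1 h2; set U := family u N in h1 h2.
have h3 := hw U; rewrite -[Ps poisson U]/(Ps poisson_fun U) in h3.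
have h4 := apx_bf (ltW e0) e0 hw hw.
have ee : e * e <= e by rewrite ler_piMl // ltW.
have h5 : sn w ^+ 2 <= complex.Re (ip h g) + e * c.
  have := Re_cab (bf w w - ip h g); rewrite ReD ReN -sn_sqr -/a in h4 *.
  by rewrite -/a in h4; move: h4; rewrite /c; lra.
have ce : d * (N%:R * (2 * c)) <= e * (2 * c).
  have c2 : 0 <= 2 * c by rewrite mulr_ge0.
  have dNe : d * N%:R <= e by lra.
  by have := ler_wpM2r c2 dNe; rewrite -[d * N%:R * _]mulrA.
have h6 : a ^+ 2 <= sn w * sn U + e * sn U + a * (e * (2 + a)).
  have e2 : a * nr (h - Ps poisson_fun U) <= a * (e * (2 + a)).
    rewrite ler_wpM2l // nrBC; apply: le_trans h2 _.
    by have := ler_wpM2r a0 rN; lra.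
  have e3 : complex.Re (ip h (h - Ps poisson_fun U)) <= a * nr (h - Ps poisson_fun U).
    exact: le_trans (Re_cab _) (ip_CS _ _).
  have e4 : complex.Re (ip h (Ps poisson_fun U)) <= sn w * sn U + e * sn U.
    have := Re_cab (ip h (Ps poisson_fun U)); have := cab_le (ip h (Ps poisson_fun U)) (bf w U).
    rewrite cabBC; have := bf_CS w U; lra.
  rewrite ipBr ReD ReN Re_ipxx -/a in e3; lra.
have h7 : sn U <= 1 + sn U ^+ 2.
  by have := sqr_ge0 (sn U - 1); have := sn_ge0 U; rewrite !expr2; lra.
have h8 := sqr_ge0 (sn w - sn U).
have h9 : e * sn U <= e * (1 + a ^+ 2 + 2 * c).
  rewrite ler_wpM2l ?(ltW e0) //; have : e * (2 * c) <= 2 * c by rewrite ler_piMl ?mulr_ge0.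
  lra.
rewrite /K; rewrite !expr2 in h1 h5 h6 h7 h8 h9 *; lra.
Qed.

End Poisson.

(** * Polynomials *)

Section Polynomials.
Variables (R : realType) (M : cstarAlg R) (s : setting M) (X : standard_subproduct s).
Variables (H : hilbSpace R) (T : forall n, spX X n -> adjOp H) (hT : covariant_rep T).
Variable FX : fock X.
Local Notation C := (complex R).
Implicit Types p : sp_poly X.
Local Notation coef p n := (@pcoef _ _ _ _ p n).

(* With [r T = (r ^ n T_n)_n], [scaled_adj r p] is [p(r T)^*] and [scaled r p] is [p(r T)]. *)
Definition scaled_adj (r : R) p (g : H) : H :=
  conjc (pconst p) *: g + \sum_(n < (pdeg p).+1) (r ^+ n)%:C%C *: aadj (T (coef p n)) g.

Definition scaled (r : R) p (g : H) : H :=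
  pconst p *: g + \sum_(n < (pdeg p).+1) (r ^+ n)%:C%C *: T (coef p n) g.

Lemma scaled_ip r p g h : ip (scaled_adj r p g) h = ip g (scaled r p h).
Proof.
rewrite /scaled_adj /scaled ipDl ipDr ipZl ipZr conjcK ip_suml ip_sumr; congr (_ + _).
apply: eq_bigr => n _; rewrite ipZl ipZr conjc_real; congr (_ * _).
by rewrite -[LHS]ipC -[RHS]ipC; congr conjc; exact/esym/(adjP (T (coef p n))).
Qed.

Lemma scaled_adj1 p g : scaled_adj 1 p g = aadj (peval T p) g.
Proof. by rewrite /scaled_adj; under eq_bigr => n _ do rewrite expr1n scale1r. Qed.

Lemma scaled_adj_near p g : exists c, 0 <= c /\ forall r, 0 < r -> r < 1 ->
  nr (scaled_adj 1 p g - scaled_adj r p g) <= (1 - r) * c.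
Proof.
exists (\sum_(n < (pdeg p).+1) n%:R * nr (aadj (T (coef p n)) g)); split.
  by apply: sumr_ge0 => n _; rewrite mulr_ge0 ?nr_ge0.
move=> r r0 r1; rewrite /scaled_adj opprD addrACA subrr add0r -sumrB.
apply: le_trans (nr_sum _ _ _) _; rewrite mulr_sumr; apply: ler_sum => n _.
rewrite expr1n -scalerBl -rmorphB nrZr mulrA ler_wpM2r ?nr_ge0 //.
have rn1 : r ^+ n <= 1 by rewrite exprn_ile1 // ltW.
rewrite ger0_norm ?subr_ge0 //; elim: (n : nat) => [|k IH]; first by rewrite expr0 subrr mulr0.
have rk : r ^+ k <= 1 by rewrite exprn_ile1 // ltW.
have r1' : 0 <= 1 - r by rewrite subr_ge0 ltW.
have := ler_wpM2l r1' rk; rewrite exprS -natr1; lra.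
Qed.

Section Scaled.
Variable r : R.
Hypotheses (r0 : 0 < r) (r1 : r < 1).
Let hsigma : star_hom (@T 0 : M -> adjOp H) := rep_hom hT.
Local Notation J := (ff_ker hT FX r0 r1).
Local Notation VE := (tens (fspace FX) (hker hsigma (eform hT r0 r1))).
Local Notation Phi := (poisson hT FX r0 r1).
Let e : J -> VE := @ff_emb _ _ _ _ _ _ hT FX _ r0 r1.

Definition ff_shift n (x : spX X n) (q : J) : J :=
  @mkff _ _ _ X H _ (sp_prod x (projT2 (q : finite_fock X H)).1) (projT2 (q : finite_fock X H)).2.

Lemma ff_shift_emb n (x : spX X n) (q : J) :
  e (ff_shift x q) = (fshift FX x (e q).1, (e q).2).
Proof. by rewrite /e /ff_emb /= fshiftE. Qed.

Lemma ff_shift_poisson n (x : spX X n) (q : J) :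
  Phi (ff_shift x q) = (r ^+ n)%:C%C *: T x (Phi q).
Proof.
rewrite /= /poisson_fun /= (rep_mul hT) (adjZ (adjOp_adj _)) scalerA -rmorphM exprD.
by [].
Qed.

Definition ff_poly p (v : seq J) : seq J := scal (pconst p) v ++
  flatten [seq [seq ff_shift (coef p n) q | q <- v] | n <- index_enum 'I_(pdeg p).+1].

Lemma ff_poly_poisson p v : Ps Phi (ff_poly p v) = scaled r p (Ps Phi v).
Proof.
rewrite Ps_cat Ps_scal; congr (_ + _); rewrite [LHS]big_flatten big_map; apply: eq_bigr => n _.
rewrite big_map /Ps (adj_sum (adjOp_adj _)) scaler_sumr; apply: eq_bigr => q _.
exact: ff_shift_poisson.
Qed.

Local Notation B p := (peval (fshift FX) p).

Lemma ff_poly_bf p (z : seq VE) v : bf z (map e (ff_poly p v)) = bf z (tmap (B p) (map e v)).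
Proof.
rewrite /ff_poly map_cat bf_catr.
have -> : bf z (map e (scal (pconst p) v)) = pconst p * bf z (map e v).
  rewrite /bf mulr_sumr; apply: eq_bigr => i _; rewrite !big_map mulr_sumr.
  by apply: eq_bigr => q _; exact: ff_scalP.
have -> : bf z (map e (flatten [seq [seq ff_shift (coef p n) q | q <- v] | n <- index_enum 'I_(pdeg p).+1])) =
    \sum_(n < (pdeg p).+1) bf z (tmap (fshift FX (coef p n)) (map e v)).
  rewrite /bf [RHS]exchange_big; apply: eq_bigr => i _; rewrite big_map big_flatten big_map.
  apply: eq_bigr => n _; rewrite !big_map; apply: eq_bigr => q _.
  by rewrite ff_shift_emb.
move: (map e v) => w.
transitivity (\sum_(i <- z) (pconst p * (\sum_(q <- w) kf i q) + \sum_(n < (pdeg p).+1)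
    \sum_(q <- w) kf i ((fshift FX (coef p n) q.1, q.2) : VE))).
  rewrite big_split /= -mulr_sumr; congr (_ + _); rewrite exchange_big; apply: eq_bigr => n _.
  by apply: eq_bigr => i _; rewrite big_map.
apply: eq_bigr => i _; rewrite big_map mulr_sumr exchange_big -big_split; apply: eq_bigr => q _.
have E : B p q.1 = pconst p *: q.1 + \sum_(n < (pdeg p).+1) fshift FX (coef p n) q.1 by [].
transitivity (kf i.2 (mact (hip i.1 (B p q.1)) q.2)); last by [].
by rewrite E hipD hipZ mactD mactZ hip_sumr mact_sum.
Qed.

Lemma ff_sn (v : seq J) : sn (map e v) = sn v.
Proof. by have eE (i j : J) : kf (e i) (e j) = kf i j by []; exact: (sn_map eE v). Qed.

Lemma ff_poly_sn p v c : 0 < c -> bdd (B p) c -> sn (ff_poly p v) <= c * sn v.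
Proof.
move=> c0 Bc; rewrite -!ff_sn.
have -> : sn (map e (ff_poly p v)) = sn (tmap (B p) (map e v)).
  by apply: sn_ext => w; rewrite -bfC ff_poly_bf bfC.
exact: tmap_bdd (adjOp_adj (B p)) c0 Bc.
Qed.

(** The relation [Phi^* p(r T)^* = (p(S)^* (x) 1) Phi^*], for approximants. [p(S)^*] need not
    preserve finitely supported vectors, hence [fapx]. *)
Lemma fapx_poly p g (z : seq VE) d c : 0 <= d -> 0 < c -> bdd (B p) c ->
  fapx e Phi g z d -> fapx e Phi (scaled_adj r p g) (tmap (aadj (B p)) z) (d * c).
Proof.
move=> d0 c0 Bc hz w.
rewrite (tmap_adj _ _ (adjC (adjOp_adj (B p)))) -ff_poly_bf scaled_ip -ff_poly_poisson.
by apply: le_trans (hz _) _; rewrite -mulrA ler_wpM2l // ff_poly_sn.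
Qed.

Variables (t : nat) (p q : 'I_t -> sp_poly X).
Let A (x : fspace FX) := \sum_(i < t) B (p i) (aadj (B (q i)) x).
Let A' (x : fspace FX) := \sum_(i < t) B (q i) (aadj (B (p i)) x).

Lemma A_adj : adj A A'.
Proof.
move=> x y; rewrite hip_suml hip_sumr; apply: eq_bigr => i _.
by rewrite adjP -[LHS]hipC -[RHS]hipC adjP.
Qed.

Lemma peval_bdd (b : sp_poly X) : exists c : R, 0 < c /\ bdd (B b) c.
Proof.
have [c [c0 hc]] := adjOp_bdd (B b); exists (c + 1); split; first by rewrite ltr_wpDl.
by move=> x; apply: le_trans (hc x) _; rewrite ler_wpM2r ?nr_ge0 // lerDl.
Qed.

(** By [fapx_poly] and [poisson_Q], each summand is the inner product of [p_i(S)^* Phi^* g] and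
    [q_i(S)^* Phi^* h]; their sum is [<Phi^* g, A Phi^* h>]. *)
Lemma scaled_le g h c : 0 < c -> bdd A c ->
  cab (\sum_(i < t) ip (scaled_adj r (p i) g) (scaled_adj r (q i) h)) <= c * (nr g * nr h).
Proof.
move=> c0 Ac.
pose cp i := sval (cid (peval_bdd (p i))); pose cq i := sval (cid (peval_bdd (q i))).
have cp0 i : 0 < cp i by rewrite /cp; case: cid => ? [].
have cpB i : bdd (B (p i)) (cp i) by rewrite /cp; case: cid => ? [].
have cq0 i : 0 < cq i by rewrite /cq; case: cid => ? [].
have cqB i : bdd (B (q i)) (cq i) by rewrite /cq; case: cid => ? [].
pose k i := cp i * (nr (scaled_adj r (q i) h) + cq i) + nr (scaled_adj r (p i) g) * cq i.
have k0 i : 0 <= k i by rewrite addr_ge0 ?mulr_ge0 ?addr_ge0 ?nr_ge0 // ltW.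
apply: (@le_small1 _ _ _ (\sum_i k i + c * (nr g + nr h + 1))).
  by rewrite addr_ge0 ?mulr_ge0 ?addr_ge0 ?nr_ge0 ?(ltW c0) // sumr_ge0.
move=> d d0 d1; have [u hu] := apx_ex Phi g d0; have [w hw] := apx_ex Phi h d0.
have eE (i j : J) : kf (e i) (e j) = kf i j by [].
have fu := apx_fapx eE hu; have fw := apx_fapx eE hw.
have term i : cab (bf (tmap (aadj (B (p i))) (map e u)) (tmap (aadj (B (q i))) (map e w)) -
    ip (scaled_adj r (p i) g) (scaled_adj r (q i) h)) <= d * k i.
  have h1 := fapx_poly (ltW d0) (cp0 i) (cpB i) fu.
  have h2 := fapx_poly (ltW d0) (cq0 i) (cqB i) fw.
  have := fapx_bf eE (@ff_dense _ _ _ _ _ _ hT FX _ r0 r1)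
    (mulr_ge0 (ltW d0) (ltW (cp0 i))) (mulr_ge0 (ltW d0) (ltW (cq0 i))) h1 h2.
  rewrite poisson_Q => h3; apply: le_trans h3 _; rewrite /k !mulrDr !mulrA.
  rewrite lerD //; last by rewrite mulrAC mulrC mulrA.
  rewrite lerD //; rewrite -!mulrA ler_wpM2l ?(ltW d0) // ler_wpM2l ?(ltW (cp0 i)) //.
  by rewrite ler_piMl // ltW.
have E : \sum_i bf (tmap (aadj (B (p i))) (map e u)) (tmap (aadj (B (q i))) (map e w)) =
    bf (map e u) (tmap A (map e w)).
  under eq_bigr => i _ do rewrite (tmap_adj _ _ (adjC (adjOp_adj (B (p i))))).
  move: (map e u) (map e w) => a b; rewrite /bf exchange_big; apply: eq_bigr => x _.
  under eq_bigr => i _ do rewrite 2!big_map.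
  rewrite exchange_big big_map; apply: eq_bigr => y _.
  rewrite (_ : kf x _ = kf x.2 (mact (hip x.1 (A y.1)) y.2)) //.
  by rewrite hip_sumr mact_sum.
have h1 : cab (bf (map e u) (tmap A (map e w))) <= c * ((nr g + d) * (nr h + d)).
  apply: le_trans (bf_CS _ _) _.
  apply: le_trans (ler_wpM2l (sn_ge0 _) (tmap_bdd _ A_adj c0 Ac)) _.
  rewrite mulrCA ler_wpM2l ?(ltW c0) // !ff_sn ler_pM ?sn_ge0 //; exact: apx_sn (ltW d0) _.
apply: le_trans (cab_le _ (bf (map e u) (tmap A (map e w)))) _.
rewrite mulrDr addrA [X in X <= _]addrC [c * _ + _]addrC -addrA addrC -addrA.
have h2 : cab (\sum_i ip (scaled_adj r (p i) g) (scaled_adj r (q i) h) -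
    bf (map e u) (tmap A (map e w))) <= d * \sum_i k i.
  rewrite cabBC -E -sumrB; apply: le_trans (cab_sum _ _ _) _.
  by rewrite mulr_sumr; apply: ler_sum => i _; exact: term.
have h3 : c * ((nr g + d) * (nr h + d)) <= c * (nr g * nr h) + d * (c * (nr g + nr h + 1)).
  have dd : d * d <= d by rewrite ler_piMl // ltW.
  have := ler_wpM2l (ltW c0) dd; lra.
move: (le_trans h1 h3) h2; lra.
Qed.

End Scaled.

Lemma peval_le (t : nat) (p q : 'I_t -> sp_poly X) c h : 0 < c ->
  bdd (fun x : fspace FX => \sum_(i < t) peval (fshift FX) (p i) (aadj (peval (fshift FX) (q i)) x)) c ->
  nr (\sum_(i < t) peval T (p i) (aadj (peval T (q i)) h)) <= c * nr h.
Proof.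
move=> c0 Ac; set L := \sum_i _.
have key g : cab (ip g L) <= c * (nr g * nr h).
  have -> : ip g L = \sum_i ip (scaled_adj 1 (p i) g) (scaled_adj 1 (q i) h).
    rewrite /L ip_sumr; apply: eq_bigr => i _; rewrite !scaled_adj1.
    by rewrite -[LHS]ipC -[RHS]ipC; congr conjc; exact: (adjP (peval T (p i))).
  pose kp i := sval (cid (scaled_adj_near (p i) g)).
  pose kq i := sval (cid (scaled_adj_near (q i) h)).
  have kp0 i : 0 <= kp i by rewrite /kp; case: cid => ? [].
  have kq0 i : 0 <= kq i by rewrite /kq; case: cid => ? [].
  have hp i r : 0 < r -> r < 1 -> nr (scaled_adj 1 (p i) g - scaled_adj r (p i) g) <= (1 - r) * kp i.
    by rewrite /kp; case: cid => ? [? hh]; exact: hh.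
  have hq i r : 0 < r -> r < 1 -> nr (scaled_adj 1 (q i) h - scaled_adj r (q i) h) <= (1 - r) * kq i.
    by rewrite /kq; case: cid => ? [? hh]; exact: hh.
  pose k i := nr (scaled_adj 1 (p i) g) * kq i + kp i * (nr (scaled_adj 1 (q i) h) + kq i).
  apply: (@le_small1 _ _ _ (2 * \sum_i k i)).
    by rewrite mulr_ge0 // sumr_ge0 // => i _; rewrite addr_ge0 ?mulr_ge0 ?addr_ge0 ?nr_ge0.
  (* Any [r] tending to 1 with [d] would do; halving keeps [r > 0] at [d = 1]. *)
  move=> d d0 d1; pose r := 1 - d / 2.
  have r0 : 0 < r by rewrite /r; lra.
  have r1 : r < 1 by rewrite /r; lra.
  have rd : 1 - r = d / 2 by rewrite /r; lra.
  have := scaled_le r0 r1 g h c0 Ac.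
  set S := \sum_i _ => hS; apply: le_trans (cab_le _ S) _; rewrite addrC; apply: lerD => //.
  rewrite /S -sumrB mulr_sumr mulr_sumr; apply: le_trans (cab_sum _ _ _) _.
  apply: ler_sum => i _.
  set a := scaled_adj 1 (p i) g; set b := scaled_adj 1 (q i) h.
  set a' := scaled_adj r (p i) g; set b' := scaled_adj r (q i) h.
  have -> : ip a b - ip a' b' = ip a (b - b') + ip (a - a') b'.
    by rewrite ipBr ipBl addrA subrK.
  have ha := hp i r r0 r1; have hb := hq i r r0 r1; rewrite rd -/a -/a' -/b -/b' in ha hb.
  have b1 : nr b' <= nr b + kq i.
    have := nr_le b' b; rewrite nrBC; have : d / 2 * kq i <= kq i by rewrite ler_piMl //; lra.
    lra.
  apply: le_trans (cabD _ _) _; apply: le_trans (lerD (ip_CS _ _) (ip_CS _ _)) _.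
  have t1 := ler_wpM2l (nr_ge0 a) hb.
  have t2 := ler_pM (nr_ge0 _) (nr_ge0 _) ha b1.
  have t3 : 0 <= d * k i.
    by rewrite mulr_ge0 ?(ltW d0) // addr_ge0 ?mulr_ge0 ?addr_ge0 ?nr_ge0.
  move: t3; rewrite /k -/a -/b; lra.
have [->|L0] := eqVneq (nr L) 0; first by rewrite mulr_ge0 ?nr_ge0 // ltW.
have Lp : 0 < nr L by rewrite lt_def L0 nr_ge0.
rewrite -(ler_pM2l Lp) -expr2 -Re_ipxx; apply: le_trans (Re_cab _) (le_trans (key L) _).
by rewrite mulrCA.
Qed.

End Polynomials.

(** * Operator norms and the inequality *)

Lemma opnorm_bdd (R : realType) (M : cstarAlg R) (F : hilbMod M) (f g : F -> F) :
  adj f g -> 0 <= opnorm f /\ bdd f (opnorm f).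
Proof.
move=> fg; have [c [c0 fc]] := adj_bounded (@CS_hip _ _ F) fg.
have ub : has_ubound [set complex.Re `|f x| | x in [set x : F | `|x| <= 1]].
  exists c => _ [x /= x1 <-]; apply: le_trans (fc x) _.
  by rewrite ler_piMr // -lecR -nrE.
have le x : nr x <= 1 -> nr (f x) <= opnorm f.
  move=> x1; apply: (ub_le_sup ub); exists x => //=.
  by rewrite nrE lecR.
split; first by have := le 0; rewrite nr0 (adj0 fg) nr0; apply.
move=> x; have [x0|x0] := eqVneq (nr x) 0.
  by rewrite (nr_eq0 x0) (adj0 fg) nr0 mulr0.
have xp : 0 < nr x by rewrite lt_def x0 nr_ge0.
have := le ((nr x)^-1%:C%C *: x); rewrite (adjZ fg) !nrZr gtr0_norm ?invr_gt0 // mulVf //.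
by move=> /(_ (lexx _)); rewrite mulrC ler_pdivrMr // mulrC.
Qed.

Theorem corollary2p18 (R : realType) (M : cstarAlg R) (s : setting M)
    (X : standard_subproduct s) (FX : fock X)
    (H : hilbSpace R) (T : forall n, spX X n -> adjOp H)
    (hT : covariant_rep T)
    (t : nat) (p q : 'I_t -> sp_poly X) :
  opnorm (fun h : H =>
    \sum_(i < t) peval T (p i) (aadj (peval T (q i)) h)) <=
  opnorm (fun x : fspace FX =>
    \sum_(i < t) peval (fshift FX) (p i) (aadj (peval (fshift FX) (q i)) x)).
Proof.
set A := fun x : fspace FX => _.
have [c0 Ac] := opnorm_bdd (A_adj (FX := FX) p q).
apply: ge_sup.
  by eexists; exists 0 => //=; rewrite normr0.
(* The slack [d] makes the bound strictly positive, as [peval_le] requires, even if the norm on the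
   Fock space is 0. *)
move=> _ [h /= h1 <-]; apply: (@le_small _ _ _ 1) => // d d0; rewrite mulr1.
have cd : 0 < opnorm A + d by rewrite ltr_wpDl.
have Acd : bdd A (opnorm A + d).
  by move=> x; apply: le_trans (Ac x) _; rewrite ler_wpM2r ?nr_ge0 // lerDl ltW.
apply: le_trans (peval_le hT h cd Acd) _.
by rewrite ler_piMr ?(ltW cd) // -lecR -nrE.
Qed.
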